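(* Let $\mathcal P\subset\mathcal P_0$ and $C,c>0$. Assume $A_fA_g=o_{\mathcal P}(n^{-1})$, $B_f=o_{\mathcal P}(1)$, $B_g=o_{\mathcal P}(1)$, that there exists $\eta>0$ with $\sup_{P\in\mathcal P}\mathbb E_P[|\epsilon_P\xi_P|^{2+\eta}]<\infty$, and that $\mathcal W_{P,C,c}$ is nonempty for all $P\in\mathcal P$. Then $\sup_{P\in\mathcal P}\sup_{w\in\mathcal W_{P,C,c}}\sup_{t\in\mathbb R}|\mathbb P_P(T_w^{(n)}\le t)-\Phi(t)|\to0$.
   Context: Let $X,Y$ be real-valued random variables and $Z$ a random vector in $\mathbb R^{d_Z}$. $\mathcal E_0$ is the set of distributions of $(X,Y,Z)$ absolutely continuous with respect to Lebesgue measure, $\mathcal P_0\subseteq\mathcal E_0$ those under which $X$ and $Y$ are conditionally independent given $Z$. For $P\in\mathcal E_0$: $f_P(z)=\mathbb E_P[X\mid Z=z]$, $g_P(z)=\mathbb E_P[Y\mid Z=z]$, $\epsilon_P=X-f_P(Z)$, $\xi_P=Y-g_P(Z)$, $u_P(z)=\mathbb E_P[\epsilon_P^2\mid Z=z]$, $v_P(z)=\mathbb E_P[\xi_P^2\mid Z=z]$. Data $(x_i,y_i,z_i)$, $i=1,\dots,n$, i.i.d. copies of $(X,Y,Z)$; $\hat f$ obtained by regressing $\mathbf X^{(n)}$ on $\mathbf Z^{(n)}$, $\hat g$ by regressing $\mathbf Y^{(n)}$ on $\mathbf Z^{(n)}$. $A_f=\frac1n\sum_i(f_P(z_i)-\hat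 f(z_i))^2$, $A_g=\frac1n\sum_i(g_P(z_i)-\hat g(z_i))^2$, $B_f=\frac1n\sum_i(f_P(z_i)-\hat f(z_i))^2v_P(z_i)$, $B_g=\frac1n\sum_i(g_P(z_i)-\hat g(z_i))^2u_P(z_i)$. $\mathcal W_{P,C,c}$ is the set of measurable $w:\mathbb R^{d_Z}\to\mathbb R$ with $|w|\le C$ and $\mathbb E_P[\epsilon_P^2\xi_P^2w(Z)^2]\ge c$. For such $w$, $R_{w,i}=(x_i-\hat f(z_i))(y_i-\hat g(z_i))w(z_i)$ and $T_w^{(n)}=\frac{\frac1{\sqrt n}\sum_iR_{w,i}}{(\frac1n\sum_iR_{w,i}^2-(\frac1n\sum_rR_{w,r})^2)^{1/2}}$. $\Phi$ is the standard normal distribution function. $V_n=o_{\mathcal P}(W_n)$ means $\sup_{P\in\mathcal P}\mathbb P_P(|V_n/W_n|>\delta)\to0$ for all $\delta>0$. *)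

(* Defs.v *)
From HB Require Import structures.
From mathcomp Require Import all_boot all_order all_algebra.
From mathcomp Require Import all_classical all_reals all_analysis.
Set Implicit Arguments.
Unset Strict Implicit.
Unset Printing Implicit Defensive.
Import Order.TTheory GRing.Theory Num.Theory.
Import numFieldNormedType.Exports.
Local Open Scope classical_set_scope.
Local Open Scope ring_scope.

Section GCM.
Variables (R : realType) (dZ : nat).

(* Z takes values in R^{dZ}, with the product (= Borel) sigma-algebra. *)
Definition Zsp := (dZ.-tuple R)%type.
(* An observation (X, Y, Z) : t.1.1 = X, t.1.2 = Y, t.2 = Z. *)
Definition Obs := (R * R * Zsp)%type.

Definition crd (t : Obs) : seq R := [:: t.1.1, t.1.2 & (t.2 : seq R)].

Definition obox (a b : Obs) : set Obs :=
  [set t | forall j : 'I_(dZ.+2),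
     nth 0 (crd a) j <= nth 0 (crd t) j <= nth 0 (crd b) j].
Definition obox_vol (a b : Obs) : R :=
  \prod_(j < dZ.+2) Num.max (nth 0 (crd b) j - nth 0 (crd a) j) 0.

Definition lebesgue_null (A : set Obs) : Prop :=
  forall e : R, 0 < e -> exists a b : nat -> Obs,
    A `<=` \bigcup_k obox (a k) (b k) /\
    forall N, \sum_(k < N) obox_vol (a k) (b k) <= e.

Definition abs_cont (P : probability Obs R) : Prop :=
  forall A : set Obs, measurable A -> lebesgue_null A -> P A = 0%E.

Definition cond_exp (P : probability Obs R) (phi : Obs -> R) (h : Zsp -> R)
  : Prop :=
  measurable_fun setT phi /\ measurable_fun setT h /\
  (P.-integrable setT (EFin \o phi) \/ (forall t, 0 <= phi t)) /\
  forall C : set Zsp, measurable C ->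
    (\int[P]_(t in [set t | C t.2]) (phi t)%:E =
     \int[P]_(t in [set t | C t.2]) (h t.2)%:E)%E.

Definition cond_indep (P : probability Obs R) : Prop :=
  forall A B : set R, measurable A -> measurable B ->
  exists hA hB : Zsp -> R,
    cond_exp P (fun t => \1_A t.1.1) hA /\
    cond_exp P (fun t => \1_B t.1.2) hB /\
    cond_exp P (fun t => \1_A t.1.1 * \1_B t.1.2) (fun z => hA z * hB z).

Definition P0 (P : probability Obs R) : Prop := abs_cont P /\ cond_indep P.

(* W_{P,C,c} (f, g are versions of f_P, g_P) *)
Definition Wset (P : probability Obs R) (f g : Zsp -> R) (C c : R)
  (w : Zsp -> R) : Prop :=
  measurable_fun setT w /\ (forall z, `|w z| <= C) /\
  (c%:E <= \int[P]_t ((t.1.1 - f t.2) ^+ 2 * (t.1.2 - g t.2) ^+ 2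
                        * w t.2 ^+ 2)%:E)%E.

Section Sample.
Context {dO : measure_display} {Omega : measurableType dO}.

Definition iid (Pr : probability Omega R) (D : nat -> Omega -> Obs)
  (P : probability Obs R) : Prop :=
  (forall i, measurable_fun setT (D i)) /\
  (forall i (A : set Obs), measurable A -> Pr (D i @^-1` A) = P A) /\
  (forall (I : seq nat) (A : nat -> set Obs), uniq I ->
     (forall i, measurable (A i)) ->
     Pr (\big[setI/setT]_(i <- I) (D i @^-1` A i)) =
     (\prod_(i <- I) Pr (D i @^-1` A i))%E).

Variable (D : nat -> Omega -> Obs).

Definition Xdat n (om : Omega) : n.-tuple R := [tuple (D i om).1.1 | i < n].
Definition Ydat n (om : Omega) : n.-tuple R := [tuple (D i om).1.2 | i < n].
Definition Zdat n (om : Omega) : n.-tuple Zsp := [tuple (D i om).2 | i < n].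

Definition regression := forall n : nat, n.-tuple R -> n.-tuple Zsp -> Zsp -> R.

Definition measurable_regression (est : regression) : Prop :=
  forall n, measurable_fun setT
    (fun p : (n.-tuple R * n.-tuple Zsp) * Zsp => est n p.1.1 p.1.2 p.2).

Variables (estf estg : regression).

Definition fhat n om : Zsp -> R := estf (Xdat n om) (Zdat n om).
Definition ghat n om : Zsp -> R := estg (Ydat n om) (Zdat n om).

Definition A_f (f : Zsp -> R) n om : R :=
  n%:R^-1 * \sum_(i < n) (f (D i om).2 - fhat n om (D i om).2) ^+ 2.
Definition A_g (g : Zsp -> R) n om : R :=
  n%:R^-1 * \sum_(i < n) (g (D i om).2 - ghat n om (D i om).2) ^+ 2.
Definition B_f (f v : Zsp -> R) n om : R :=
  n%:R^-1 * \sum_(i < n)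
     (f (D i om).2 - fhat n om (D i om).2) ^+ 2 * v (D i om).2.
Definition B_g (g u : Zsp -> R) n om : R :=
  n%:R^-1 * \sum_(i < n)
     (g (D i om).2 - ghat n om (D i om).2) ^+ 2 * u (D i om).2.

Definition Rw (w : Zsp -> R) n om (i : nat) : R :=
  ((D i om).1.1 - fhat n om (D i om).2) *
  ((D i om).1.2 - ghat n om (D i om).2) * w (D i om).2.

Definition Tstat (w : Zsp -> R) n om : R :=
  let S1 := \sum_(i < n) Rw w n om i in
  let S2 := \sum_(i < n) Rw w n om i ^+ 2 in
  (S1 / Num.sqrt n%:R) /
  Num.sqrt (S2 / n%:R - (S1 / n%:R) ^+ 2).

End Sample.

Definition littleo_unif {dO : measure_display} {Omega : measurableType dO}
  (Pset : set (probability Obs R)) (Pr : probability Obs R -> probability Omega R)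
  (V : probability Obs R -> nat -> Omega -> R) (W : nat -> R) : Prop :=
  forall delta : R, 0 < delta -> forall e : R, 0 < e ->
  exists N : nat, forall n : nat, (N <= n)%N ->
  forall P, Pset P ->
    (Pr P [set om | (delta < `|V P n om / W n|)%R] <= e%:E)%E.

End GCM.

Definition Phi {R : realType} (t : R) : \bar R :=
  normal_prob 0 1 `]-oo, t].

(* Main.v *)
Require Import Defs.
From HB Require Import structures.
From mathcomp Require Import all_boot all_order all_algebra.
From mathcomp Require Import all_classical all_reals all_analysis measurable_realfun.
From mathcomp Require Import ring lra.
(** The proof runs a Lindeberg replacement directly on [Phi].  The function
    [(th, y) |-> Phi (y / sqrt th)] solves the heat equation, so moving one
    standardized observation from the sum to the variance [th] costs only
    [o(1/n)], uniformly under a uniform moment bound; starting from a small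
    [th = s^2] instead of [0] plays the role of a smoothing kernel.  This gives
    a central limit theorem for [epsilon xi w / sigma] that is uniform over
    the class.

    The remaining part of [R_i] is controlled by second moments.  Given the
    sample with the [Y_i] hidden, the errors [f - fhat] are constants, and
    conditional independence makes the [xi_i] centred and orthogonal, with
    conditional second moments [v_P(Z_i)]; on the event [B_f <= b], which the
    hidden sample determines, the squared cross term is thus at most [C^2 b] on
    average.  The other cross term is symmetric, and the product term is
    handled by Cauchy-Schwarz and [A_f A_g].  Finally, [T <= t] is squeezed
    between events [N <= l t + x] with [l] close to 1 and [x] close to 0, and
    [sup_t |Phi (l t) - Phi t| = O(|l - 1|)] makes this uniform in [t]. *)

Set Implicit Arguments.
Unset Strict Implicit.
Unset Printing Implicit Defensive.
Import Order.TTheory GRing.Theory Num.Theory.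
Import numFieldNormedType.Exports.
Local Open Scope classical_set_scope.
Local Open Scope ring_scope.


(** * The normal distribution function *)

(** Uniformity dictates the form of the estimates: they are explicit inequalities for a fixed sample
    size, and the threshold for [n] is chosen before [P] and [w]. Independence is used in one shape
    only: replacing a single observation by a fresh draw leaves the law of the sample unchanged.
    Averaging over the fresh draw with the other observations frozen gives both the Lindeberg step
    and the orthogonality of the noise terms. Conditional expectations are known only through
    integrals over events that depend on Z, and conditional independence only through pairs of
    events, with versions that may change from pair to pair. No conditional law is constructed:
    identities are checked on a pi-system and extended to nonnegative functions by uniqueness of
    measures. The weights multiplying the noise come from arbitrary estimators, so the products may
    fail to be integrable; centring is therefore an equality of integrals of positive and negative
    parts, and second moments are compared as extended reals until a cutoff makes them finite. *)

Section normal_cdf.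
Context {R : realType}.
Implicit Types (x y z p l : R).

(** The endpoints come in no fixed order, since the increments to which this is applied have either
    sign. *)
Lemma mvt_le (f df : R -> R) (K a b : R) :
  (forall x, Num.min a b <= x <= Num.max a b ->
     is_derive x 1 f (df x) /\ `|df x| <= K) ->
  `|f b - f a| <= K * `|b - a|.
Proof.
wlog ab : a b / a <= b => [hw|] H.
  have [ab|ba] := leP a b; first exact: hw.
  by rewrite distrC (distrC b); apply: hw; [exact: ltW|rewrite minC maxC].
rewrite (min_idPl ab) (max_idPr ab) in H.
have ctf : {within `[a, b], continuous f}.
  apply: derivable_within_continuous => x; rewrite in_itv/= => xab.
  by have [[]] := H _ xab.
have drf x : x \in `]a, b[%R -> is_derive x 1 f (df x).
  by rewrite in_itv/= => /andP[xa xb]; have [] := H x _; rewrite // !ltW.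
have [c] := @MVT_segment _ f df _ _ ab drf ctf.
rewrite in_itv/= => cab ->; rewrite normrM ler_wpM2r//.
by have [] := H _ cab.
Qed.

Lemma is_derive_compE (f g : R -> R) (a b x : R) :
  is_derive (g x) 1 f a -> is_derive x 1 g b ->
  is_derive x 1 (fun y => f (g y)) (a * b).
Proof. exact: is_derive1_comp. Qed.

Definition gpdf x : R := normal_pdf 0 1 x.

Definition gcdf x : R := fine (Phi x).

Lemma gpdfE x : gpdf x = normal_peak 1 * expR (- (x ^+ 2 / 2)).
Proof.
rewrite /gpdf normal_pdfE ?oner_eq0// /normal_fun subr0 expr1n mulNr.
by rewrite mulr2n.
Qed.

Lemma gcdf_fin x : Phi x = (gcdf x)%:E.
Proof. by rewrite /gcdf fineK// /Phi fin_num_measure. Qed.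

Lemma gcdf_ge0 x : 0 <= gcdf x.
Proof. by rewrite fine_ge0. Qed.

Lemma gcdf_le1 x : gcdf x <= 1.
Proof. by rewrite -lee_fin -gcdf_fin; exact: probability_le1. Qed.

Lemma gcdf_nd x y : x <= y -> gcdf x <= gcdf y.
Proof.
move=> xy; rewrite -lee_fin -!gcdf_fin /Phi le_measure ?inE//.
exact: subitvPr.
Qed.

Lemma gcdf_derive x : is_derive x 1 gcdf (gpdf x).
Proof.
have intf : lebesgue_measure.-integrable [set` Interval -oo%O (BRight (x + 1))]
    (EFin \o gpdf).
  by apply: integrableS (integrable_normal_pdf 0 1).
have cf : {for x, continuous gpdf}.
  by apply: continuous_normal_pdf; rewrite oner_eq0.
have xx1 : x < x + 1 by rewrite ltrDl.
have [] := @continuous_FTC1 R gpdf -oo%O x (x + 1) xx1 intf (ltNyr _) cf.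
rewrite derive1E => df <-; exact: DeriveDef.
Qed.

Lemma gpdf_derive x : is_derive x 1 gpdf (- (x * gpdf x)).
Proof.
have -> : gpdf = fun x => normal_peak 1 * expR (- (2^-1 * x ^+ 2)).
  by apply/funext => y; rewrite gpdfE (mulrC 2^-1).
apply: is_derive_eq.
rewrite /GRing.scale/= !(mulr0, add0r, addr0, mulr1).
by field.
Qed.

(** One constant bounds [|x| ^ k * gpdf x] for every [k] up to 3. The factor 17 is a convenient one
    with [1 + u ^ 4 <= 17 (1 + u ^ 2 / 4) ^ 2]. *)
Definition gK : R := 17 * normal_peak 1.

Lemma gK_ge0 : 0 <= gK.
Proof. by rewrite mulr_ge0 ?normal_peak_ge0. Qed.

Lemma gpdf_ge0 x : 0 <= gpdf x.
Proof. exact: normal_pdf_ge0. Qed.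

(** [expR (u ^ 2 / 2)] is the square of [expR (u ^ 2 / 4)], hence at least [(1 + u ^ 2 / 4) ^ 2],
    which dominates degree four. *)
Lemma gpdf_le (k : nat) x : (k <= 3)%N -> `|x| ^+ k * gpdf x <= gK.
Proof.
move=> k3; rewrite gpdfE mulrCA /gK [leRHS]mulrC ler_wpM2l ?normal_peak_ge0//.
rewrite expRN ler_pdivrMr ?expR_gt0//.
rewrite -(real_normK (num_real x)); set u := `|x|.
have u0 : 0 <= u by exact: normr_ge0.
have e4 : expR (u ^+ 2 / 2) >= (1 + u ^+ 2 / 4) ^+ 2.
  have -> : u ^+ 2 / 2 = u ^+ 2 / 4 * 2%:R by field.
  rewrite expRM_natr lerXn2r ?nnegrE ?expR_ge0 ?expR_ge1Dx//.
  by rewrite addr_ge0// divr_ge0// sqr_ge0.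
have uk : u ^+ k <= 1 + u ^+ 4.
  have [u1|u1] := leP u 1.
    by rewrite (@le_trans _ _ 1) ?exprn_ile1// lerDl exprn_ge0.
  rewrite (@le_trans _ _ (u ^+ 4)) ?lerDr//.
  by rewrite ler_weXn2l ?ltW// (leq_trans k3).
apply: (le_trans uk); apply: (@le_trans _ _ (17 * (1 + u ^+ 2 / 4) ^+ 2)).
  nra.
by rewrite ler_wpM2l.
Qed.

Lemma gcdf_lip x y : `|gcdf y - gcdf x| <= gK * `|y - x|.
Proof.
apply: mvt_le => z _; split; first exact: gcdf_derive.
by rewrite ger0_norm ?gpdf_ge0//; have := gpdf_le z (isT : (0 <= 3)%N); rewrite expr0 mul1r.
Qed.

(** The second derivative of the remainder is both bounded and Lipschitz at 0, whence the minimum.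
    Small increments thus cost a third power, and large ones only a square, which is all that a tail
    bound on second moments can absorb. *)
Lemma gcdf_taylor z p :
  `|gcdf (z + p) - gcdf z - p * gpdf z + p ^+ 2 / 2 * (z * gpdf z)|
  <= 2 * gK * (Num.min 1 `|p| * p ^+ 2).
Proof.
(* [r1] and [r2] are the first two derivatives of the remainder [r0]. As [r0] and [r1] vanish at 0,
   a bound on [r2] integrates twice. *)
pose r2 x := - ((z + x) * gpdf (z + x)) + z * gpdf z.
pose r1 x := gpdf (z + x) - gpdf z + x * (z * gpdf z).
pose r0 x := gcdf (z + x) - gcdf z - x * gpdf z + x ^+ 2 / 2 * (z * gpdf z).
have dsh (f : R -> R) df x : (forall y, is_derive y 1 f (df y)) ->
    is_derive x 1 (fun y => f (z + y)) (df (z + x)).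
  move=> h; rewrite -[df _]mulr1; apply: (@is_derive_compE f (fun y => z + y)) => //.
  by have := is_deriveD (is_derive_cst z x 1) (is_derive_id x 1); rewrite add0r.
have dr1 x : is_derive x 1 r1 (r2 x).
  have h := dsh _ _ x gpdf_derive.
  rewrite /r1; apply: is_derive_eq.
  by rewrite /GRing.scale/= !(mulr0, add0r, addr0, mulr1) oppr0 addr0 /r2.
have dr0 x : is_derive x 1 r0 (r1 x).
  have h := dsh _ _ x gcdf_derive.
  have -> : r0 = fun x => gcdf (z + x) - gcdf z - x * gpdf z
     + x ^+ 2 * (2^-1 * (z * gpdf z)) by apply/funext => y; rewrite /r0; field.
  apply: is_derive_eq.
  by rewrite /GRing.scale/= /r1; field.
have bxg x : `|x * gpdf x| <= gK.
  by rewrite normrM (ger0_norm (gpdf_ge0 _)); exact: (@gpdf_le 1).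
have r2a x : `|r2 x| <= 2 * gK.
  rewrite /r2 (le_trans (ler_normD _ _))// normrN mulr_natl mulr2n.
  by rewrite lerD.
have r2b x : `|r2 x| <= 2 * gK * `|x|.
  have := @mvt_le (fun y => y * gpdf y)
    (fun y => gpdf y - y ^+ 2 * gpdf y) (2 * gK) z (z + x).
  have -> : z + x - z = x by ring.
  have -> : r2 x = - ((z + x) * gpdf (z + x) - z * gpdf z) by rewrite /r2; ring.
  rewrite normrN; apply => y _; split.
    have h := gpdf_derive y; apply: is_derive_eq.
    by rewrite /GRing.scale/=; ring.
  rewrite (le_trans (ler_normB _ _))// mulr_natl mulr2n lerD//.
    rewrite ger0_norm ?gpdf_ge0//.
    by have := gpdf_le y (isT : (0 <= 3)%N); rewrite expr0 mul1r.
  by rewrite normrM normrX (ger0_norm (gpdf_ge0 _)); exact: gpdf_le.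
pose M := 2 * gK * Num.min 1 `|p|.
have M0 : 0 <= M.
  by apply: mulr_ge0; [rewrite mulr_ge0 ?gK_ge0|rewrite le_min ler01 normr_ge0].
have r2M x : `|x| <= `|p| -> `|r2 x| <= M.
  move=> xp; rewrite /M; have [p1|p1] := leP 1 `|p|; first by rewrite mulr1.
  apply: le_trans (r2b x) _; apply: ler_wpM2l => //; apply: mulr_ge0 => //.
  exact: gK_ge0.
have btw x y : Num.min 0 x <= y <= Num.max 0 x -> `|y| <= `|x|.
  have [x0|x0] := leP 0 x; move=> /andP[? ?].
    by rewrite !ger0_norm.
  by rewrite !ler0_norm ?lerN2// ltW.
have r1M x : `|x| <= `|p| -> `|r1 x| <= M * `|p|.
  move=> xp; have := @mvt_le r1 r2 M 0 x.
  have -> : r1 0 = 0 by rewrite /r1 addr0 subrr mul0r addr0.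
  rewrite !subr0 => /(_ _)/le_trans; apply; last by rewrite ler_wpM2l.
  by move=> y /btw yx; split; [exact: dr1|apply: r2M; exact: le_trans xp].
have := @mvt_le r0 r1 (M * `|p|) 0 p.
have -> : r0 0 = 0 by rewrite /r0 addr0 subrr !mul0r expr0n/= !mul0r subrr addr0.
rewrite !subr0 => /(_ _)/le_trans; apply.
  by move=> y /btw yx; split; [exact: dr0|exact: r1M].
by rewrite -mulrA -expr2 real_normK ?num_real// /M !mulrA.
Qed.

(** The derivative in [l] is [z * gpdf (l * z)], that is [1 / l] times the bounded function
    [x * gpdf x] at [x = l * z]. This makes the bound uniform in [z]. *)
Lemma gcdf_scale l z : 2^-1 <= l -> `|gcdf (l * z) - gcdf z| <= 2 * gK * `|l - 1|.
Proof.
move=> l2; have := @mvt_le (fun l => gcdf (l * z)) (fun l => z * gpdf (l * z))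
  (2 * gK) 1 l.
rewrite mul1r; apply => x /andP[x1 _].
have x2 : 2^-1 <= x by rewrite (le_trans _ x1)// le_min l2 andbT invf_le1// ler1n.
split.
  have h := gcdf_derive (x * z).
  rewrite [X in is_derive _ _ _ X]mulrC; apply: (@is_derive_compE gcdf (fun y => y * z)) => //.
  by apply: is_derive_eq; rewrite /GRing.scale/=; ring.
have x0 : 0 < x by rewrite (lt_le_trans _ x2)// invr_gt0.
have := @gpdf_le 1 (x * z) isT; rewrite expr1 !normrM (gtr0_norm x0).
rewrite (ger0_norm (gpdf_ge0 _)) => h.
have : 0 <= `|z| * gpdf (x * z) by rewrite mulr_ge0 ?gpdf_ge0.
set w := `|z| * _ in h *; rewrite -mulrA -/w in h; nra.
Qed.

(** The second derivative in the scale [y] is, up to sign, [x ^ 3 * gpdf x / y ^ 2] at [x = y * z];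
    with [y >= 1 / 2] it is at most [4 * gK], uniformly in [z]. *)
Lemma gcdf_scale2 l z : 2^-1 <= l <= 1 ->
  `|gcdf (l * z) - gcdf z - (l - 1) * (z * gpdf z)| <= 4 * gK * (l - 1) ^+ 2.
Proof.
move=> /andP[l2 l1].
pose r0 x := gcdf (x * z) - gcdf z - (x - 1) * (z * gpdf z).
pose r1 x := z * gpdf (x * z) - z * gpdf z.
have dm x : is_derive x 1 (fun y => y * z) z.
  by apply: is_derive_eq; rewrite /GRing.scale/=; ring.
have d0 x : is_derive x 1 r0 (r1 x).
  have h := gcdf_derive (x * z).
  have h' := @is_derive_compE gcdf (fun y => y * z) _ _ _ h (dm x).
  by rewrite /r0; apply: is_derive_eq; rewrite /GRing.scale/= /r1; ring.
have b1 x : l <= x <= 1 -> `|r1 x| <= 4 * gK * `|l - 1|.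
  move=> /andP[lx x1].
  have := @mvt_le (fun y => z * gpdf (y * z)) (fun y => - (z ^+ 2 * (y * z) * gpdf (y * z)))
    (4 * gK) 1 x; rewrite mul1r => /(_ _)/le_trans; apply; last first.
    apply: ler_wpM2l; first by rewrite mulr_ge0 ?gK_ge0.
    by rewrite !ler0_norm ?subr_le0 ?(le_trans lx)// lerN2 lerB.
  rewrite (min_idPr x1) (max_idPl x1) => y /andP[xy y1].
  split.
    have h := gpdf_derive (y * z).
    have h' := @is_derive_compE gpdf (fun y => y * z) _ _ _ h (dm y).
    by apply: is_derive_eq; rewrite /GRing.scale/=; ring.
  have y2 : 2^-1 <= y by apply: le_trans xy; exact: le_trans lx.
  have y0 : 0 < y by rewrite (lt_le_trans _ y2)// invr_gt0.
  rewrite normrN 2!normrM normrX normrM (gtr0_norm y0) (ger0_norm (gpdf_ge0 _)).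
  have := @gpdf_le 3 (y * z) isT; rewrite normrM (gtr0_norm y0) => h.
  have w0 : 0 <= `|z| ^+ 2 * (y * `|z|) * gpdf (y * z).
    by rewrite !mulr_ge0 ?gpdf_ge0 ?sqr_ge0// ltW.
  set w := _ * gpdf _ in w0 *.
  have h2 : y ^+ 2 * w <= gK.
    by apply: le_trans h; rewrite /w exprMn; lra.
  have y4 : 1 / 4 <= y ^+ 2 by nra.
  nra.
have := @mvt_le r0 r1 (4 * gK * `|l - 1|) 1 l.
have -> : r0 1 = 0 by rewrite /r0 mul1r !subrr mul0r subrr.
rewrite subr0 => /(_ _)/le_trans; apply; last first.
  by rewrite -mulrA -normrM -expr2 ger0_norm ?sqr_ge0.
rewrite (min_idPr l1) (max_idPl l1) => y yl; split; [exact: d0|exact: b1].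
Qed.

(** The identity as a random variable under the normal law: its distribution function is [gcdf], so
    the general limits of distribution functions at infinity apply. *)
Let idR : measurableTypeR R -> R := idfun.

#[local] HB.instance Definition _ :=
  @isMeasurableFun.Build _ _ _ _ idR (@measurable_id _ _ setT).

Lemma gcdf_tail (e : R) : 0 < e -> exists M : R, 0 < M /\
  gcdf (- M) <= e /\ 1 - e <= gcdf M.
Proof.
move=> e0.
pose X : {RV (normal_prob (0 : R) 1) >-> R} := idR.
have E r : cdf X r = (gcdf r)%:E.
  by rewrite -gcdf_fin /cdf /distribution /pushforward /Phi.
have cy : gcdf x @[x --> +oo] --> (1 : R).
  have := cvg_cdfy1 X.
  by rewrite (_ : cdf _ = EFin \o gcdf); [move/fine_cvgP => []|apply/funext].
have cn : gcdf x @[x --> -oo] --> (0 : R).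
  have := cvg_cdfNy0 X.
  by rewrite (_ : cdf _ = EFin \o gcdf); [move/fine_cvgP => []|apply/funext].
have /cvgrPdist_le/(_ _ e0)[M1 [_ h1]] := cy.
have /cvgrPdist_le/(_ _ e0)[M2 [_ h2]] := cn.
pose M := 1 + `|M1| + `|M2|.
have M0 : 0 < M by rewrite !ltr_wpDr.
exists M; split => //; split.
  have := h2 (- M) _; rewrite sub0r normrN ger0_norm ?gcdf_ge0//; apply.
  rewrite /M ltrNl; have := ler_norm (- M2); rewrite normrN.
  by have := normr_ge0 M1; lra.
have := h1 M _; rewrite ger0_norm ?subr_ge0 ?gcdf_le1// => h.
have : 1 - gcdf M <= e by apply: h; rewrite /M;
  have := ler_norm M1; have := normr_ge0 M2; lra.
by lra.
Qed.

End normal_cdf.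

(** * Weighted laws and resampling *)

Section weighted_law.
Local Open Scope ereal_scope.
Context d1 d2 (X : measurableType d1) (T : measurableType d2) (R : realType).
Variables (mu : {measure set X -> \bar R}) (w : X -> R) (phi : X -> T).
Hypotheses (mw : measurable_fun setT w) (w0 : forall x, (0 <= w x)%R)
  (mphi : measurable_fun setT phi).

(* The dummy [let] makes the hypotheses arguments of [wlaw], so that its measure
   structure can be inferred. *)
Definition wlaw (A : set T) : \bar R :=
  let _ := (mw, w0, mphi) in \int[mu]_(x in phi @^-1` A) (w x)%:E.

Let mphiA A : measurable A -> measurable (phi @^-1` A).
Proof. by move=> mA; rewrite -[X in measurable X]setTI; exact: mphi. Qed.

Let wlaw0 : wlaw set0 = 0.
Proof. by rewrite /wlaw preimage_set0 integral_set0. Qed.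

Let wlaw_ge0 A : 0 <= wlaw A.
Proof. by apply: integral_ge0 => x _; rewrite lee_fin. Qed.

Let wlaw_sigma_additive : semi_sigma_additive wlaw.
Proof.
move=> F mF tF mUF; rewrite /wlaw preimage_bigcup ge0_integral_bigcup//; last 4 first.
- by move=> k; exact: mphiA.
- by apply: measurable_funTS; exact/measurable_EFinP.
- by move=> x _; rewrite lee_fin.
- apply/trivIsetP => /= i j _ _ ij; rewrite -preimage_setI.
  by move/trivIsetP : tF => /(_ _ _ _ _ ij) ->//; rewrite preimage_set0.
apply: is_cvg_ereal_nneg_natsum => k _.
by apply: integral_ge0 => x _; rewrite lee_fin.
Qed.

HB.instance Definition _ := isMeasure.Build _ _ _
  wlaw wlaw0 wlaw_ge0 wlaw_sigma_additive.

Import HBNNSimple.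

Let wlaw_indic A : measurable A ->
  \int[wlaw]_y (\1_A y)%:E = \int[mu]_x ((w x)%:E * (\1_A (phi x))%:E).
Proof.
move=> mA; rewrite integral_indic// setIT /= /wlaw integral_mkcond.
apply: eq_integral => x _; rewrite patchE indicE.
rewrite (_ : (x \in phi @^-1` A) = (phi x \in A)); last first.
  by apply/idP/idP; rewrite !inE.
by case: (_ \in _); rewrite ?mule1 ?mule0.
Qed.

Let wlaw_nnsfun (h : {nnsfun T >-> R}) :
  \int[wlaw]_y (h y)%:E = \int[mu]_x ((w x)%:E * (h (phi x))%:E).
Proof.
under [LHS]eq_integral do rewrite fimfunE -fsumEFin//.
rewrite [LHS]ge0_integral_fsum//; last 2 first.
  - by move=> r; exact/measurable_EFinP/measurableT_comp.
  - by move=> n x _; rewrite EFinM nnfun_muleindic_ge0.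
under [RHS]eq_integral.
  move=> x xD; rewrite fimfunE -fsumEFin// ge0_mule_fsumr; last first.
    by move=> r; rewrite EFinM nnfun_muleindic_ge0.
  over.
rewrite [RHS]ge0_integral_fsum//; last 2 first.
  - move=> r; apply: emeasurable_funM; apply/measurable_EFinP => //.
    by apply: measurable_funM => //; apply: measurableT_comp.
  - move=> r x _; apply: mule_ge0; first by rewrite lee_fin.
    by rewrite EFinM nnfun_muleindic_ge0.
apply: eq_fsbigr => r _.
rewrite integralZl_indic_nnsfun// wlaw_indic//.
have [r0|r0] := leP 0%R r; last first.
  rewrite preimage_nnfun0// indic0.
  under eq_integral do rewrite /= mule0.
  rewrite integral0 mule0; apply/esym; apply: integral0_eq => x _.
  by rewrite /= mulr0 mule0.
rewrite -ge0_integralZl//.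
- by apply: eq_integral => x _; rewrite EFinM muleCA.
- apply: emeasurable_funM; apply/measurable_EFinP => //.
  by apply: measurableT_comp.
- by move=> x _; rewrite mule_ge0 ?lee_fin.
Qed.

(** [wlaw] is the image under [phi] of the measure with density [w]; the formula passes from
    indicators to simple functions to monotone limits. *)
Lemma integral_wlaw (f : T -> \bar R) : measurable_fun setT f ->
  (forall y, 0 <= f y) ->
  \int[wlaw]_y f y = \int[mu]_x ((w x)%:E * f (phi x)).
Proof.
move=> mf f0; pose f_ := nnsfun_approx measurableT mf.
transitivity (limn (fun n => \int[wlaw]_y (f_ n y)%:E)).
  rewrite -monotone_convergence//=.
  - apply: eq_integral => x _; apply/esym/cvg_lim => //=.
    exact: cvg_nnsfun_approx.
  - by move=> n; apply: measurableT_comp => //; exact: measurable_funTS.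
  - by move=> n x _; rewrite lee_fin.
  - by move=> x _ a b ab; rewrite lee_fin//; exact/lefP/nd_nnsfun_approx.
transitivity (limn (fun n => \int[mu]_x ((w x)%:E * (f_ n (phi x))%:E))).
  by congr (limn _); apply/funext => n; rewrite wlaw_nnsfun.
rewrite -monotone_convergence//=.
- apply: eq_integral => x _; apply/cvg_lim => //=.
  apply: cvgeZl => //; exact: cvg_nnsfun_approx.
- move=> n; apply: emeasurable_funM; apply/measurable_EFinP => //.
  exact: measurableT_comp.
- by move=> n x _; rewrite mule_ge0// lee_fin.
- move=> x _ a b ab; apply: lee_wpmul2l; first by rewrite lee_fin.
  by rewrite lee_fin//; exact/lefP/nd_nnsfun_approx.
Qed.

End weighted_law.
Arguments wlaw {d1 d2 X T R} mu {w phi}.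

Section weighted_law_unique.
Local Open Scope ereal_scope.
Context d1 d1' d2 (X : measurableType d1) (X' : measurableType d1')
  (T : measurableType d2) (R : realType).
Variables (mu : {measure set X -> \bar R}) (mu' : {measure set X' -> \bar R}).

(** Two weighted image measures that agree on a generating pi-system, and are finite on members of
    it that cover the space, coincide. This single uniqueness argument serves the law of the sample,
    its resampling, conditional expectations and conditional independence. Both sides may be
    infinite. *)
Lemma weighted_law_eq (G : set (set T)) (g : (set T)^nat)
    (w : X -> R) (phi : X -> T) (w' : X' -> R) (phi' : X' -> T)
    (f : T -> \bar R) :
  measurable = <<s G >> -> setI_closed G -> (forall k, G (g k)) ->
  \bigcup_k g k = setT ->
  measurable_fun setT w -> (forall x, (0 <= w x)%R) -> measurable_fun setT phi ->
  measurable_fun setT w' -> (forall x, (0 <= w' x)%R) -> measurable_fun setT phi' ->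
  (forall A, G A -> \int[mu]_(x in phi @^-1` A) (w x)%:E =
                    \int[mu']_(x in phi' @^-1` A) (w' x)%:E) ->
  (forall k, \int[mu]_(x in phi @^-1` (g k)) (w x)%:E < +oo) ->
  measurable_fun setT f -> (forall y, 0 <= f y) ->
  \int[mu]_x ((w x)%:E * f (phi x)) = \int[mu']_x ((w' x)%:E * f (phi' x)).
Proof.
move=> mG GI Gg gT mw w0 mphi mw' w0' mphi' eqG gfin mf f0.
rewrite -(integral_wlaw mu mw w0 mphi)// -(integral_wlaw mu' mw' w0' mphi')//.
apply: eq_measure_integral => A mA _.
apply: (measure_unique G g mG GI Gg gT) => //.
Qed.

End weighted_law_unique.

(** * Replacing one observation by an independent copy *)

Section resampling.
Local Open Scope ereal_scope.
Context d dO (T : measurableType d) (Omega : measurableType dO) (R : realType).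
Variables (Pr : probability Omega R) (P : probability T R) (D : nat -> Omega -> T).
Hypothesis mD : forall i, measurable_fun setT (D i).
Hypothesis PD : forall i (A : set T), measurable A -> Pr (D i @^-1` A) = P A.
Hypothesis indD : forall (I : seq nat) (A : nat -> set T), uniq I ->
     (forall i, measurable (A i)) ->
     Pr (\big[setI/setT]_(i <- I) (D i @^-1` A i)) =
     (\prod_(i <- I) Pr (D i @^-1` A i)).

Definition sample n (om : Omega) : n.-tuple T := [tuple D i om | i < n].

Definition resample n (s : n.-tuple T) (i : 'I_n) (x : T) : n.-tuple T :=
  [tuple if j == i then x else tnth s j | j < n].

Lemma measurable_tuple_of d' (U : measurableType d') n (h : 'I_n -> U -> T) :
  (forall i, measurable_fun setT (h i)) ->
  measurable_fun setT (fun u => [tuple h i u | i < n]).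
Proof.
move=> mh; apply/measurable_fun_tnthP => i.
by rewrite (_ : _ \o _ = h i)//; apply/funext => u /=; rewrite tnth_mktuple.
Qed.

Lemma measurable_sample n : measurable_fun setT (sample n).
Proof. by apply: measurable_tuple_of => i; exact: mD. Qed.

Lemma measurable_resample n (i : 'I_n) :
  measurable_fun setT (fun p : n.-tuple T * T => resample p.1 i p.2).
Proof.
apply: measurable_tuple_of => j; case: eqP => _; first exact: measurable_snd.
by apply: (@measurableT_comp _ _ _ _ _ _ (@tnth n T ^~ j)) => //;
  exact: measurable_tnth.
Qed.

(** The sides are indexed by [nat] and not by ['I_n], to match the independence hypothesis
    [indD]. *)
Definition boxes (n : nat) : set (set (n.-tuple T)) :=
  [set B | exists2 A : nat -> set T, (forall i, measurable (A i)) &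
     B = [set s | forall i : 'I_n, A i (tnth s i)]].

Lemma boxes_gen n : @measurable _ (n.-tuple T) = <<s @boxes n >>.
Proof.
rewrite eqEsubset; split.
  apply: smallest_sub; first exact: smallest_sigma_algebra.
  case: n => [|n]; first by rewrite big_ord0.
  rewrite -bigcup_mkord_ord; apply: bigcup_sub => k kn B [A mA <-].
  apply: sub_sigma_algebra; exists (fun i => if i == k then A else setT).
    by move=> i; case: ifP.
  rewrite setTI; apply/seteqP; split => s /=.
    by move=> As i; case: eqP => // ik; rewrite (_ : i = inord k)//;
      apply/val_inj; rewrite /= inordK.
  by move=> /(_ (inord k)); rewrite inordK// eqxx.
apply: smallest_sub; first exact: sigma_algebra_measurable.
move=> B [A mA ->].
rewrite (_ : [set s | _] = \bigcap_(i in [set: 'I_n]) (@tnth n T ^~ i @^-1` (A i))).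
  apply: fin_bigcap_measurable => // i _.
  by rewrite -[X in measurable X]setTI; exact: measurable_tnth.
by apply/seteqP; split=> s /= h i; [move=> _; exact: h|exact: (h i I)].
Qed.

Lemma boxes_setI n : setI_closed (@boxes n).
Proof.
move=> _ _ [A mA ->] [B mB ->]; exists (fun i => A i `&` B i).
  by move=> i; exact: measurableI.
apply/seteqP; split=> s /=; first by move=> [h1 h2] i; split.
by move=> h; split=> i; have [] := h i.
Qed.

Lemma boxes_setT n : @boxes n setT.
Proof. by exists (fun=> setT) => //; apply/seteqP; split. Qed.

Lemma sample_box n (A : nat -> set T) : (forall i, measurable (A i)) ->
  Pr (sample n @^-1` [set s | forall i : 'I_n, A i (tnth s i)]) =
  \prod_(i < n) P (A i).
Proof.
move=> mA; have := indD (iota_uniq 0 n) mA.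
under [X in _ = X -> _]eq_bigr do rewrite PD//.
rewrite -(big_mkord xpredT (fun i => P (A i))) /index_iota subn0 => <-.
congr (Pr _); rewrite -bigcap_seq; apply/seteqP; split => om /=.
  move=> h i; rewrite /= mem_iota add0n => /andP[_ lin].
  by have := h (Ordinal lin); rewrite tnth_mktuple.
by move=> h i; rewrite tnth_mktuple; apply: h; rewrite /= mem_iota/= add0n.
Qed.

Lemma resample_box n (i : 'I_n) (A : nat -> set T) :
  (forall i, measurable (A i)) ->
  (Pr \x P) ((fun p => resample (sample n p.1) i p.2) @^-1`
    [set s | forall i : 'I_n, A i (tnth s i)]) = \prod_(i < n) P (A i).
Proof.
(* Resampling overwrites coordinate [i], so [A'] leaves the original coordinate free, and the
   constraint [A i] falls on the fresh point. *)
move=> mA; pose A' j := if j == i :> nat then setT else A j.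
have mA' j : measurable (A' j) by rewrite /A'; case: ifP.
rewrite (_ : _ @^-1` _ =
    (sample n @^-1` [set s | forall i : 'I_n, A' i (tnth s i)]) `*` A i).
  rewrite product_measure1E//; last first.
    rewrite -[X in measurable X]setTI; apply: measurable_sample => //.
    by rewrite boxes_gen; apply: sub_sigma_algebra; exists A'.
  transitivity ((\prod_(j < n) P (A' j)) * P (A i)).
    by congr (_ * _); exact: sample_box.
  rewrite [in RHS](bigD1 i)//= [X in X * _](bigD1 i)//=.
  rewrite {1}/A' eqxx probability_setT mul1e muleC; congr (_ * _).
  by apply: eq_bigr => j ji; rewrite /A' -val_eqE/= in ji *; rewrite (negbTE ji).
apply/seteqP; split => -[om x] /=.
  move=> h; split; last by have := h i; rewrite tnth_mktuple eqxx.
  move=> j; rewrite /A'; case: ifPn => // ji; have := h j.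
  by rewrite [in X in X -> _]tnth_mktuple -val_eqE (negbTE ji).
move=> [h1 h2] j; rewrite [X in A j X]tnth_mktuple; case: eqP => [->//|/eqP ji].
by have := h1 j; rewrite /A' -val_eqE in ji *; rewrite (negbTE ji).
Qed.

Lemma measurable_resample_sample n (i : 'I_n) :
  measurable_fun setT (fun p : Omega * T => resample (sample n p.1) i p.2).
Proof.
apply: (@measurableT_comp _ _ _ _ _ _ (fun p : n.-tuple T * T => resample p.1 i p.2)
  _ (fun p : Omega * T => (sample n p.1, p.2))).
  exact: measurable_resample.
apply/measurable_fun_pairP; split => //=.
  exact: (measurableT_comp (@measurable_sample n) measurable_fst).
exact: measurable_snd.
Qed.

(** The sample with one coordinate redrawn has the same law as the sample, because both give a box
    the product of the measures of its sides. All later uses of independence go through this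
    identity. *)
Lemma integral_resample n (i : 'I_n) (F : n.-tuple T -> \bar R) :
  measurable_fun setT F -> (forall s, 0 <= F s) ->
  \int[Pr]_om F (sample n om) =
  \int[Pr]_om \int[P]_x F (resample (sample n om) i x).
Proof.
move=> mF F0.
have mG : measurable_fun setT
    (fun p : Omega * T => F (resample (sample n p.1) i p.2)).
  by apply: measurableT_comp => //; exact: measurable_resample_sample.
rewrite -(@fubini_tonelli1 _ _ _ _ _ Pr P
  (fun p => F (resample (sample n p.1) i p.2)))//.
have := @weighted_law_eq _ _ _ Omega (Omega * T)%type (n.-tuple T) R Pr
  (Pr \x P) (@boxes n) (fun=> setT) (cst 1%R) (sample n) (cst 1%R)
  (fun p => resample (sample n p.1) i p.2) F (@boxes_gen n) (@boxes_setI n).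
move=> H; transitivity (\int[Pr]_om (((cst 1%R om : R))%:E * F (sample n om))).
  by apply: eq_integral => x _; rewrite mul1e.
have int1 d' (U : measurableType d') (m : {measure set U -> \bar R}) (B : set U) :
    measurable B -> \int[m]_(x in B) (cst 1%R x : R)%:E = m B.
  move=> mB; rewrite -[LHS]/(\int[m]_(x in B) cst 1%:E x).
  by rewrite integral_cst// mul1e.
rewrite {}H//.
- by apply: eq_integral => x _; rewrite mul1e.
- by move=> k; exact: boxes_setT.
- by rewrite bigcup_const.
- exact: measurable_sample.
- exact: measurable_resample_sample.
- move=> _ [A mA ->]; rewrite !int1.
  + by rewrite -[RHS]/((Pr \x P) _) resample_box//; exact: sample_box.
  + rewrite -[X in measurable X]setTI; apply: measurable_resample_sample => //.
    by rewrite boxes_gen; apply: sub_sigma_algebra; exists A.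
  + rewrite -[X in measurable X]setTI; apply: measurable_sample => //.
    by rewrite boxes_gen; apply: sub_sigma_algebra; exists A.
- move=> k; rewrite preimage_setT int1//.
  by rewrite (le_lt_trans (probability_le1 Pr measurableT))// ltry.
Qed.

End resampling.

(** * Conditional independence *)

Lemma integral_set_indic dT (T : measurableType dT) (R : realType) (U : Type)
    (m : {measure set T -> \bar R}) (f : T -> R) (h : T -> U) (C : set U) :
  (\int[m]_(t in [set t | C (h t)]) (f t)%:E =
   \int[m]_t (f t * \1_C (h t))%:E)%E.
Proof.
rewrite integral_mkcond; apply: eq_integral => t _; rewrite patchE indicE.
have -> : (t \in [set t | C (h t)]) = (h t \in C) by apply/idP/idP; rewrite !inE.
by case: (_ \in _); rewrite ?mulr1 ?mulr0.
Qed.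

Section conditional_independence.
Context {R : realType} {dZ : nat}.
Notation Obs := (Obs R dZ).
Notation Z := (Zsp R dZ).
Variable P : probability Obs R.

Lemma measurable_obsz : measurable_fun setT (fun t : Obs => t.2).
Proof. exact: measurable_snd. Qed.

Lemma measurable_obsz_set (C : set Z) : measurable C ->
  measurable [set t : Obs | C t.2].
Proof. by move=> mC; have := measurable_obsz measurableT mC; rewrite setTI. Qed.

Lemma measurable_compz (h : Z -> R) : measurable_fun setT h ->
  measurable_fun setT (fun t : Obs => h t.2).
Proof. by move=> mh; apply: (measurableT_comp mh); exact: measurable_obsz. Qed.

(** Over the event [h < 0], the defining identity equates a nonnegative integral with one of a
    negative function, so both vanish. *)
Lemma cond_exp_ge0_ae (phi : Obs -> R) (h : Z -> R) :
  cond_exp P phi h -> (forall t, 0 <= phi t) ->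
  {ae P, forall t, 0 <= h t.2}.
Proof.
move=> [mphi [mh [_ H]]] phi0.
pose C := [set z | h z < 0].
have mC : measurable C.
  have -> : C = h @^-1` `]-oo, 0[%classic.
    by apply/seteqP; split => z /=; rewrite in_itv.
  by rewrite -[X in measurable X]setTI; exact: mh.
have mhz := measurable_compz mh.
have mN := measurable_obsz_set mC.
have i0 : (\int[P]_(t in [set t | C t.2]) `|(h t.2)%:E| = 0)%E.
  apply/eqP; rewrite eq_le; apply/andP; split; last first.
    by apply: integral_ge0 => t _; exact: abse_ge0.
  rewrite -oppe_ge0 -integral_ge0N; last by move=> t _; exact: abse_ge0.
  rewrite (_ : (\int[P]_(x in _) _)%E =
    (\int[P]_(t in [set t | C t.2]) (h t.2)%:E)%E); last first.
    apply: eq_integral => t /[!inE]/= Ct.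
    by rewrite /= ltr0_norm// opprK.
  by rewrite -H//; apply: integral_ge0 => t _; rewrite lee_fin.
have [N [mN' N0 sub]] : ae_eq P [set t | C t.2] (EFin \o (fun t => h t.2)) (cst 0%E).
  by apply/ae_eq_integral_abs => //; apply/measurable_EFinP/measurable_funTS.
exists N; split => // t /= /negP; rewrite -ltNge => ht; apply: sub => /=.
by move=> /(_ ht) [h0]; rewrite h0 ltxx in ht.
Qed.

(** From indicators of Z-events to all nonnegative functions of Z. The sets [g j] provide
    sigma-finiteness, since [phi] itself may have an infinite integral. *)
Lemma test_extension (phi psi : Obs -> R) (g : nat -> set Z) (k : Z -> \bar R) :
  measurable_fun setT phi -> (forall t, 0 <= phi t) ->
  measurable_fun setT psi -> (forall t, 0 <= psi t) ->
  (forall j, measurable (g j)) -> \bigcup_j g j = setT ->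
  (forall j, \int[P]_(t in [set t | g j t.2]) (phi t)%:E < +oo)%E ->
  (forall C, measurable C -> \int[P]_(t in [set t | C t.2]) (phi t)%:E =
     \int[P]_(t in [set t | C t.2]) (psi t)%:E)%E ->
  measurable_fun setT k -> (forall z, (0 <= k z)%E) ->
  (\int[P]_t ((phi t)%:E * k t.2) = \int[P]_t ((psi t)%:E * k t.2))%E.
Proof.
move=> mphi phi0 mpsi psi0 mg gT gfin eqC mk k0.
apply: (@weighted_law_eq _ _ _ _ _ Z R P P measurable g phi (fun t => t.2)
  psi (fun t => t.2)) => //.
- apply/esym; apply: sigma_algebra_id; exact: sigma_algebra_measurable.
- by move=> A B mA mB; exact: measurableI.
- exact: measurable_obsz.
- exact: measurable_obsz.
Qed.

(** A version is nonnegative only almost surely; its positive part is nonnegative everywhere and can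
    serve as the density of a weighted law. *)
Lemma pos_version (phi : Obs -> R) (h : Z -> R) (C : set Z) :
  cond_exp P phi h -> (forall t, 0 <= phi t) -> measurable C ->
  (\int[P]_(t in [set t | C t.2]) (phi t)%:E =
   \int[P]_(t in [set t | C t.2]) (Num.max 0 (h t.2))%:E)%E.
Proof.
move=> ch phi0 mC; have [mphi [mh [_ H]]] := ch; rewrite H//.
have h0 := cond_exp_ge0_ae ch phi0.
have mhz := measurable_compz mh.
apply: ae_eq_integral => //.
- exact: measurable_obsz_set.
- by apply/measurable_EFinP/measurable_funTS.
- by apply/measurable_EFinP/measurable_funTS/measurable_maxr.
by apply: filterS h0 => t h0 _ /=; rewrite (max_idPr h0).
Qed.

(** [cond_indep] with the two coordinates as parameters, so that X and Y can exchange roles; for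
    [t.1.1] and [t.1.2] it is convertible to [cond_indep]. *)
Definition ci (x y : Obs -> R) := forall A B : set R, measurable A -> measurable B ->
  exists hA hB : Z -> R,
    cond_exp P (fun t => \1_A (x t)) hA /\
    cond_exp P (fun t => \1_B (y t)) hB /\
    cond_exp P (fun t => \1_A (x t) * \1_B (y t)) (fun z => hA z * hB z).

Lemma ciC x y : ci x y -> ci y x.
Proof.
move=> H A B mA mB; have [hB [hA [h1 [h2 h3]]]] := H B A mB mA.
exists hA, hB; split => //; split => //.
rewrite (_ : (fun t => _) = (fun t => \1_B (x t) * \1_A (y t))); last first.
  by apply/funext => t; rewrite mulrC.
by rewrite (_ : (fun z => _) = (fun z => hB z * hA z))//; apply/funext => t;
  rewrite mulrC.
Qed.

Variables x y : Obs -> R.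
Hypotheses (mx : measurable_fun setT x) (my : measurable_fun setT y).
Hypothesis cixy : ci x y.

Lemma mprod_box d1 d2 (T1 : measurableType d1) (T2 : measurableType d2) :
  @measurable _ (T1 * T2)%type =
  <<s [set A `*` B | A in measurable & B in measurable] >>.
Proof. by rewrite measurable_prod_measurableType. Qed.

Lemma mprod_box_setI d1 d2 (T1 : measurableType d1) (T2 : measurableType d2) :
  setI_closed [set A `*` B | A in @measurable _ T1 & B in @measurable _ T2].
Proof.
move=> _ _ [A mA [B mB <-]] [A' mA' [B' mB' <-]].
exists (A `&` A'); first exact: measurableI.
by exists (B `&` B'); [exact: measurableI|rewrite setXI].
Qed.

Lemma indic_fin (u : Obs -> R) (A : set R) (S : set Obs) : measurable S ->
  measurable A -> measurable_fun setT u ->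
  (\int[P]_(t in S) (\1_A (u t))%:E < +oo)%E.
Proof.
move=> mS mA mu; apply: (@le_lt_trans _ _ (\int[P]_(t in S) (cst 1%E t))%E).
  apply: ge0_le_integral => //.
  - apply/measurable_EFinP/measurable_funTS.
    by apply: (measurableT_comp _ mu); exact: measurable_indic.
  - by move=> t _; rewrite lee_fin indicE; case: (_ \in _).
rewrite integral_cst// mul1e (le_lt_trans (probability_le1 P mS))//.
exact: ltry.
Qed.

(** [p] is a version of the conditional probability of [x] in [A] given Z, and it must not depend on
    the event tested on [y]. Since [ci] offers versions for each pair of events, [p] is taken from
    the pair [A], [setT] and then reconciled with the versions of every other pair. *)
Lemma ci_weight (A : set R) : measurable A -> exists p : Z -> R,
  measurable_fun setT p /\ (forall z, 0 <= p z) /\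
  (forall phi : R * Z -> R, measurable_fun setT phi -> (forall u, 0 <= phi u) ->
    (\int[P]_t ((\1_A (x t))%:E * (phi (y t, t.2))%:E) =
     \int[P]_t ((p t.2)%:E * (phi (y t, t.2))%:E))%E).
Proof.
move=> mA.
have [hA0 [hT [cA0 _]]] := cixy mA measurableT.
pose p z := Num.max 0 (hA0 z).
have i0 (u : Obs -> R) B t : (0 : R) <= \1_B (u t).
  by rewrite indicE; case: (_ \in _).
have mi (u : Obs -> R) B : measurable_fun setT u -> measurable B ->
    measurable_fun setT (fun t => \1_B (u t) : R).
  by move=> mu mB; apply: (measurableT_comp _ mu); exact: measurable_indic.
have mmax (h : Z -> R) : measurable_fun setT h ->
    measurable_fun setT (fun z => Num.max 0 (h z)).
  by move=> mh; exact: measurable_maxr.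
have test (u : Obs -> R) B h k : measurable_fun setT u -> measurable B ->
    cond_exp P (fun t => \1_B (u t)) h ->
    measurable_fun setT k -> (forall z : Z, (0 <= k z)%E) ->
    (\int[P]_t ((\1_B (u t))%:E * k t.2) =
     \int[P]_t ((Num.max 0 (h t.2))%:E * k t.2))%E.
  move=> mu mB ch mk k0; have [_ [mh _]] := ch.
  apply: (@test_extension (fun t => \1_B (u t)) (fun t => Num.max 0 (h t.2))
    (fun=> setT)) => //.
  - exact: mi.
  - exact: (measurable_compz (mmax h mh)).
  - by move=> t; rewrite le_max lexx.
  - by rewrite bigcup_const.
  - by move=> _; apply: indic_fin => //; exact: measurable_obsz_set.
  - by move=> C mC; apply: (@pos_version (fun t => \1_B (u t)) h) => // t; exact: i0.
have [_ [mhA0 _]] := cA0.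
have mp : measurable_fun setT p by exact: mmax.
have p0 z : 0 <= p z by rewrite le_max lexx.
exists p; split => //; split => // phi mphi phi0.
apply: (@weighted_law_eq _ _ _ _ _ (R * Z)%type R P P
  [set A `*` B | A in @measurable _ R & B in @measurable _ Z] (fun=> setT)
  (fun t => \1_A (x t)) (fun t => (y t, t.2)) (fun t => p t.2)
  (fun t => (y t, t.2)) (EFin \o phi)).
- exact: mprod_box.
- exact: mprod_box_setI.
- by move=> _; exists setT => //; exists setT => //; rewrite setXTT.
- by rewrite bigcup_const.
- exact: mi.
- by move=> t; exact: i0.
- by apply/measurable_fun_pairP; split => //; exact: measurable_obsz.
- exact: measurable_compz.
- by [].
- by apply/measurable_fun_pairP; split => //; exact: measurable_obsz.
- move=> _ [B mB [C mC <-]].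
  have [hA [hB [cA [cB cAB]]]] := cixy mA mB.
  have [_ [mhA _]] := cA; have [_ [mhB _]] := cB.
  have [_ [_ [_ /(_ C mC) eAB]]] := cAB.
  have i0' z : (0 : R) <= \1_C (z : Z) by rewrite indicE; case: (_ \in _).
  rewrite [LHS](_ : _ =
      \int[P]_(t in [set t | C t.2]) (\1_A (x t) * \1_B (y t))%:E)%E; last first.
    rewrite [RHS](@integral_set_indic _ _ _ _ P _ (fun t : Obs => t.2)).
    rewrite [LHS](@integral_set_indic _ _ _ _ P _ (fun t : Obs => (y t, t.2)) (B `*` C)).
    apply: eq_integral => t _; congr EFin; rewrite -mulrA; congr (_ * _).
    by rewrite !indicE in_setX /=; case: (_ \in _); case: (_ \in _);
      rewrite /= ?mulr1 ?mulr0.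
  rewrite eAB (@integral_set_indic _ _ _ _ P (fun t => hA t.2 * hB t.2) (fun t : Obs => t.2)).
  pose k1 z := (Num.max 0 (hB z) * \1_C z)%:E.
  have mk1 : measurable_fun setT k1.
    by apply/measurable_EFinP/measurable_funM; [exact: mmax|exact: measurable_indic].
  have k10 z : (0 <= k1 z)%E by rewrite lee_fin mulr_ge0// le_max lexx.
  transitivity (\int[P]_t ((Num.max 0 (hA t.2))%:E * k1 t.2))%E.
    apply: ae_eq_integral => //.
    - apply/measurable_EFinP/measurable_funM.
        by apply: measurable_funM; exact: measurable_compz.
      by apply: (@measurable_compz (\1_C)); exact: measurable_indic.
    - apply: emeasurable_funM.
        by apply/measurable_EFinP; exact: (measurable_compz (mmax hA mhA)).
      by apply: (measurableT_comp mk1); exact: measurable_obsz.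
    have hA0' := cond_exp_ge0_ae cA (i0 x A).
    have hB0' := cond_exp_ge0_ae cB (i0 y B).
    apply: filterS2 hA0' hB0' => t a b _ /=.
    by rewrite /k1 (max_idPr a) (max_idPr b) -EFinM mulrA.
  (* Going back to the indicator of [A] and forward again trades the version [hA], which depends on
     [B], for [hA0]. *)
  rewrite -(test x A hA k1)// (test x A hA0 k1)//.
  pose k2 z := (p z * \1_C z)%:E.
  have mk2 : measurable_fun setT k2.
    by apply/measurable_EFinP/measurable_funM => //; exact: measurable_indic.
  have k20 z : (0 <= k2 z)%E by rewrite lee_fin mulr_ge0.
  transitivity (\int[P]_t ((Num.max 0 (hB t.2))%:E * k2 t.2))%E.
    by apply: eq_integral => t _; rewrite /k1 /k2 -!EFinM mulrCA.
  rewrite -(test y B hB k2)//.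
  rewrite [RHS](@integral_set_indic _ _ _ _ P _ (fun t : Obs => (y t, t.2)) (B `*` C)).
  apply: eq_integral => t _; rewrite /k2 -EFinM mulrCA; congr (_ * _)%:E.
  by rewrite !indicE in_setX /=; case: (_ \in _); case: (_ \in _);
      rewrite /= ?mulr1 ?mulr0.
- by move=> k; rewrite preimage_setT; exact: indic_fin.
- exact/measurable_EFinP.
- by move=> u; rewrite lee_fin.
Qed.

(** On an event [x] in [A], Z in [C], the indicator of [A] can be replaced by a function of Z. What
    remains is to compare [phi] and [psi] against functions of Z alone, and such comparisons follow
    from the assumed equality on Z-events. *)
Lemma ci_swap (phi psi : R * Z -> R) (g : nat -> set Z) (k : R * Z -> R) :
  measurable_fun setT phi -> (forall t, 0 <= phi t) ->
  measurable_fun setT psi -> (forall t, 0 <= psi t) ->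
  (forall j, measurable (g j)) -> \bigcup_j g j = setT ->
  (forall j, \int[P]_(t in [set t | g j t.2]) (phi (y t, t.2))%:E < +oo)%E ->
  (forall C, measurable C -> \int[P]_(t in [set t | C t.2]) (phi (y t, t.2))%:E =
     \int[P]_(t in [set t | C t.2]) (psi (y t, t.2))%:E)%E ->
  measurable_fun setT k -> (forall u, 0 <= k u) ->
  (\int[P]_t ((phi (y t, t.2))%:E * (k (x t, t.2))%:E) =
   \int[P]_t ((psi (y t, t.2))%:E * (k (x t, t.2))%:E))%E.
Proof.
move=> mphi phi0 mpsi psi0 mg gT gfin eqC mk k0.
have mxz : measurable_fun setT (fun t : Obs => (x t, t.2)).
  by apply/measurable_fun_pairP; split => //; exact: measurable_obsz.
have myz : measurable_fun setT (fun t : Obs => (y t, t.2)).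
  by apply/measurable_fun_pairP; split => //; exact: measurable_obsz.
apply: (@weighted_law_eq _ _ _ _ _ (R * Z)%type R P P
  [set A `*` B | A in @measurable _ R & B in @measurable _ Z]
  (fun j => setT `*` g j)
  (fun t => phi (y t, t.2)) (fun t => (x t, t.2)) (fun t => psi (y t, t.2))
  (fun t => (x t, t.2)) (EFin \o k)) => //.
- exact: mprod_box.
- exact: mprod_box_setI.
- by move=> j; exists setT => //; exists (g j).
- apply/seteqP; split => // -[a z] _.
  have : (\bigcup_j g j) z by rewrite gT.
  by move=> [j _ gjz]; exists j.
- exact: (measurableT_comp mphi myz).
- exact: (measurableT_comp mpsi myz).
- move=> _ [A mA [C mC <-]].
  have [p [mp [p0 ep]]] := ci_weight mA.
  have key (f : R * Z -> R) : measurable_fun setT f -> (forall u, 0 <= f u) ->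
     (\int[P]_(t in (fun t : Obs => (x t, t.2)) @^-1` (A `*` C)) (f (y t, t.2))%:E
       = \int[P]_t ((f (y t, t.2))%:E * (p t.2 * \1_C t.2)%:E))%E.
    move=> mf f0.
    rewrite [LHS](@integral_set_indic _ _ _ _ P _ (fun t : Obs => (x t, t.2)) (A `*` C)).
    transitivity (\int[P]_t ((\1_A (x t))%:E * (f (y t, t.2) * \1_C t.2)%:E))%E.
      apply: eq_integral => t _; rewrite -EFinM mulrCA; congr (_ * _)%:E.
      by rewrite !indicE in_setX /=; case: (_ \in _); case: (_ \in _);
        rewrite /= ?mulr1 ?mulr0.
    rewrite (ep (fun u => f u * \1_C u.2)).
    - by apply: eq_integral => t _; rewrite -!EFinM mulrCA.
    - apply: measurable_funM => //; apply: (measurableT_comp _ measurable_snd).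
      exact: measurable_indic.
    - by move=> u; rewrite mulr_ge0// indicE; case: (_ \in _).
  rewrite !key//.
  apply: (@test_extension (fun t => phi (y t, t.2)) (fun t => psi (y t, t.2)) g
     (fun z => (p z * \1_C z)%:E)) => //.
  + exact: (measurableT_comp mphi myz).
  + exact: (measurableT_comp mpsi myz).
  + by apply/measurable_EFinP/measurable_funM => //; exact: measurable_indic.
  + by move=> z; rewrite lee_fin mulr_ge0// indicE; case: (_ \in _).
- move=> j; rewrite (_ : _ @^-1` _ = [set t | g j t.2])//.
  by apply/seteqP; split => t //= [].
- exact/measurable_EFinP.
Qed.

End conditional_independence.

Lemma integral_posneg d (T : measurableType d) (R : realType)
    (m : {measure set T -> \bar R}) (S : set T) (f : T -> R) :
  (\int[m]_(t in S) (f t)%:E = \int[m]_(t in S) (Num.max 0 (f t))%:E -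
     \int[m]_(t in S) (Num.max 0 (- f t))%:E)%E.
Proof.
rewrite integralE; congr (_ - _)%E; apply: eq_integral => t _.
  by rewrite funeposE EFin_max maxC.
by rewrite funenegE EFin_max maxC.
Qed.

Lemma pos_mul (R : realDomainType) (a b : R) : Num.max 0 (a * b) =
  Num.max 0 a * Num.max 0 b + Num.max 0 (- a) * Num.max 0 (- b).
Proof.
have [a0|/ltW a0] := lerP 0 a; have [b0|/ltW b0] := lerP 0 b.
- have na : - a <= 0 by rewrite oppr_le0.
  by rewrite (max_idPr (mulr_ge0 a0 b0)) (max_idPl na) mul0r addr0.
- have na : - a <= 0 by rewrite oppr_le0.
  by rewrite (max_idPl (mulr_ge0_le0 a0 b0)) (max_idPl na) mulr0 mul0r addr0.
- have nb : - b <= 0 by rewrite oppr_le0.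
  by rewrite (max_idPl (mulr_le0_ge0 a0 b0)) (max_idPl nb) mulr0 mul0r addr0.
- have na : 0 <= - a by rewrite oppr_ge0.
  have nb : 0 <= - b by rewrite oppr_ge0.
  have ab : 0 <= a * b by rewrite -mulrNN mulr_ge0.
  by rewrite (max_idPr na) (max_idPr nb) (max_idPr ab) mulrNN mul0r add0r.
Qed.

(** * Regression noise given the other variable *)

Section noise.
Context {R : realType} {dZ : nat}.
Notation Obs := (Obs R dZ).
Notation Z := (Zsp R dZ).
Variables (P : probability Obs R) (x y : Obs -> R).
Hypotheses (mx : measurable_fun setT x) (my : measurable_fun setT y).
Hypothesis cixy : ci P x y.
Hypothesis inty : P.-integrable setT (EFin \o y).
Variables (g v : Z -> R).
Hypothesis cg : cond_exp P y g.
Hypothesis cv : cond_exp P (fun t => (y t - g t.2) ^+ 2) v.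

Let mg : measurable_fun setT g. Proof. by case: cg => _ []. Qed.
Let mv : measurable_fun setT v. Proof. by case: cv => _ []. Qed.

Let eg (C : set Z) : measurable C ->
  (\int[P]_(t in [set t | C t.2]) (y t)%:E =
   \int[P]_(t in [set t | C t.2]) (g t.2)%:E)%E.
Proof. by case: cg => _ [_ [_]]; apply. Qed.

Let mgz : measurable_fun setT (fun t : Obs => g t.2).
Proof. exact: (measurable_compz mg). Qed.

(** The sign of [g] defines two Z-events, and on each of them the integral of [|g|] is, up to sign,
    the finite integral of [y]. *)
Lemma cond_exp_integrable : P.-integrable setT (fun t => (g t.2)%:E).
Proof.
apply/integrableP; split; first exact/measurable_EFinP.
pose C := [set z | 0 <= g z].
have mC : measurable C.
  have -> : C = g @^-1` `[0, +oo[%classic.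
    by apply/seteqP; split => z /=; rewrite in_itv/= andbT.
  by rewrite -[X in measurable X]setTI; exact: mg.
have mC1 := measurable_obsz_set mC.
have mC2 := measurable_obsz_set (measurableC mC).
have fin (S : set Obs) : measurable S -> (\int[P]_(t in S) (y t)%:E \is a fin_num)%E.
  by move=> mS; apply: integrable_fin_num => //; exact: integrableS inty.
have -> : setT = [set t : Obs | C t.2] `|` [set t : Obs | (~` C) t.2].
  by apply/seteqP; split => t // _; have [] := pselect (C t.2); [left|right].
rewrite ge0_integral_setU//; last 2 first.
- by apply: measurableT_comp => //; exact/measurable_EFinP/measurable_funTS.
- by apply/disj_setPS => t [/= ? ?].
apply: lte_add_pinfty.
  rewrite (_ : (\int[P]_(x in _) _)%E =
      (\int[P]_(t in [set t | C t.2]) (g t.2)%:E)%E).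
    by rewrite -eg// ltey_eq fin.
  by apply: eq_integral => t /[!inE]/= Ct; rewrite ger0_norm.
have e : (\int[P]_(t in [set t | (~` C) t.2]) (g t.2)%:E =
    - \int[P]_(t in [set t | (~` C) t.2]) `|(g t.2)%:E|)%E.
  rewrite -integral_ge0N => [|t _]; last exact: abse_ge0.
  apply: eq_integral => t /[!inE]/= /negP; rewrite -ltNge => h.
  by rewrite ltr0_norm// opprK.
have : (\int[P]_(t in [set t | (~` C) t.2]) `|(g t.2)%:E| \is a fin_num)%E.
  by rewrite -fin_numN -e -eg ?fin//; exact: measurableC.
by rewrite ge0_fin_numE// integral_ge0.
Qed.

Lemma noise_integrable : P.-integrable setT (fun t => (y t - g t.2)%:E).
Proof.
rewrite (_ : (fun t => _) = ((EFin \o y) \- (fun t => (g t.2)%:E))%E).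
  by apply: integrableB => //; exact: cond_exp_integrable.
by apply/funext => t /=; rewrite EFinB.
Qed.

Let mpos : measurable_fun setT (fun u : R * Z => Num.max 0 (u.1 - g u.2)).
Proof.
apply: measurable_maxr => //; apply: measurable_funB => //.
exact: (measurableT_comp mg measurable_snd).
Qed.

Let mneg : measurable_fun setT (fun u : R * Z => Num.max 0 (- (u.1 - g u.2))).
Proof.
apply: measurable_maxr => //; apply: measurableT_comp => //.
by apply: measurable_funB => //; exact: (measurableT_comp mg measurable_snd).
Qed.

Let posneg_eq (C : set Z) : measurable C ->
  (\int[P]_(t in [set t | C t.2]) (Num.max 0 (y t - g t.2))%:E =
   \int[P]_(t in [set t | C t.2]) (Num.max 0 (- (y t - g t.2)))%:E)%E.
Proof.
move=> mC; have mC' := measurable_obsz_set mC.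
have ii : P.-integrable [set t | C t.2] (fun t => (y t - g t.2)%:E).
  exact: integrableS noise_integrable.
have : (\int[P]_(t in [set t | C t.2]) (y t - g t.2)%:E = 0)%E.
  under eq_integral do rewrite EFinB.
  rewrite integralB_EFin//; last 2 first.
  - exact: integrableS inty.
  - exact: integrableS cond_exp_integrable.
  rewrite eg// subee//; apply: integrable_fin_num => //.
  exact: integrableS cond_exp_integrable.
rewrite integral_posneg => /eqP.
rewrite sube_eq ?add0e; first by move=> /eqP.
  rewrite (_ : (\int[P]_(x in _) _)%E =
    (\int[P]_(t in [set t | C t.2]) ((fun t => (y t - g t.2)%:E)^\+ t)%E)%E).
    exact: integrable_pos_fin_num.
  by apply: eq_integral => t _; rewrite funeposE EFin_max maxC.
by rewrite fin_num_adde_defr.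
Qed.

(* Equality of the positive and negative parts expresses that the noise times
   [k] has mean zero, without requiring that the product be integrable. *)
Lemma noise_sign (k : R * Z -> R) : measurable_fun setT k ->
  (\int[P]_t (Num.max 0 ((y t - g t.2) * k (x t, t.2)))%:E =
   \int[P]_t (Num.max 0 (- ((y t - g t.2) * k (x t, t.2))))%:E)%E.
Proof.
move=> mk.
pose kp u := Num.max 0 (k u); pose kn u := Num.max 0 (- k u).
have mkp : measurable_fun setT kp by exact: measurable_maxr.
have mkn : measurable_fun setT kn.
  by apply: measurable_maxr => //; exact: measurableT_comp.
have max0 (a : R) : 0 <= Num.max 0 a by rewrite le_max lexx.
have myz : measurable_fun setT (fun t : Obs => (y t, t.2)).
  by apply/measurable_fun_pairP; split => //; exact: measurable_obsz.
have mxz : measurable_fun setT (fun t : Obs => (x t, t.2)).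
  by apply/measurable_fun_pairP; split => //; exact: measurable_obsz.
have swap (k' : R * Z -> R) : measurable_fun setT k' -> (forall u, 0 <= k' u) ->
    (\int[P]_t ((Num.max 0 (y t - g t.2))%:E * (k' (x t, t.2))%:E) =
     \int[P]_t ((Num.max 0 (- (y t - g t.2)))%:E * (k' (x t, t.2))%:E))%E.
  move=> mk' k'0.
  apply: (@ci_swap R dZ P x y mx my cixy
    (fun u => Num.max 0 (u.1 - g u.2)) (fun u => Num.max 0 (- (u.1 - g u.2)))
    (fun=> setT) k') => //.
  - by rewrite bigcup_const.
  - move=> _; rewrite (_ : (\int[P]_(x in _) _)%E =
      (\int[P]_t ((fun t => (y t - g t.2)%:E)^\+ t)%E)%E).
      exact/integral_funepos_lt_pinfty/noise_integrable.
    by apply: eq_integral => t _; rewrite funeposE EFin_max maxC.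
have mf (a b : R * Z -> R) : measurable_fun setT a -> measurable_fun setT b ->
    measurable_fun setT (fun t => (a (y t, t.2))%:E * (b (x t, t.2))%:E)%E.
  move=> ma mb; apply: emeasurable_funM; apply/measurable_EFinP.
    exact: (measurableT_comp ma myz).
  exact: (measurableT_comp mb mxz).
(* The positive part of a product is the sum of the products of equal-signed parts. Exchanging the
   two parts of the noise by [swap] turns it into the negative part. *)
transitivity (\int[P]_t ((Num.max 0 (y t - g t.2))%:E * (kp (x t, t.2))%:E
   + (Num.max 0 (- (y t - g t.2)))%:E * (kn (x t, t.2))%:E))%E.
  by apply: eq_integral => t _; rewrite pos_mul EFinD !EFinM.
transitivity (\int[P]_t ((Num.max 0 (- (y t - g t.2)))%:E * (kp (x t, t.2))%:E
   + (Num.max 0 (y t - g t.2))%:E * (kn (x t, t.2))%:E))%E; last first.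
  by apply: eq_integral => t _; rewrite -mulNr pos_mul opprK EFinD !EFinM.
rewrite !ge0_integralD//.
- by congr (_ + _)%E; [apply: swap|apply/esym/swap] => // u; exact: max0.
- by move=> t _; rewrite mule_ge0 ?lee_fin ?max0.
- exact: (mf (fun u => Num.max 0 (- (u.1 - g u.2)))).
- by move=> t _; rewrite mule_ge0 ?lee_fin ?max0.
- exact: (mf (fun u => Num.max 0 (u.1 - g u.2))).
- by move=> t _; rewrite mule_ge0 ?lee_fin ?max0.
- exact: (mf (fun u => Num.max 0 (u.1 - g u.2))).
- by move=> t _; rewrite mule_ge0 ?lee_fin ?max0.
- exact: (mf (fun u => Num.max 0 (- (u.1 - g u.2)))).
Qed.

(** The second moment of the noise may be infinite. The events [v <= j] exhaust the space and bound
    the conditional second moment, which supplies the sigma-finiteness required by [ci_swap]. *)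
Lemma noise_square (k : R * Z -> R) : measurable_fun setT k ->
  (forall u, 0 <= k u) ->
  (\int[P]_t ((y t - g t.2) ^+ 2 * k (x t, t.2))%:E =
   \int[P]_t (Num.max 0 (v t.2) * k (x t, t.2))%:E)%E.
Proof.
move=> mk k0.
under eq_integral do rewrite EFinM; under [RHS]eq_integral do rewrite EFinM.
pose G j := [set z | v z <= j%:R].
have mG j : measurable (G j).
  have -> : G j = v @^-1` `]-oo, j%:R]%classic.
    by apply/seteqP; split => z /=; rewrite in_itv/=.
  by rewrite -[X in measurable X]setTI; exact: mv.
apply: (@ci_swap R dZ P x y mx my cixy
    (fun u => (u.1 - g u.2) ^+ 2) (fun u => Num.max 0 (v u.2)) G k) => //.
- apply: measurable_funX; apply: measurable_funB => //.
  exact: (measurableT_comp mg measurable_snd).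
- by move=> t; exact: sqr_ge0.
- by apply: measurable_maxr => //; exact: (measurableT_comp mv measurable_snd).
- by move=> t; rewrite le_max lexx.
- apply/seteqP; split => // z _; exists (Num.truncn (v z)).+1 => //=.
  by rewrite /G/= ltW// truncnS_gt.
- move=> j /=; rewrite (pos_version cv)//; last by move=> t; exact: sqr_ge0.
  apply: (@le_lt_trans _ _ (\int[P]_(t in [set t | G j t.2]) (cst j%:R%:E t))%E).
    apply: ge0_le_integral => //.
    + exact: measurable_obsz_set.
    + by move=> t _; rewrite lee_fin le_max lexx.
    + apply/measurable_EFinP/measurable_funTS/measurable_maxr => //.
      exact: measurable_compz.
    + by move=> t /= Gj; rewrite lee_fin ge_max Gj ler0n.
  have mS := measurable_obsz_set (mG j).
  rewrite integral_cst//.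
  apply: (@le_lt_trans _ _ (j%:R%:E * 1)%E); last by rewrite mule1 ltry.
  by apply: lee_wpmul2l; [rewrite lee_fin|exact: probability_le1].
- by move=> C mC; apply: pos_version => // t; exact: sqr_ge0.
Qed.

End noise.

(** * Orthogonal sums *)

Lemma integral_cst_prob d (T : measurableType d) (R : realType)
    (P : probability T R) (r : R) : (\int[P]_t cst r%:E t = r%:E)%E.
Proof.
rewrite integral_cst// -[RHS]mule1; congr (_ * _)%E.
exact: probability_setT.
Qed.

Lemma mul_le_sqrD (R : realDomainType) (u w : R) : u * w <= u ^+ 2 + w ^+ 2.
Proof. by have := sqr_ge0 (u - w); have := sqr_ge0 u; have := sqr_ge0 w; nra. Qed.

Section orthogonal_sums.
Context d d' dO (T : measurableType d) (T' : measurableType d')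
  (Omega : measurableType dO) (R : realType).
Variables (Pr : probability Omega R) (P : probability T R) (D : nat -> Omega -> T).
Hypothesis mD : forall i, measurable_fun setT (D i).
Hypothesis PD : forall i (A : set T), measurable A -> Pr (D i @^-1` A) = P A.
Hypothesis indD : forall (I : seq nat) (A : nat -> set T), uniq I ->
     (forall i, measurable (A i)) ->
     Pr (\big[setI/setT]_(i <- I) (D i @^-1` A i)) =
     (\prod_(i <- I) Pr (D i @^-1` A i))%E.

(* [pi] hides the part of an observation that carries the noise [xi]; [V] is
   the conditional second moment of [xi] given [pi]. *)
Variables (pi : T -> T') (xi : T -> R) (V : T' -> R).
Hypotheses (mpi : measurable_fun setT pi) (mxi : measurable_fun setT xi)
  (mV : measurable_fun setT V) (V0 : forall u, 0 <= V u).
Hypothesis xi_sign : forall k : T' -> R, measurable_fun setT k ->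
  (\int[P]_t (Num.max 0 (xi t * k (pi t)))%:E =
   \int[P]_t (Num.max 0 (- (xi t * k (pi t))))%:E)%E.
Hypothesis xi_square : forall k : T' -> R, measurable_fun setT k ->
  (forall u, 0 <= k u) ->
  (\int[P]_t (xi t ^+ 2 * k (pi t))%:E = \int[P]_t (V (pi t) * k (pi t))%:E)%E.

Definition blind n (s : n.-tuple T) : n.-tuple T' := [tuple pi (tnth s i) | i < n].

Lemma measurable_blind n : measurable_fun setT (@blind n).
Proof.
by apply: measurable_tuple_of => i; apply: (measurableT_comp mpi); exact: measurable_tnth.
Qed.

Lemma blind_resample n (s : n.-tuple T) i t :
  blind (resample s i t) = resample (blind s) i (pi t).
Proof. by apply: eq_from_tnth => j; rewrite !tnth_mktuple; case: eqP. Qed.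

Variables (n : nat) (del : 'I_n -> n.-tuple T' -> R).
Hypothesis mdel : forall i, measurable_fun setT (del i).
Variable b : R.
Hypothesis del_le : forall s : n.-tuple T',
  \sum_(i < n) del i s ^+ 2 * V (tnth s i) <= b.

Let z i (s : n.-tuple T) : R := del i (blind s) * xi (tnth s i).

Let mz i : measurable_fun setT (z i).
Proof.
apply: measurable_funM; first exact: (measurableT_comp (mdel i) (@measurable_blind n)).
by apply: (measurableT_comp mxi); exact: measurable_tnth.
Qed.

Let mS := @measurable_sample _ _ _ _ D mD n.

Lemma measurable_resample_r (U : measurableType d') (s : n.-tuple U) i :
  measurable_fun setT (fun u => resample s i u).
Proof. by apply: measurable_tuple_of => j; case: eqP. Qed.

(** Redrawing observation [i] freezes all the others, so the weight becomes a function of [pi t]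
    alone and [xi_square] applies. *)
Let z2 i : (\int[Pr]_om (z i (sample D n om) ^+ 2)%:E =
  \int[Pr]_om (del i (blind (sample D n om)) ^+ 2 *
     V (tnth (blind (sample D n om)) i))%:E)%E.
Proof.
have md2 : measurable_fun setT (fun s => del i s ^+ 2) by exact: measurable_funX.
rewrite (integral_resample mD PD indD i (F := fun s => (z i s ^+ 2)%:E)); last 2 first.
- by apply/measurable_EFinP; exact: measurable_funX.
- by move=> s; rewrite lee_fin sqr_ge0.
rewrite (integral_resample mD PD indD i
  (F := fun s => (del i (blind s) ^+ 2 * V (tnth (blind s) i))%:E)); last 2 first.
- apply/measurable_EFinP/measurable_funM.
    exact: (measurableT_comp md2 (@measurable_blind n)).
  apply: (measurableT_comp mV).
  exact: (measurableT_comp (@measurable_tnth _ T' n i) (@measurable_blind n)).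
- by move=> s; rewrite lee_fin mulr_ge0 ?sqr_ge0.
apply: eq_integral => om _; set s := sample D n om.
pose k u := del i (resample (blind s) i u) ^+ 2.
have := @xi_square k.
have E t : tnth (resample s i t) i = t by rewrite tnth_mktuple eqxx.
have E' t : tnth (blind (resample s i t)) i = pi t by rewrite tnth_mktuple E.
move=> xs; transitivity (\int[P]_t (xi t ^+ 2 * k (pi t))%:E)%E.
  by apply: eq_integral => t _; rewrite /z E blind_resample exprMn mulrC.
rewrite xs.
- by apply: eq_integral => t _; rewrite E' blind_resample mulrC.
- by apply: (measurableT_comp md2); exact: measurable_resample_r.
- by move=> u; exact: sqr_ge0.
Qed.

Lemma sum_sq_le :
  (\int[Pr]_om (\sum_(i < n) (del i (blind (sample D n om)) *
     xi (D i om)) ^+ 2)%:E <= b%:E)%E.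
Proof.
under eq_integral do rewrite -sumEFin.
rewrite ge0_integral_sum//; last 2 first.
- move=> i; apply/measurable_EFinP; apply: measurable_funX.
  apply: measurable_funM => //.
    exact: (measurableT_comp (mdel i) (measurableT_comp (@measurable_blind n) mS)).
  exact: (measurableT_comp mxi).
- by move=> i om _; rewrite lee_fin sqr_ge0.
have -> : (\sum_(i < n) \int[Pr]_om ((del i (blind (sample D n om)) *
     xi (D i om)) ^+ 2)%:E = \sum_(i < n)
  \int[Pr]_om (del i (blind (sample D n om)) ^+ 2 *
     V (tnth (blind (sample D n om)) i))%:E)%E.
  apply: eq_bigr => i _; rewrite -z2; apply: eq_integral => om _.
  by rewrite /z tnth_mktuple.
have md2 i : measurable_fun setT (fun om => (del i (blind (sample D n om)) ^+ 2 *
     V (tnth (blind (sample D n om)) i))).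
  apply: measurable_funM.
    apply: measurable_funX.
    exact: (measurableT_comp (mdel i) (measurableT_comp (@measurable_blind n) mS)).
  apply: (measurableT_comp mV); apply: (measurableT_comp (@measurable_tnth _ T' n i)).
  exact: (measurableT_comp (@measurable_blind n) mS).
rewrite -ge0_integral_sum//; last 2 first.
- by move=> i; exact/measurable_EFinP.
- by move=> i om _; rewrite lee_fin mulr_ge0 ?sqr_ge0.
apply: (@le_trans _ _ (\int[Pr]_om (cst b%:E om))%E); last first.
  by rewrite integral_cst_prob.
apply: ge0_le_integral => //.
- by move=> om _; apply: sume_ge0 => i _; rewrite lee_fin mulr_ge0 ?sqr_ge0.
- by apply: emeasurable_sum => i; exact/measurable_EFinP.
- by move=> om _; rewrite sumEFin lee_fin; exact: del_le.
Qed.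

Let z_int i : Pr.-integrable setT (fun om => (z i (sample D n om) ^+ 2)%:E).
Proof.
have mzs : measurable_fun setT (fun om => z i (sample D n om) ^+ 2).
  by apply: measurable_funX; exact: (measurableT_comp (mz i) mS).
apply/integrableP; split; first exact/measurable_EFinP.
apply: le_lt_trans (ltry b); apply: le_trans sum_sq_le.
apply: ge0_le_integral => //.
- exact/measurableT_comp/measurable_EFinP.
- apply/measurable_EFinP/measurable_sum => j; apply: measurable_funX.
  apply: measurable_funM => //; last exact: (measurableT_comp mxi).
  exact: (measurableT_comp (mdel j) (measurableT_comp (@measurable_blind n) mS)).
- move=> om _; rewrite gee0_abs ?lee_fin ?sqr_ge0//.
  rewrite (bigD1 i)//= /z tnth_mktuple lerDl sumr_ge0// => j _.
  exact: sqr_ge0.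
Qed.

Let zz_int i j : Pr.-integrable setT
  (fun om => (z i (sample D n om) * z j (sample D n om))%:E).
Proof.
have mzs k : measurable_fun setT (fun om => z k (sample D n om)).
  exact: (measurableT_comp (mz k) mS).
apply: (le_integrable measurableT _ _ (integrableD measurableT (z_int i) (z_int j))).
  by apply/measurable_EFinP; exact: measurable_funM.
move=> om _ /=; rewrite lee_fin [leRHS]ger0_norm ?addr_ge0 ?sqr_ge0//.
rewrite normrM -(real_normK (num_real (z i _))) -(real_normK (num_real (z j _))).
exact: mul_le_sqrD.
Qed.

(** After redrawing observation [i], the factor [xi] of observation [j] is a constant and both
    weights depend on [pi t] only. Hence the product is [xi t] times a function of [pi t], and
    [xi_sign] equates its positive and negative parts. *)
Let zz0 i j : i != j ->
  (\int[Pr]_om (z i (sample D n om) * z j (sample D n om))%:E = 0)%E.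
Proof.
move=> ij; rewrite integral_posneg.
have mzz : measurable_fun setT (fun s => z i s * z j s) by exact: measurable_funM.
rewrite (integral_resample mD PD indD i
  (F := fun s => (Num.max 0 (z i s * z j s))%:E)); last 2 first.
- by apply/measurable_EFinP; exact: measurable_maxr.
- by move=> s; rewrite lee_fin le_max lexx.
have fin : (\int[Pr]_om (Num.max 0 (- (z i (sample D n om) * z j (sample D n om))))%:E
    \is a fin_num)%E.
  rewrite (_ : (\int[Pr]_x _)%E = (\int[Pr]_om
      ((fun om => (z i (sample D n om) * z j (sample D n om))%:E)^\- om))%E).
    exact: integrable_neg_fin_num (zz_int i j).
  by apply: eq_integral => t _; rewrite funenegE EFin_max maxC.
rewrite [X in (X - _)%E](_ : _ = (\int[Pr]_om
    (Num.max 0 (- (z i (sample D n om) * z j (sample D n om))))%:E)%E).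
  by rewrite subee.
rewrite [RHS](integral_resample mD PD indD i
  (F := fun s => (Num.max 0 (- (z i s * z j s)))%:E)); last 2 first.
- by apply/measurable_EFinP; apply: measurable_maxr => //; exact: measurableT_comp.
- by move=> s; rewrite lee_fin le_max lexx.
apply: eq_integral => om _; set s := sample D n om.
pose k u := del i (resample (blind s) i u) * (del j (resample (blind s) i u) * xi (tnth s j)).
have E t : z i (resample s i t) * z j (resample s i t) = xi t * k (pi t).
  rewrite /z /k !blind_resample !tnth_mktuple eqxx eq_sym (negbTE ij); ring.
under eq_integral do rewrite E; under [RHS]eq_integral do rewrite E.
apply: xi_sign; apply: measurable_funM.
  by apply: (measurableT_comp (mdel i)); exact: measurable_resample_r.
apply: measurable_funM => //.
by apply: (measurableT_comp (mdel j)); exact: measurable_resample_r.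
Qed.

(** The off-diagonal products integrate to zero, so the square of the sum costs no more than the sum
    of the squares. Besides the cross terms, this also yields ordinary variance bounds, by hiding
    the observations entirely. *)
Lemma sq_sum_le :
  (\int[Pr]_om ((\sum_(i < n) del i (blind (sample D n om)) *
     xi (D i om)) ^+ 2)%:E <= b%:E)%E.
Proof.
have -> : (\int[Pr]_om ((\sum_(i < n) del i (blind (sample D n om)) *
     xi (D i om)) ^+ 2)%:E = \int[Pr]_om (\sum_(i < n) \sum_(j < n)
     (z i (sample D n om) * z j (sample D n om))%:E))%E.
  apply: eq_integral => om _.
  under [RHS]eq_bigr do rewrite sumEFin; rewrite sumEFin; congr EFin.
  rewrite expr2 mulr_suml; apply: eq_bigr => i _; rewrite mulr_sumr.
  by apply: eq_bigr => j _; rewrite /z !tnth_mktuple.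
rewrite integral_sum//; last first.
  by move=> i; apply: integrable_sum => // j _; exact: zz_int.
apply: le_trans sum_sq_le.
under [leRHS]eq_integral do rewrite -sumEFin.
rewrite [leRHS]integral_sum//; last first.
  move=> i; have := z_int i; apply: eq_integrable => // om _.
  by rewrite /z tnth_mktuple.
apply: lee_sum => i _; rewrite integral_sum//.
rewrite (bigD1 i)//= big1 ?adde0 => [|j ji]; last by rewrite zz0// eq_sym.
by rewrite le_eqVlt; apply/orP; left; apply/eqP; apply: eq_integral => om _;
  rewrite /z tnth_mktuple expr2.
Qed.

End orthogonal_sums.

(** * The central limit theorem *)

Section bounded_integrals.
Context d (T : measurableType d) (R : realType) (P : probability T R).

Lemma bounded_integrable (f : T -> R) (M : R) : measurable_fun setT f ->
  (forall t, `|f t| <= M) -> P.-integrable setT (EFin \o f).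
Proof.
move=> mf fM; apply: measurable_bounded_integrable => //.
  rewrite (@le_lt_trans _ _ 1%E) ?ltry//; exact: probability_le1.
by exists M; split; [exact: num_real|move=> y My t _; apply: le_trans (ltW My)].
Qed.

Lemma Rintegral_cst_prob (r : R) : \int[P]_t (cst r t) = r.
Proof. by rewrite /Rintegral integral_cst_prob. Qed.

Lemma EFin_Rintegral (f : T -> R) : P.-integrable setT (EFin \o f) ->
  ((\int[P]_t f t)%:E = \int[P]_t (f t)%:E)%E.
Proof. by move=> fi; rewrite /Rintegral fineK//; exact: integrable_fin_num. Qed.

Lemma Rintegral_indic (S : set T) : measurable S ->
  (\int[P]_t (\1_S t))%:E = P S.
Proof.
move=> mS; rewrite EFin_Rintegral; last first.
  apply: (@bounded_integrable _ 1); first exact: measurable_indic.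
  by move=> t; rewrite indicE; case: (_ \in _); rewrite ?normr1 ?normr0.
by rewrite integral_indic// setIT.
Qed.

Lemma Rintegral_close (f g : T -> R) (e : R) :
  P.-integrable setT (EFin \o f) -> P.-integrable setT (EFin \o g) ->
  (forall t, `|f t - g t| <= e) -> `|\int[P]_t f t - \int[P]_t g t| <= e.
Proof.
move=> fi gi fg; rewrite -RintegralB//.
have fgi : P.-integrable setT (EFin \o (fun t => f t - g t)).
  by rewrite (_ : _ \o _ = (EFin \o f) \- (EFin \o g))%E//; exact: integrableB.
apply: (le_trans (le_normr_Rintegral measurableT fgi)).
rewrite -[leRHS](Rintegral_cst_prob e); apply: le_Rintegral => //.
  exact: (integrable_norm fgi).
by apply: (@bounded_integrable _ `|e|) => //; exact: measurable_cst.
Qed.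

Lemma markov_gt (f : T -> R) (b l : R) : measurable_fun setT f ->
  (forall t, 0 <= f t) -> (\int[P]_t (f t)%:E <= b%:E)%E -> 0 < l ->
  (P [set t | (l < f t)%R] <= (b / l)%:E)%E.
Proof.
move=> mf f0 fb l0.
have mf' : measurable_fun setT (EFin \o f) by exact/measurable_EFinP.
have := le_integral_abse P measurableT mf' l0.
rewrite setTI => h.
have sub : [set t | l < f t] `<=` [set t | (l%:E <= `|(EFin \o f) t|)%E].
  by move=> t /= lt; rewrite lee_fin ger0_norm// ltW.
have mS1 : measurable [set t | l < f t].
  have -> : [set t | l < f t] = f @^-1` `]l, +oo[%classic.
    by apply/seteqP; split => t /=; rewrite in_itv/= andbT.
  by rewrite -[X in measurable X]setTI; exact: mf.
have mS2 : measurable [set t | (l%:E <= `|(EFin \o f) t|)%E].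
  have -> : [set t | (l%:E <= `|(EFin \o f) t|)%E] = f @^-1` `[l, +oo[%classic.
    by apply/seteqP; split => t /=; rewrite in_itv/= andbT lee_fin ger0_norm.
  by rewrite -[X in measurable X]setTI; exact: mf.
rewrite EFinM lee_pdivlMr//.
apply: le_trans fb; rewrite muleC.
apply: (@le_trans _ _ (l%:E * P [set t | (l%:E <= `|(EFin \o f) t|)%E])%E).
  apply: lee_wpmul2l; first by rewrite lee_fin ltW.
  by apply: le_measure; rewrite ?inE.
apply: (le_trans h); rewrite le_eqVlt; apply/orP; left; apply/eqP.
by apply: eq_integral => t _; rewrite /= ger0_norm.
Qed.

Lemma posneg_of_integral0 (h : T -> R) : P.-integrable setT (EFin \o h) ->
  \int[P]_t h t = 0 ->
  (\int[P]_t (Num.max 0 (h t))%:E = \int[P]_t (Num.max 0 (- h t))%:E)%E.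
Proof.
move=> hi h0.
have : (\int[P]_t (h t)%:E = 0)%E by rewrite -EFin_Rintegral// h0.
rewrite integral_posneg => /eqP; rewrite sube_eq ?add0e; first by move=> /eqP.
  rewrite (_ : (\int[P]_x _)%E = (\int[P]_t ((EFin \o h)^\+ t)%E)%E).
    exact: integrable_pos_fin_num.
  by apply: eq_integral => t _; rewrite funeposE EFin_max maxC.
by rewrite fin_num_adde_defr.
Qed.

End bounded_integrals.

Lemma measurable_gcdf (R : realType) : measurable_fun setT (@gcdf R).
Proof. by apply: nondecreasing_measurable => // x y; exact: gcdf_nd. Qed.

Lemma telescope_le (R : realDomainType) (u : nat -> R) (e : R) n :
  (forall k, (k < n)%N -> `|u k.+1 - u k| <= e) -> `|u n - u 0%N| <= n%:R * e.
Proof.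
elim: n => [_|n IH H]; first by rewrite subrr normr0 mul0r.
rewrite -(subrKA (u n)) (le_trans (ler_normD _ _))// -natr1 mulrDl mul1r addrC.
by rewrite lerD ?H// IH// => k kn; apply: H; exact: ltnW.
Qed.

Section rho.
Context {R : realType}.

Lemma rho_bounds (k : R) : 0 <= k <= 3 ->
  let r := (Num.sqrt (1 + k))^-1 in
  [/\ 2^-1 <= r <= 1, (r - 1) ^+ 2 <= k ^+ 2 / 4 & `|r - 1 + k / 2| <= k ^+ 2].
Proof.
move=> /andP[k0 k3] r.
pose q := Num.sqrt (1 + k).
have q2 : q ^+ 2 = 1 + k by rewrite sqr_sqrtr// addr_ge0.
have q0 : 0 <= q by exact: sqrtr_ge0.
have q1 : 1 <= q by nra.
have qle2 : q <= 2 by nra.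
have qgt0 : 0 < q by lra.
have rq : r * q = 1 by rewrite mulVf// gt_eqF.
have r0 : 0 < r by rewrite invr_gt0.
have r1 : r <= 1 by nra.
have r2 : 2^-1 <= r by nra.
have kE : k = (q - 1) * (q + 1) by lra.
have qk : q - 1 <= k / 2 by nra.
have e1 : 1 - r = r * (q - 1) by lra.
have r1k : 1 - r <= k / 2 by nra.
split; first by rewrite r2.
  by nra.
have -> : r - 1 + k / 2 = (q - 1) ^+ 2 * (q + 2) * r / 2.
  rewrite kE; have -> : r = q^-1 by [].
  by field; rewrite gt_eqF.
have qq : 0 <= (q - 1) ^+ 2 by exact: sqr_ge0.
have qr : 0 <= (q + 2) * r <= 3.
  by apply/andP; split; [nra|nra].
rewrite ger0_norm; last first.
  by rewrite divr_ge0// -mulrA mulr_ge0//; case/andP: qr.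
case/andP: qr => qr0 qr3.
have : (q - 1) ^+ 2 <= k ^+ 2 / 4 by nra.
nra.
Qed.

(** The first-order effect of adding variance [k] is [- k / 2 * (z * gpdf z)], exactly the
    second-order Taylor term of a centred increment of variance [k]. This is the heat equation in
    the form used below. *)
Lemma gcdf_rho (k z : R) : 0 <= k <= 3 ->
  `|gcdf (z / Num.sqrt (1 + k)) - gcdf z + k / 2 * (z * gpdf z)|
   <= 2 * gK * k ^+ 2.
Proof.
move=> k03; have [r2 rk rk2] := rho_bounds k03.
set r := (Num.sqrt _)^-1 in r2 rk rk2 *.
have := gcdf_scale2 z r2; rewrite [r * z]mulrC => h.
have zg : `|z * gpdf z| <= gK.
  by rewrite normrM (ger0_norm (gpdf_ge0 _)); exact: (@gpdf_le _ 1).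
have -> : gcdf (z * r) - gcdf z + k / 2 * (z * gpdf z) =
  (gcdf (z * r) - gcdf z - (r - 1) * (z * gpdf z)) + (r - 1 + k / 2) * (z * gpdf z).
  by ring.
apply: (le_trans (ler_normD _ _)).
have h2 : `|(r - 1 + k / 2) * (z * gpdf z)| <= gK * k ^+ 2.
  by rewrite normrM mulrC ler_pM.
have h3 : 4 * gK * (r - 1) ^+ 2 <= gK * k ^+ 2.
  have := @gK_ge0 R; nra.
lra.
Qed.

End rho.

Section clt.
Context d dO (T : measurableType d) (Omega : measurableType dO) (R : realType).
Variables (Pr : probability Omega R) (P : probability T R) (D : nat -> Omega -> T).
Hypothesis mD : forall i, measurable_fun setT (D i).
Hypothesis PD : forall i (A : set T), measurable A -> Pr (D i @^-1` A) = P A.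
Hypothesis indD : forall (I : seq nat) (A : nat -> set T), uniq I ->
     (forall i, measurable (A i)) ->
     Pr (\big[setI/setT]_(i <- I) (D i @^-1` A i)) =
     (\prod_(i <- I) Pr (D i @^-1` A i))%E.

Lemma integral_law i (f : T -> R) : measurable_fun setT f -> (forall t, 0 <= f t) ->
  (\int[Pr]_om (f (D i om))%:E = \int[P]_t (f t)%:E)%E.
Proof.
move=> mf f0.
have := @weighted_law_eq _ _ _ Omega T T R Pr P measurable (fun=> setT) (cst 1)
  (D i) (cst 1) id (EFin \o f).
move=> H; transitivity (\int[Pr]_om ((cst 1 om : R)%:E * (EFin \o f) (D i om)))%E.
  by apply: eq_integral => x _; rewrite mul1e.
rewrite {}H//.
- by apply: eq_integral => x _; rewrite mul1e.
- apply/esym; apply: sigma_algebra_id; exact: sigma_algebra_measurable.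
- by move=> A B mA mB; exact: measurableI.
- by rewrite bigcup_const.
- move=> A mA; rewrite -[LHS]/(\int[Pr]_(x in _) cst 1%:E x)%E.
  rewrite -[RHS]/(\int[P]_(x in _) cst 1%:E x)%E !integral_cst// ?mul1e.
    exact: PD.
  by rewrite -[X in measurable X]setTI; exact: mD.
- move=> k; rewrite preimage_setT -[ltLHS]/(\int[Pr]_x cst 1%:E x)%E.
  by rewrite integral_cst_prob ltry.
- exact/measurable_EFinP.
Qed.

(** It is enough to compare the average over one redrawn observation with [H], for each outcome of
    the remaining sample. *)
Lemma resample_close n (i : 'I_n) (F : n.-tuple T -> R) (H : Omega -> R) (e : R) :
  measurable_fun setT F -> (forall s, 0 <= F s <= 1) ->
  measurable_fun setT H -> (forall om, 0 <= H om <= 1) ->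
  (forall om, `|\int[P]_t F (resample (sample D n om) i t) - H om| <= e) ->
  `|\int[Pr]_om F (sample D n om) - \int[Pr]_om H om| <= e.
Proof.
move=> mF F01 mH H01 FH.
pose J om := \int[P]_t F (resample (sample D n om) i t).
have F1 s : `|F s| <= 1 by have /andP[? ?] := F01 s; rewrite ger0_norm.
have mres om : measurable_fun setT (fun t => F (resample (sample D n om) i t)).
  apply: (measurableT_comp mF); apply: measurable_tuple_of => j.
  by case: eqP => _; [exact: measurable_id|exact: measurable_cst].
have JE om : (J om)%:E = (\int[P]_t (F (resample (sample D n om) i t))%:E)%E.
  by apply: EFin_Rintegral; exact: (@bounded_integrable _ _ _ _ _ 1).
have mJ : measurable_fun setT J.
  apply/measurable_EFinP.
  have := @measurable_fun_fubini_tonelli_F _ _ _ _ _ P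
    (fun p : Omega * T => (F (resample (sample D n p.1) i p.2))%:E).
  rewrite (_ : fubini_F P _ = EFin \o J); last first.
    by apply/funext => om; rewrite /= JE.
  apply; last by move=> p; rewrite lee_fin; have /andP[] := F01 (resample (sample D n p.1) i p.2).
  by apply/measurable_EFinP; exact: (measurableT_comp mF (measurable_resample_sample mD i)).
have J01 om : `|J om| <= 1.
  have := @Rintegral_close _ _ _ P (fun t => F (resample (sample D n om) i t)) (cst 0) 1.
  rewrite Rintegral_cst_prob subr0; apply.
  - exact: (@bounded_integrable _ _ _ _ _ 1).
  - by apply: (@bounded_integrable _ _ _ _ _ 0) => // t; rewrite normr0.
  - by move=> t; rewrite subr0.
have -> : \int[Pr]_om F (sample D n om) = \int[Pr]_om J om.
  rewrite /Rintegral; congr fine.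
  rewrite (integral_resample mD PD indD i (F := EFin \o F)).
  - by apply: eq_integral => om _; rewrite JE.
  - exact/measurable_EFinP.
  - by move=> s; rewrite lee_fin; have /andP[] := F01 s.
apply: Rintegral_close => //.
- exact: (@bounded_integrable _ _ _ _ _ 1).
- apply: (@bounded_integrable _ _ _ _ _ 1) => // om.
  by have /andP[? ?] := H01 om; rewrite ger0_norm.
Qed.

Variable a : T -> R.
Hypotheses (ma : measurable_fun setT a) (ai : P.-integrable setT (EFin \o a)).
Hypothesis a0 : \int[P]_t a t = 0.
Hypothesis a2 : (\int[P]_t (a t ^+ 2)%:E = 1)%E.
Variables (L tau del : R).
Hypothesis tail : (\int[P]_t (a t ^+ 2 * (L < `|a t|)%R%:R)%:E <= del%:E)%E.

Let a2i : P.-integrable setT (EFin \o (fun t => a t ^+ 2)).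
Proof.
apply/integrableP; split; first by apply/measurable_EFinP; exact: measurable_funX.
under eq_integral do rewrite /= ger0_norm ?sqr_ge0//.
by rewrite a2 ltry.
Qed.

Lemma measurable_tail : measurable_fun setT (fun t => a t ^+ 2 * (L < `|a t|)%R%:R).
Proof.
apply: measurable_funM; first exact: measurable_funX.
rewrite (_ : (fun t => _) = \1_[set t | L < `|a t|]); last first.
  by apply/funext => t; rewrite indicE; case: (boolP (L < _)) => h;
    [rewrite mem_set|rewrite memNset//=; exact/negP].
apply: measurable_indic.
have -> : [set t | L < `|a t|] = (fun t => `|a t|) @^-1` `]L, +oo[%classic.
  by apply/seteqP; split => t /=; rewrite in_itv/= andbT.
rewrite -[X in measurable X]setTI; exact: (measurableT_comp _ ma).
Qed.

Let ti : P.-integrable setT (EFin \o (fun t => a t ^+ 2 * (L < `|a t|)%R%:R)).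
Proof.
apply: (le_integrable measurableT _ _ a2i).
  by apply/measurable_EFinP; exact: measurable_tail.
move=> t _ /=; rewrite lee_fin [leRHS]ger0_norm ?sqr_ge0// ger0_norm; last first.
  by apply: mulr_ge0; [exact: sqr_ge0|].
by case: (_ < _); rewrite ?mulr1 ?mulr0// sqr_ge0.
Qed.

(** Averaging the Taylor expansion removes the linear term by [a0] and fixes the quadratic one by
    [a2]; that term cancels against [gcdf_rho]. In the remainder, [min 1 |c a|] is at most [tau]
    when [|a| <= L] and at most 1 otherwise, so the tail of [a ^ 2] contributes [del]. *)
Lemma clt_step c z : c ^+ 2 <= 3 -> `|c| * L <= tau -> 0 <= tau ->
  `|\int[P]_t gcdf (z + c * a t) - gcdf (z / Num.sqrt (1 + c ^+ 2))|
  <= c ^+ 2 * (2 * gK * (tau + del) + 2 * gK * c ^+ 2).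
Proof.
move=> c3 cL tau0.
pose rem t := gcdf (z + c * a t) - gcdf z - c * a t * gpdf z
    + (c * a t) ^+ 2 / 2 * (z * gpdf z).
have mga : measurable_fun setT (fun t => gcdf (z + c * a t)).
  apply: (measurableT_comp (@measurable_gcdf R)).
  by apply: measurable_funD => //; exact: measurable_funM.
have Fi : P.-integrable setT (EFin \o (fun t => gcdf (z + c * a t))).
  apply: (@bounded_integrable _ _ _ _ _ 1) => // t.
  by rewrite ger0_norm ?gcdf_ge0 ?gcdf_le1.
pose lin t := (c * gpdf z) * a t - (c ^+ 2 / 2 * (z * gpdf z)) * a t ^+ 2.
have zi (k : R) (f : T -> R) : P.-integrable setT (EFin \o f) ->
    P.-integrable setT (EFin \o (fun t => k * f t)).
  move=> fi; rewrite (_ : _ \o _ = (fun t => k%:E * (EFin \o f) t)%E)//.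
  exact: integrableZl.
have bi (f g : T -> R) : P.-integrable setT (EFin \o f) ->
    P.-integrable setT (EFin \o g) -> P.-integrable setT (EFin \o (fun t => f t - g t)).
  by move=> fi gi; rewrite (_ : _ \o _ = (EFin \o f) \- (EFin \o g))%E//; exact: integrableB.
have ci' : P.-integrable setT (EFin \o (fun=> gcdf z)).
  by apply: (@bounded_integrable _ _ _ _ _ 1) => // t; rewrite ger0_norm ?gcdf_ge0 ?gcdf_le1.
have lini : P.-integrable setT (EFin \o lin) by apply: bi; exact: zi.
have linE : \int[P]_t lin t = - (c ^+ 2 / 2 * (z * gpdf z)).
  rewrite RintegralB//; [|exact: zi|exact: zi].
  rewrite !RintegralZl// a0 mulr0 add0r.
  by rewrite /Rintegral a2 mulr1.
have remE t : rem t = gcdf (z + c * a t) - gcdf z - lin t.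
  by rewrite /rem /lin exprMn; field.
have remi : P.-integrable setT (EFin \o rem).
  rewrite (_ : rem = fun t => (gcdf (z + c * a t) - gcdf z) - lin t); last exact/funext.
  by apply: (bi (fun t => gcdf (z + c * a t) - gcdf z)) => //; exact: bi.
have remI : \int[P]_t rem t =
    \int[P]_t gcdf (z + c * a t) - gcdf z + c ^+ 2 / 2 * (z * gpdf z).
  under eq_Rintegral do rewrite remE.
  rewrite RintegralB//; last exact: bi.
  rewrite linE opprK RintegralB//; congr (_ - _ + _).
  exact: (Rintegral_cst_prob P (gcdf z)).
have remb : `|\int[P]_t rem t| <= 2 * gK * c ^+ 2 * (tau + del).
  apply: (le_trans (le_normr_Rintegral measurableT remi)).
  (* The sum is written as a difference of multiples so that [bi] and [zi] give its
     integrability. *)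
  pose bnd t := 2 * gK * c ^+ 2 * (tau * a t ^+ 2 - (- 1) * (a t ^+ 2 * (L < `|a t|)%R%:R)).
  apply: (@le_trans _ _ (\int[P]_t bnd t)).
    apply: le_Rintegral => //.
    - exact: (integrable_norm remi).
    - exact: (zi _ _ (bi _ _ (zi tau _ a2i) (zi (-1) _ ti))).
    move=> t _; apply: (le_trans (gcdf_taylor _ _)).
    rewrite (_ : bnd t = 2 * gK *
        ((tau + (L < `|a t|)%R%:R) * (c * a t) ^+ 2)); last by rewrite /bnd; ring.
    apply: ler_wpM2l; first by rewrite mulr_ge0 ?gK_ge0.
    apply: ler_wpM2r; first exact: sqr_ge0.
    case: ltP => La; first by rewrite ge_min lerDr tau0.
    rewrite addr0 ge_min; apply/orP; right.
    by rewrite normrM; apply: le_trans cL; apply: ler_wpM2l.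
  rewrite RintegralZl//; last exact: (bi _ _ (zi tau _ a2i) (zi (-1) _ ti)).
  apply: ler_wpM2l.
    by apply: mulr_ge0; [rewrite mulr_ge0 ?gK_ge0|exact: sqr_ge0].
  rewrite RintegralB//; [|exact: (zi)|exact: (zi)].
  rewrite !RintegralZl// mulN1r opprK; apply: lerD.
    by rewrite /Rintegral a2 mulr1.
  by rewrite -lee_fin EFin_Rintegral.
have := @gcdf_rho R (c ^+ 2) z; rewrite sqr_ge0 c3 => /(_ isT) hr.
rewrite remI in remb.
set I := \int[P]_t _ in remb *; set g1 := gcdf (z / _) in hr *.
have -> : I - g1 = (I - gcdf z + c ^+ 2 / 2 * (z * gpdf z)) -
   (g1 - gcdf z + c ^+ 2 / 2 * (z * gpdf z)) by ring.
apply: (le_trans (ler_normB _ _)).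
apply: (le_trans (lerD remb hr)).
by rewrite le_eqVlt; apply/orP; left; apply/eqP; ring.
Qed.

Let S n om : R := \sum_(i < n) a (D i om).

Lemma measurable_sumD (f : T -> R) n : measurable_fun setT f ->
  measurable_fun setT (fun om => \sum_(i < n) f (D i om)).
Proof. by move=> mf; apply: measurable_sum => i; exact: (measurableT_comp mf). Qed.

(** The variance [th k] never drops below [s ^ 2], so a step has [c ^ 2 <= 1 / (n s ^ 2)]. Summing
    [n] steps leaves the factor [1 / s ^ 2]. *)
Lemma clt_smooth n (s t : R) : (0 < n)%N -> 0 < s ->
  (n%:R * s ^+ 2)^-1 <= 3 -> L <= tau * Num.sqrt (n%:R * s ^+ 2) -> 0 <= tau ->
  `|\int[Pr]_om gcdf ((t - S n om / Num.sqrt n%:R) / s) -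
    gcdf (t / Num.sqrt (s ^+ 2 + 1))| <=
  (2 * gK * (tau + del) + 2 * gK * (n%:R * s ^+ 2)^-1) / s ^+ 2.
Proof.
move=> n0 s0 k3 Ltau tau0.
have n0' : 0 < n%:R :> R by rewrite ltr0n.
have s20 : 0 < s ^+ 2 by rewrite exprn_gt0.
have ns0 : 0 < n%:R * s ^+ 2 by rewrite mulr_gt0.
pose th k : R := s ^+ 2 + (n - k)%:R / n%:R.
have th_ge k : s ^+ 2 <= th k by rewrite lerDl divr_ge0.
have th0 k : 0 < th k by exact: lt_le_trans (th_ge k).
(* [F 0] is deterministic, [F n] is the smoothed statistic, and one step
   trades the summand [a (D k)] for its variance [1 / n] in [th]. *)
pose F k om := gcdf ((t - S k om / Num.sqrt n%:R) / Num.sqrt (th k)).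
pose err := (n%:R * s ^+ 2)^-1 *
  (2 * gK * (tau + del) + 2 * gK * (n%:R * s ^+ 2)^-1).
have gK0 := @gK_ge0 R.
have del0 : 0 <= del.
  rewrite -lee_fin; apply: le_trans tail; apply: integral_ge0 => x _.
  by rewrite lee_fin mulr_ge0 ?sqr_ge0.
have mF k : measurable_fun setT (F k).
  apply: (measurableT_comp (@measurable_gcdf R)); apply: measurable_funM => //.
  apply: measurable_funB => //; apply: measurable_funM => //.
  exact: measurable_sumD.
have F01 k om : 0 <= F k om <= 1 by rewrite gcdf_ge0 gcdf_le1.
have step k : (k < n)%N ->
    `|\int[Pr]_om F k.+1 om - \int[Pr]_om F k om| <= err.
  move=> kn.
  pose G (u : k.+1.-tuple T) := gcdf ((t - (\sum_(i < k.+1) a (tnth u i)) /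
    Num.sqrt n%:R) / Num.sqrt (th k.+1)).
  have mG : measurable_fun setT G.
    apply: (measurableT_comp (@measurable_gcdf R)); apply: measurable_funM => //.
    apply: measurable_funB => //; apply: measurable_funM => //.
    apply: measurable_sum => i; apply: (measurableT_comp ma).
    exact: measurable_tnth.
  have -> : \int[Pr]_om F k.+1 om = \int[Pr]_om G (sample D k.+1 om).
    apply: eq_Rintegral => om _; rewrite /F /G.
    rewrite (_ : S k.+1 om = \sum_(i < k.+1) a (tnth (sample D k.+1 om) i))//.
    by apply: eq_bigr => i _; rewrite tnth_mktuple.
  apply: (@resample_close _ (@ord_max k) G (F k) err) => //.
    by move=> u; rewrite gcdf_ge0 gcdf_le1.
  move=> om.
  (* The summand enters with a minus sign. Since [c ^ 2 = 1 / (n th (k + 1))], one has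
     [th k = th (k + 1) (1 + c ^ 2)], and the target of [clt_step] is exactly [F k]. *)
  pose c := - (Num.sqrt n%:R * Num.sqrt (th k.+1))^-1.
  pose z := (t - S k om / Num.sqrt n%:R) / Num.sqrt (th k.+1).
  have sn0 : 0 < Num.sqrt (n%:R : R) by rewrite sqrtr_gt0.
  have sth0 : 0 < Num.sqrt (th k.+1) by rewrite sqrtr_gt0.
  have cE : c ^+ 2 = (n%:R * th k.+1)^-1.
    by rewrite sqrrN exprVn exprMn !sqr_sqrtr ?ltW.
  have c2le : c ^+ 2 <= (n%:R * s ^+ 2)^-1.
    rewrite cE lef_pV2 ?posrE ?mulr_gt0//.
    by rewrite ler_pM2l.
  have -> : \int[P]_x G (resample (sample D k.+1 om) ord_max x) =
      \int[P]_x gcdf (z + c * a x).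
    apply: eq_Rintegral => x _; rewrite /G; congr gcdf.
    rewrite big_ord_recr /= tnth_mktuple eqxx.
    rewrite (_ : \sum_(i < k) _ = S k om).
      by rewrite /z /c; field; rewrite !gt_eqF.
    apply: eq_bigr => i _; rewrite !tnth_mktuple.
    by rewrite -val_eqE /= ltn_eqF.
  have -> : F k om = gcdf (z / Num.sqrt (1 + c ^+ 2)).
    rewrite /F /z; congr gcdf; rewrite -mulrA -invfM -sqrtrM ?ltW//.
    congr (_ / Num.sqrt _); rewrite cE /th.
    have -> : (n - k)%:R = (n - k.+1)%:R + 1 :> R.
      by rewrite natr1 subnSK.
    have h : th k.+1 != 0 by rewrite gt_eqF.
    rewrite -/(th k.+1) mulrDr mulr1 invfM mulrCA mulfV// mulr1 /th; field.
    by rewrite gt_eqF.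
  apply: (le_trans (clt_step _ _ _ _)) => //.
  - exact: le_trans c2le k3.
  - have L0 : `|c| * L <= (Num.sqrt (n%:R * s ^+ 2))^-1 * (tau * Num.sqrt (n%:R * s ^+ 2)).
      have cs : `|c| <= (Num.sqrt (n%:R * s ^+ 2))^-1.
        rewrite -[X in X <= _]ger0_norm// -ler_sqr ?nnegrE// normr_id.
        by rewrite real_normK ?num_real// [leRHS]exprVn sqr_sqrtr//; exact: ltW.
      apply: (@le_trans _ _ (`|c| * (tau * Num.sqrt (n%:R * s ^+ 2)))).
        by apply: ler_wpM2l.
      by apply: ler_wpM2r => //; rewrite mulr_ge0.
    apply: (le_trans L0); rewrite mulrCA mulVf ?mulr1//.
    by rewrite gt_eqF ?sqrtr_gt0.
  - apply: ler_pM => //; first exact: sqr_ge0.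
      have gK2 : 0 <= 2 * gK :> R by rewrite mulr_ge0.
      by apply: addr_ge0; apply: mulr_ge0 => //; [exact: addr_ge0|exact: sqr_ge0].
    by rewrite lerD2l; apply: ler_wpM2l => //; rewrite mulr_ge0.
have := @telescope_le _ (fun k => \int[Pr]_om F k om) err n step.
rewrite (_ : \int[Pr]_om F n om = \int[Pr]_om
    gcdf ((t - S n om / Num.sqrt n%:R) / s)); last first.
  by apply: eq_Rintegral => om _; rewrite /F /th subnn mul0r addr0 sqrtr_sqr gtr0_norm.
rewrite (_ : \int[Pr]_om F 0%N om = gcdf (t / Num.sqrt (s ^+ 2 + 1))); last first.
  rewrite -[RHS](Rintegral_cst_prob Pr); apply: eq_Rintegral => om _.
  by rewrite /F /S big_ord0 mul0r subr0 /th subn0 divff ?gt_eqF.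
move=> /le_trans; apply; rewrite /err le_eqVlt; apply/orP; left; apply/eqP.
by field; rewrite !gt_eqF.
Qed.

(** The smoothing is undone by shifting the threshold by [M s]: beyond that distance the kernel is
    within [e] of the indicator. The shift costs [gK M s], and returning from variance [s ^ 2 + 1]
    to 1 costs [2 gK s ^ 2]. *)
Lemma clt_bound n (s e M t : R) : (0 < n)%N -> 0 < s -> s <= 1 ->
  (n%:R * s ^+ 2)^-1 <= 3 -> L <= tau * Num.sqrt (n%:R * s ^+ 2) -> 0 <= tau ->
  0 <= M -> gcdf (- M) <= e -> 1 - e <= gcdf M ->
  (`| Pr [set om | (S n om / Num.sqrt n%:R <= t)%R] - (gcdf t)%:E | <=
   ((2 * gK * (tau + del) + 2 * gK * (n%:R * s ^+ 2)^-1) / s ^+ 2 + e +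
     gK * (M * s) + 2 * gK * s ^+ 2)%:E)%E.
Proof.
move=> n0 s0 s1 k3 Ltau tau0 M0 Me1 Me2.
set A := [set om | _].
have gK0 := @gK_ge0 R.
pose X om := S n om / Num.sqrt n%:R.
have mX : measurable_fun setT X by apply: measurable_funM => //; exact: measurable_sumD.
have mA : measurable A.
  have -> : A = X @^-1` `]-oo, t]%classic.
    by apply/seteqP; split => om /=; rewrite in_itv.
  by rewrite -[Y in measurable Y]setTI; exact: mX.
rewrite -Rintegral_indic// -EFinB abse_EFin lee_fin.
pose err := (2 * gK * (tau + del) + 2 * gK * (n%:R * s ^+ 2)^-1) / s ^+ 2.
rewrite -/err.
have ii : Pr.-integrable setT (EFin \o (\1_A : Omega -> R)).
  apply: (@bounded_integrable _ _ _ _ _ 1); first exact: measurable_indic.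
  by move=> om; rewrite indicE; case: (_ \in _); rewrite ?normr1 ?normr0.
have gi t' : Pr.-integrable setT (EFin \o (fun om => gcdf ((t' - X om) / s))).
  apply: (@bounded_integrable _ _ _ _ _ 1).
    apply: (measurableT_comp (@measurable_gcdf R)); apply: measurable_funM => //.
    exact: measurable_funB.
  by move=> om; rewrite ger0_norm ?gcdf_ge0 ?gcdf_le1.
have ce : Pr.-integrable setT (EFin \o (fun=> e)).
  by apply: (@bounded_integrable _ _ _ _ _ `|e|).
have ceE : \int[Pr]_om e = e := Rintegral_cst_prob Pr e.
have di (f : Omega -> R) : Pr.-integrable setT (EFin \o f) ->
    Pr.-integrable setT (EFin \o (fun om => f om + e)).
  by move=> fi; rewrite (_ : _ \o _ = (EFin \o f) \+ (EFin \o (fun=> e)))%E//; exact: integrableD.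
have drift t' : `|t' - t| <= M * s ->
    `|gcdf (t' / Num.sqrt (s ^+ 2 + 1)) - gcdf t| <= gK * (M * s) + 2 * gK * s ^+ 2.
  move=> tt.
  have s23 : 0 <= s ^+ 2 <= 3 by rewrite sqr_ge0/=; nra.
  have [/andP[r2 r1] _ rk] := rho_bounds s23.
  have := @gcdf_scale R (Num.sqrt (1 + s ^+ 2))^-1 t' r2.
  rewrite mulrC [1 + _]addrC => h1; have h2 := gcdf_lip t t'.
  have h3 : `|(Num.sqrt (s ^+ 2 + 1))^-1 - 1| <= s ^+ 2.
    have [_ sq _] := rho_bounds s23; rewrite (addrC 1) in sq.
    rewrite -ler_sqr ?nnegrE ?sqr_ge0// real_normK ?num_real//.
    by apply: (le_trans sq); rewrite ler_pdivrMr// ler_peMr ?sqr_ge0// ler1n.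
  set g1 := gcdf (t' / _) in h1 *.
  have -> : g1 - gcdf t = (g1 - gcdf t') + (gcdf t' - gcdf t) by ring.
  apply: (le_trans (ler_normD _ _)); rewrite addrC; apply: lerD.
    by apply: (le_trans h2); apply: ler_wpM2l.
  by apply: (le_trans h1); apply: ler_wpM2l => //; rewrite mulr_ge0.
have sm t' := clt_smooth t' n0 s0 k3 Ltau tau0.
rewrite ler_norml; apply/andP; split.
- pose t' := t - M * s.
  have tt : `|t' - t| <= M * s.
    by rewrite /t' addrAC subrr add0r normrN ger0_norm// mulr_ge0// ltW.
  have h : \int[Pr]_om gcdf ((t' - X om) / s) <= \int[Pr]_om (\1_A om + e).
    apply: le_Rintegral => //; first exact: di.
    move=> om _; rewrite indicE; case: (boolP (om \in A)) => [_|].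
      by apply: (le_trans (gcdf_le1 _)); rewrite lerDl; apply: le_trans Me1; exact: gcdf_ge0.
    rewrite notin_setE /A/= => /negP; rewrite -ltNge -/(X om) => tX.
    rewrite add0r; apply: le_trans Me1; apply: gcdf_nd.
    rewrite ler_pdivrMr// /t'; lra.
  rewrite RintegralD// ceE in h.
  have := sm t'; have := drift _ tt; rewrite -/err.
  rewrite !ler_norml => /andP[d1 d2] /andP[d3 d4].
  set I := \int[Pr]_om (\1_A om) in h *.
  rewrite /X in h.
  lra.
- pose t' := t + M * s.
  have tt : `|t' - t| <= M * s.
    by rewrite /t' addrAC subrr add0r ger0_norm// mulr_ge0// ltW.
  have h : \int[Pr]_om \1_A om <= \int[Pr]_om (gcdf ((t' - X om) / s) + e).
    apply: le_Rintegral => //; first exact: di.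
    move=> om _; rewrite indicE; case: (boolP (om \in A)) => [|_].
      rewrite inE /A/= -/(X om) => tX.
      suff : 1 - e <= gcdf ((t' - X om) / s) by rewrite lerBlDr.
      apply: (le_trans Me2); apply: gcdf_nd.
      rewrite ler_pdivlMr// /t'; lra.
    by rewrite addr_ge0 ?gcdf_ge0//; apply: le_trans Me1; exact: gcdf_ge0.
  rewrite RintegralD// ceE in h.
  have := sm t'; have := drift _ tt; rewrite -/err.
  rewrite !ler_norml => /andP[d1 d2] /andP[d3 d4].
  set I := \int[Pr]_om (\1_A om) in h *.
  rewrite /X in h.
  lra.
Qed.

(** Fourth moments may be infinite, so [a ^ 2] is truncated where [|a|] exceeds [L]. Each of three
    errors takes one [r]: the fluctuation of the truncated mean by Chebyshev, the average of the
    discarded part by Markov, and the bias of the truncation, at most [del]. *)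
Lemma wlln_bound n (r : R) : (0 < n)%N -> 0 < r -> 0 <= L -> del <= r ->
  (Pr [set om | (3 * r < `|(\sum_(i < n) a (D i om) ^+ 2) / n%:R - 1|)%R] <=
   (L ^+ 4 / (n%:R * r ^+ 2) + del / r)%:E)%E.
Proof.
move=> n0 r0 L0 delr.
have n0' : 0 < n%:R :> R by rewrite ltr0n.
pose q t := a t ^+ 2 * (L < `|a t|)%R%:R.
pose b t := a t ^+ 2 - q t.
have mq : measurable_fun setT q := measurable_tail.
have mb : measurable_fun setT b by apply: measurable_funB => //; exact: measurable_funX.
have q0 t : 0 <= q t by rewrite mulr_ge0 ?sqr_ge0.
have bL t : 0 <= b t <= L ^+ 2.
  rewrite /b /q; case: ltP => h; rewrite ?mulr1 ?mulr0 ?subrr ?subr0 ?lexx ?sqr_ge0//=.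
  by rewrite -(real_normK (num_real (a t))) ler_sqr ?nnegrE.
have bi : P.-integrable setT (EFin \o b).
  apply: (@bounded_integrable _ _ _ _ _ (L ^+ 2)) => // t.
  by have /andP[? ?] := bL t; rewrite ger0_norm.
pose m := \int[P]_t b t.
have mE : m = 1 - \int[P]_t q t.
  by rewrite /m RintegralB// /Rintegral a2.
have qI : 0 <= \int[P]_t q t <= del.
  apply/andP; split; first by apply: Rintegral_ge0 => t _; exact: q0.
  by rewrite -lee_fin EFin_Rintegral.
have m01 : 0 <= m <= L ^+ 2.
  apply/andP; split; first by apply: Rintegral_ge0 => t _; have /andP[] := bL t.
  rewrite -[leRHS](Rintegral_cst_prob P); apply: le_Rintegral => //.
    by apply: (@bounded_integrable _ _ _ _ _ `|L ^+ 2|).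
  by move=> t _; have /andP[] := bL t.
pose xi t := b t - m.
have mxi : measurable_fun setT xi by exact: measurable_funB.
have xiL t : `|xi t| <= L ^+ 2.
  have /andP[? ?] := bL t; have /andP[? ?] := m01.
  by rewrite ler_norml /xi; apply/andP; split; lra.
have xii : P.-integrable setT (EFin \o xi).
  exact: (@bounded_integrable _ _ _ _ _ (L ^+ 2)).
have xi0 : \int[P]_t xi t = 0.
  rewrite RintegralB//; last by apply: (@bounded_integrable _ _ _ _ _ `|m|).
  by rewrite -/m (_ : \int[P]_t m = m) ?subrr//; exact: (Rintegral_cst_prob P m).
pose W := \int[P]_t (xi t ^+ 2).
have xi2i : P.-integrable setT (EFin \o (fun t => xi t ^+ 2)).
  apply: (@bounded_integrable _ _ _ _ _ (L ^+ 4)); first exact: measurable_funX.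
  move=> t; rewrite normrX (_ : L ^+ 4 = (L ^+ 2) ^+ 2); last by rewrite -exprM.
  by rewrite lerXn2r ?nnegrE ?sqr_ge0.
have W0 : 0 <= W by apply: Rintegral_ge0 => t _; exact: sqr_ge0.
have WL : W <= L ^+ 4.
  rewrite -[leRHS](Rintegral_cst_prob P); apply: le_Rintegral => //.
    by apply: (@bounded_integrable _ _ _ _ _ `|L ^+ 4|).
  move=> t _; rewrite -(real_normK (num_real (xi t))) (_ : L ^+ 4 = (L ^+ 2) ^+ 2); last by rewrite -exprM.
  by rewrite lerXn2r ?nnegrE ?sqr_ge0.
have var : (\int[Pr]_om ((\sum_(i < n) 1 * xi (D i om)) ^+ 2)%:E <= (n%:R * W)%:E)%E.
  (* With [unit] as the visible part and weights 1, [sq_sum_le] is the variance bound for a sum of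
     independent centred variables. *)
  apply: (@sq_sum_le _ _ _ T unit Omega R Pr P D mD PD indD (fun=> tt) xi (fun=> W)
    _ _ _ _ _ _ n (fun _ _ => 1)) => //.
  - move=> k _; apply: posneg_of_integral0.
      apply: (@bounded_integrable _ _ _ _ _ (L ^+ 2 * `|k tt|)).
        exact: measurable_funM.
      by move=> t; rewrite normrM; exact: ler_wpM2r.
    by rewrite RintegralZr// xi0 mul0r.
  - move=> k _ _; rewrite -EFin_Rintegral; last first.
      apply: (@bounded_integrable _ _ _ _ _ (L ^+ 4 * `|k tt|)).
        by apply: measurable_funM => //; exact: measurable_funX.
      move=> t; rewrite normrM; apply: ler_wpM2r => //.
      rewrite normrX (_ : L ^+ 4 = (L ^+ 2) ^+ 2); last by rewrite -exprM.
      by rewrite lerXn2r ?nnegrE ?sqr_ge0.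
    by rewrite RintegralZr// integral_cst_prob.
  - move=> u; under eq_bigr do rewrite expr1n mul1r.
    by rewrite sumr_const card_ord mulr_natl.
have qsum : (\int[Pr]_om (\sum_(i < n) q (D i om))%:E <= (n%:R * del)%:E)%E.
  under eq_integral do rewrite -sumEFin.
  rewrite ge0_integral_sum//; last 2 first.
  - by move=> i; apply/measurable_EFinP; exact: (measurableT_comp mq).
  - by move=> i om _; rewrite lee_fin.
  apply: (@le_trans _ _ (\sum_(i < n) del%:E)%E).
    by apply: lee_sum => i _; rewrite integral_law.
  by rewrite sumEFin sumr_const card_ord mulr_natl.
pose A := [set om | (n%:R * r) ^+ 2 < (\sum_(i < n) 1 * xi (D i om)) ^+ 2].
pose B := [set om | n%:R * r < \sum_(i < n) q (D i om)].
have mxs : measurable_fun setT (fun om => (\sum_(i < n) 1 * xi (D i om)) ^+ 2).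
  apply: measurable_funX; apply: (@measurable_sumD (fun t => 1 * xi t)).
  exact: measurable_funM.
have mqs : measurable_fun setT (fun om => \sum_(i < n) q (D i om)).
  exact: measurable_sumD.
have nr0 : 0 < n%:R * r by rewrite mulr_gt0.
have pA : (Pr A <= (L ^+ 4 / (n%:R * r ^+ 2))%:E)%E.
  apply: (le_trans (markov_gt mxs _ var _)).
  - by move=> om; exact: sqr_ge0.
  - by rewrite exprn_gt0.
  rewrite lee_fin ler_pdivrMr ?exprn_gt0//.
  rewrite (_ : _ * (n%:R * r) ^+ 2 = n%:R * L ^+ 4); first by apply: ler_wpM2l.
  by field; rewrite !gt_eqF.
have pB : (Pr B <= (del / r)%:E)%E.
  apply: (le_trans (markov_gt mqs _ qsum _)) => //.
    by move=> om; apply: sumr_ge0 => i _.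
  by rewrite lee_fin -mulf_div divff ?gt_eqF// mul1r.
have mlt (f : Omega -> R) (l : R) : measurable_fun setT f -> measurable [set om | l < f om].
  move=> mf; have -> : [set om | l < f om] = f @^-1` `]l, +oo[%classic.
    by apply/seteqP; split => t /=; rewrite in_itv/= andbT.
  by rewrite -[X in measurable X]setTI; exact: mf.
rewrite EFinD; apply: le_trans (leeD pA pB).
apply: le_trans (measureU2 _ _ _); [|exact: mlt|exact: mlt].
apply: le_measure; rewrite ?inE.
- apply: mlt; apply: measurableT_comp => //; apply: measurable_funB => //.
  apply: measurable_funM => //; apply: (@measurable_sumD (fun t => a t ^+ 2)).
  exact: measurable_funX.
- by apply: measurableU; exact: mlt.
move=> om /= big; rewrite /A /B /=.
have [Bom|nB] := ltP (n%:R * r) (\sum_(i < n) q (D i om)); [by right|left].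
have e : \sum_(i < n) a (D i om) ^+ 2 =
    \sum_(i < n) 1 * xi (D i om) + \sum_(i < n) q (D i om) + n%:R * m.
  rewrite [n%:R * m](_ : _ = \sum_(i < n) m); last first.
    by rewrite sumr_const card_ord mulr_natl.
  rewrite -!big_split/=; apply: eq_bigr => i _; rewrite /xi /b; ring.
rewrite e in big.
set X := \sum_(i < n) 1 * _ in big *; set Y := \sum_(i < n) q _ in big nB *.
have Y0 : 0 <= Y by apply: sumr_ge0 => i _.
rewrite -[X in _ < X]real_normK ?num_real//.
rewrite ltr_pXn2r ?nnegrE ?normr_ge0 ?(ltW nr0)//.
have eXY : (X + Y + n%:R * m) / n%:R - 1 = X / n%:R + Y / n%:R - (1 - m).
  by field; rewrite gt_eqF.
rewrite eXY in big.
have Yr : 0 <= Y / n%:R <= r.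
  by rewrite divr_ge0//= ler_pdivrMr// mulrC.
have m1 : 0 <= 1 - m <= r by rewrite mE; case/andP: qI => ? ?; apply/andP; split; lra.
rewrite mulrC -ltr_pdivlMr// -[X in _ < _ / X]gtr0_norm// -normf_div.
case/andP: Yr => ? ?; case/andP: m1 => ? ?.
have := ler_normB (X / n%:R + Y / n%:R) (1 - m).
have := ler_normD (X / n%:R) (Y / n%:R).
rewrite (ger0_norm (_ : 0 <= Y / n%:R))// (ger0_norm (_ : 0 <= 1 - m))//.
lra.
Qed.

End clt.

(** * Remainder terms and studentization *)

Lemma measurable_gt_set d (T : measurableType d) (R : realType) (f : T -> R) (l : R) :
  measurable_fun setT f -> measurable [set t | l < f t].
Proof.
move=> mf; have -> : [set t | l < f t] = f @^-1` `]l, +oo[%classic.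
  by apply/seteqP; split => t /=; rewrite in_itv/= andbT.
by rewrite -[X in measurable X]setTI; exact: mf.
Qed.

Lemma measurable_le_set d (T : measurableType d) (R : realType) (f : T -> R) (l : R) :
  measurable_fun setT f -> measurable [set t | f t <= l].
Proof.
move=> mf; have -> : [set t | f t <= l] = f @^-1` `]-oo, l]%classic.
  by apply/seteqP; split => t /=; rewrite in_itv/=.
by rewrite -[X in measurable X]setTI; exact: mf.
Qed.

Lemma measure_cover2 d (T : measurableType d) (R : realType)
    (m : {measure set T -> \bar R}) (A B C : set T) :
  measurable A -> measurable B -> measurable C -> A `<=` B `|` C ->
  (m A <= m B + m C)%E.
Proof.
move=> mA mB mC ABC; apply: le_trans (measureU2 _ mB mC).
by apply: le_measure; rewrite ?inE//; exact: measurableU.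
Qed.

(** * Noise weighted by regression errors *)

Section noise_control.
Context d d' dO (T : measurableType d) (T' : measurableType d')
  (Omega : measurableType dO) (R : realType).
Variables (Pr : probability Omega R) (P : probability T R) (D : nat -> Omega -> T).
Hypothesis mD : forall i, measurable_fun setT (D i).
Hypothesis PD : forall i (A : set T), measurable A -> Pr (D i @^-1` A) = P A.
Hypothesis indD : forall (I : seq nat) (A : nat -> set T), uniq I ->
     (forall i, measurable (A i)) ->
     Pr (\big[setI/setT]_(i <- I) (D i @^-1` A i)) =
     (\prod_(i <- I) Pr (D i @^-1` A i))%E.
Variables (pi : T -> T') (xi : T -> R) (V : T' -> R).
Hypotheses (mpi : measurable_fun setT pi) (mxi : measurable_fun setT xi)
  (mV : measurable_fun setT V) (V0 : forall u, 0 <= V u).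
Hypothesis xi_sign : forall k : T' -> R, measurable_fun setT k ->
  (\int[P]_t (Num.max 0 (xi t * k (pi t)))%:E =
   \int[P]_t (Num.max 0 (- (xi t * k (pi t))))%:E)%E.
Hypothesis xi_square : forall k : T' -> R, measurable_fun setT k ->
  (forall u, 0 <= k u) ->
  (\int[P]_t (xi t ^+ 2 * k (pi t))%:E = \int[P]_t (V (pi t) * k (pi t))%:E)%E.
Variables (n : nat) (del : 'I_n -> n.-tuple T' -> R).
Hypothesis n0 : (0 < n)%N.
Hypothesis mdel : forall i, measurable_fun setT (del i).

Let bs om := blind pi (sample D n om).
Let mbs : measurable_fun setT bs.
Proof. exact: (measurableT_comp (measurable_blind mpi (n:=n)) (measurable_sample mD (n:=n))). Qed.

Let Q u := \sum_(i < n) del i u ^+ 2 * V (tnth u i).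

Let mQ : measurable_fun setT Q.
Proof.
apply: measurable_sum => i; apply: measurable_funM; first exact: measurable_funX.
by apply: (measurableT_comp mV); exact: measurable_tnth.
Qed.

Let bsE om i : tnth (bs om) i = pi (D i om).
Proof. by rewrite !tnth_mktuple. Qed.

Let bad b := [set om | n%:R * b < \sum_(i < n) del i (bs om) ^+ 2 * V (pi (D i om))].

Lemma bad_measurable b : measurable (bad b).
Proof.
apply: measurable_gt_set; apply: measurable_sum => i; apply: measurable_funM.
  by apply: measurable_funX; exact: (measurableT_comp (mdel i) mbs).
by apply: (measurableT_comp mV); exact: (measurableT_comp mpi).
Qed.

(* The cutoff on [Q <= n b] depends on the blinded sample only, so it keeps the
   noise orthogonal, and it makes all second moments finite. *)
Let I b u : R := \1_[set u | Q u <= n%:R * b] u.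

Let mI b : measurable_fun setT (I b).
Proof. by apply: measurable_indic; exact: measurable_le_set. Qed.

Let Ibad b om : ~ bad b om -> I b (bs om) = 1.
Proof.
move=> /negP; rewrite -leNgt => h; rewrite /I indicE mem_set//=.
by apply: le_trans h; apply: ler_sum => i _; rewrite bsE.
Qed.

Let Isq b u : 0 <= b -> I b u ^+ 2 * Q u <= n%:R * b.
Proof.
move=> b0; rewrite /I indicE; case: (boolP (u \in _)) => [|_].
  by rewrite inE/= expr1n mul1r.
by rewrite expr0n/= mul0r mulr_ge0.
Qed.

(** After the cutoff the expected sum is at most [n b], and outside [bad b] the cutoff equals 1;
    Markov does the rest. *)
Lemma noise_sum_sq b h : 0 <= b -> 0 < h ->
  (Pr [set om | (n%:R * h < \sum_(i < n) (del i (bs om) * xi (D i om)) ^+ 2)%R]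
   <= (b / h)%:E + Pr (bad b))%E.
Proof.
move=> b0 h0; have n0' : 0 < n%:R :> R by rewrite ltr0n.
pose di i u := I b u * del i u.
have mdi i : measurable_fun setT (di i) by exact: measurable_funM.
have := @sum_sq_le _ _ _ T T' Omega R Pr P D mD PD indD pi xi V mpi mxi mV V0
  xi_square n di mdi (n%:R * b).
rewrite -/bs => /(_ _)H.
pose W om := \sum_(i < n) (di i (bs om) * xi (D i om)) ^+ 2.
have mW : measurable_fun setT W.
  apply: measurable_sum => i; apply: measurable_funX; apply: measurable_funM.
    exact: (measurableT_comp (mdi i) mbs).
  exact: (measurableT_comp mxi).
have hW : (Pr [set om | (n%:R * h < W om)%R] <= (b / h)%:E)%E.
  apply: (le_trans (markov_gt mW _ (H _) _)).
  - by move=> om; apply: sumr_ge0 => i _; exact: sqr_ge0.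
  - move=> u; apply: le_trans (Isq u b0); rewrite mulr_sumr.
    by apply: ler_sum => i _; rewrite exprMn mulrA.
  - by rewrite mulr_gt0.
  by rewrite lee_fin -mulf_div divff ?gt_eqF// mul1r.
apply: (@le_trans _ _ (Pr [set om | (n%:R * h < W om)%R] + Pr (bad b))%E); last first.
  by apply: leeD.
apply: measure_cover2.
- apply: measurable_gt_set; apply: measurable_sum => i; apply: measurable_funX.
  apply: measurable_funM; first exact: (measurableT_comp (mdel i) mbs).
  exact: (measurableT_comp mxi).
- exact: measurable_gt_set.
- exact: bad_measurable.
move=> om /= hom; have [bo|/Ibad Io] := pselect (bad b om); [by right|left => /=].
by rewrite /W; under eq_bigr do rewrite /di Io mul1r.
Qed.

(** By orthogonality the square of the weighted sum still has mean at most [C ^ 2 n b]; being of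
    order [n] and not [n ^ 2], it is negligible after division by the square root of [n]. *)
Lemma noise_sq_sum (w : T' -> R) (C b h : R) : measurable_fun setT w ->
  (forall u, `|w u| <= C) -> 0 <= b -> 0 < h ->
  (Pr [set om | (n%:R * h ^+ 2 <
     (\sum_(i < n) del i (bs om) * w (pi (D i om)) * xi (D i om)) ^+ 2)%R]
   <= (C ^+ 2 * b / h ^+ 2)%:E + Pr (bad b))%E.
Proof.
move=> mw wC b0 h0; have n0' : 0 < n%:R :> R by rewrite ltr0n.
pose di i u := I b u * (del i u * w (tnth u i)).
have mdi i : measurable_fun setT (di i).
  apply: measurable_funM => //; apply: measurable_funM => //.
  by apply: (measurableT_comp mw); exact: measurable_tnth.
have := @sq_sum_le _ _ _ T T' Omega R Pr P D mD PD indD pi xi V mpi mxi mV V0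
  xi_sign xi_square n di mdi (C ^+ 2 * (n%:R * b)).
rewrite -/bs => /(_ _)H.
pose W om := (\sum_(i < n) di i (bs om) * xi (D i om)) ^+ 2.
have mW : measurable_fun setT W.
  apply: measurable_funX; apply: measurable_sum => i; apply: measurable_funM.
    exact: (measurableT_comp (mdi i) mbs).
  exact: (measurableT_comp mxi).
have hW : (Pr [set om | (n%:R * h ^+ 2 < W om)%R] <= (C ^+ 2 * b / h ^+ 2)%:E)%E.
  apply: (le_trans (markov_gt mW _ (H _) _)).
  - by move=> om; exact: sqr_ge0.
  - move=> u; apply: (@le_trans _ _ (C ^+ 2 * (I b u ^+ 2 * Q u))); last first.
      by apply: ler_wpM2l; [exact: sqr_ge0|exact: Isq].
    rewrite mulrA /Q mulr_sumr; apply: ler_sum => i _; rewrite !exprMn.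
    have : w (tnth u i) ^+ 2 <= C ^+ 2.
      rewrite -(real_normK (num_real (w _))) lerXn2r ?nnegrE//.
      by apply: le_trans (wC (tnth u i)).
    have : 0 <= I b u ^+ 2 * del i u ^+ 2 * V (tnth u i).
      by apply: mulr_ge0 => //; rewrite -exprMn sqr_ge0.
    set X := I b u ^+ 2; set Y := del i u ^+ 2; set v := V _; set z := w _ ^+ 2.
    move=> h1 h2; rewrite (_ : X * (Y * z) * v = z * (X * Y * v)); last by ring.
    rewrite (_ : C ^+ 2 * X * (Y * v) = C ^+ 2 * (X * Y * v)); last by ring.
    exact: ler_wpM2r.
  - by rewrite mulr_gt0// exprn_gt0.
  rewrite lee_fin ler_pdivrMr; last by rewrite mulr_gt0// exprn_gt0.
  rewrite le_eqVlt; apply/orP; left; apply/eqP; field.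
  by rewrite gt_eqF.
apply: (@le_trans _ _ (Pr [set om | (n%:R * h ^+ 2 < W om)%R] + Pr (bad b))%E); last first.
  by apply: leeD.
apply: measure_cover2.
- apply: measurable_gt_set; apply: measurable_funX; apply: measurable_sum => i.
  apply: measurable_funM; last exact: (measurableT_comp mxi).
  apply: measurable_funM; first exact: (measurableT_comp (mdel i) mbs).
  by apply: (measurableT_comp mw); exact: (measurableT_comp mpi).
- exact: measurable_gt_set.
- exact: bad_measurable.
move=> om /= hom; have [bo|/Ibad Io] := pselect (bad b om); [by right|left => /=].
by rewrite /W; under eq_bigr do rewrite /di Io mul1r bsE.
Qed.

End noise_control.

Section mean_square.
Context d dO (T : measurableType d) (Omega : measurableType dO) (R : realType).
Variables (Pr : probability Omega R) (P : probability T R) (D : nat -> Omega -> T).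
Hypothesis mD : forall i, measurable_fun setT (D i).
Hypothesis PD : forall i (A : set T), measurable A -> Pr (D i @^-1` A) = P A.
Hypothesis indD : forall (I : seq nat) (A : nat -> set T), uniq I ->
     (forall i, measurable (A i)) ->
     Pr (\big[setI/setT]_(i <- I) (D i @^-1` A i)) =
     (\prod_(i <- I) Pr (D i @^-1` A i))%E.
Variable a : T -> R.
Hypotheses (ma : measurable_fun setT a) (ai : P.-integrable setT (EFin \o a)).
Hypothesis a0 : \int[P]_t a t = 0.
Hypothesis a2 : (\int[P]_t (a t ^+ 2)%:E = 1)%E.

(** Chebyshev's inequality, with the variance again obtained from [sq_sum_le] and nothing visible.
    It makes the squared empirical mean negligible in the studentizing variance. *)
Lemma mean_sq_bound n (r : R) : (0 < n)%N -> 0 < r ->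
  (Pr [set om | (n%:R ^+ 2 * r < (\sum_(i < n) a (D i om)) ^+ 2)%R] <=
   (n%:R * r)^-1%:E)%E.
Proof.
move=> n0 r0; have n0' : 0 < n%:R :> R by rewrite ltr0n.
have a2i : P.-integrable setT (EFin \o (fun t => a t ^+ 2)).
  apply/integrableP; split; first by apply/measurable_EFinP; exact: measurable_funX.
  under eq_integral do rewrite /= ger0_norm ?sqr_ge0//.
  by rewrite a2 ltry.
have var : (\int[Pr]_om ((\sum_(i < n) 1 * a (D i om)) ^+ 2)%:E <= (n%:R)%:E)%E.
  apply: (@sq_sum_le _ _ _ T unit Omega R Pr P D mD PD indD (fun=> tt) a (fun=> 1)
    _ _ _ _ _ _ n (fun _ _ => 1)) => //.
  - move=> k _; apply: posneg_of_integral0.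
      rewrite (_ : _ \o _ = (fun t => (k tt)%:E * (EFin \o a) t)%E); last first.
        by apply/funext => t /=; rewrite mulrC EFinM.
      exact: integrableZl.
    by rewrite RintegralZr// a0 mul0r.
  - move=> k _ k0; under eq_integral do rewrite mulrC EFinM.
    rewrite ge0_integralZl//.
    + by rewrite a2 mule1 mul1r integral_cst_prob.
    + by apply/measurable_EFinP; exact: measurable_funX.
    + by move=> t _; rewrite lee_fin sqr_ge0.
    + by rewrite lee_fin.
  - move=> u; under eq_bigr do rewrite expr1n mul1r.
    by rewrite sumr_const card_ord.
under [X in Pr X]eq_set do under eq_bigr do rewrite -[a _]mul1r.
apply: (le_trans (markov_gt _ _ var _)).
- apply: measurable_funX; apply: measurable_sum => i; apply: measurable_funM => //.
  exact: (measurableT_comp ma).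
- by move=> om; exact: sqr_ge0.
- by rewrite mulr_gt0// exprn_gt0.
rewrite lee_fin le_eqVlt; apply/orP; left; apply/eqP; field.
by rewrite !gt_eqF.
Qed.

End mean_square.

Lemma sum_sqM_le (R : realFieldType) n (x y : 'I_n -> R) :
  \sum_(i < n) (x i * y i) ^+ 2 <= (\sum_(i < n) x i ^+ 2) * \sum_(i < n) y i ^+ 2.
Proof.
rewrite mulr_suml; apply: ler_sum => i _; rewrite exprMn.
apply: ler_wpM2l; first exact: sqr_ge0.
by rewrite (bigD1 i)//= lerDl sumr_ge0// => j _; exact: sqr_ge0.
Qed.

(** Lagrange's identity: twice the gap is the double sum of [(x i * y j - x j * y i) ^ 2]. *)
Lemma cauchy_schwarz (R : realFieldType) n (x y : 'I_n -> R) :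
  (\sum_(i < n) x i * y i) ^+ 2 <= (\sum_(i < n) x i ^+ 2) * \sum_(i < n) y i ^+ 2.
Proof.
have key : 0 <= \sum_(i < n) \sum_(j < n) (x i * y j - x j * y i) ^+ 2.
  by apply: sumr_ge0 => i _; apply: sumr_ge0 => j _; exact: sqr_ge0.
have e : \sum_(i < n) \sum_(j < n) (x i * y j - x j * y i) ^+ 2 =
    2 * ((\sum_(i < n) x i ^+ 2) * \sum_(i < n) y i ^+ 2) -
    2 * (\sum_(i < n) x i * y i) ^+ 2.
  rewrite [X in 2 * X - _]mulr_suml expr2 [X in _ - 2 * X]mulr_suml.
  rewrite !mulr_sumr -sumrB.
  transitivity (\sum_(i < n) \sum_(j < n) (x i ^+ 2 * y j ^+ 2 + x j ^+ 2 * y i ^+ 2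
     - 2 * (x i * y i * (x j * y j)))).
    by apply: eq_bigr => i _; apply: eq_bigr => j _; ring.
  rewrite -[RHS]addr0.
  transitivity (\sum_(i < n) (x i ^+ 2 * \sum_(j < n) y j ^+ 2) +
    \sum_(i < n) ((\sum_(j < n) x j ^+ 2) * y i ^+ 2) -
    \sum_(i < n) (2 * (x i * y i * \sum_(j < n) (x j * y j)))).
    rewrite -big_split -sumrB/=; apply: eq_bigr => i _.
    rewrite mulr_sumr mulr_suml !mulr_sumr -big_split -sumrB/=.
    by apply: eq_bigr => j _; ring.
  rewrite addr0 sumrB; congr (_ - _).
  rewrite -mulr_sumr -mulr_suml -mulr_sumr -mulr_suml; ring.
by rewrite e in key; lra.
Qed.

(** * Deterministic inequalities for the studentized statistic *)

Section studentization.
Context {R : realType}.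

(** The scale [sg] cancels, and [st <= t] reads [N + dd <= v t] with [|dd| <= eta] and [v], the
    empirical deviation, within [9 eta] of 1. The sign of [t] decides which of [1 - 9 eta] and
    [1 + 9 eta] bounds [v t] from above. The limit [1 / 18] keeps the variance at least [1 / 2]. *)
Lemma studentize n (a dl : 'I_n -> R) (sg eta t : R) : (0 < n)%N -> 0 < sg ->
  0 < eta <= 18^-1 ->
  `|(\sum_(i < n) a i ^+ 2) / n%:R - 1| <= eta ->
  (\sum_(i < n) a i) ^+ 2 <= n%:R ^+ 2 * eta ->
  \sum_(i < n) dl i ^+ 2 <= n%:R * eta ^+ 2 ->
  (\sum_(i < n) dl i) ^+ 2 <= n%:R * eta ^+ 2 ->
  let r i := sg * (a i + dl i) in
  let S1 := \sum_(i < n) r i in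
  let S2 := \sum_(i < n) r i ^+ 2 in
  let N := (\sum_(i < n) a i) / Num.sqrt n%:R in
  let st := (S1 / Num.sqrt n%:R) / Num.sqrt (S2 / n%:R - (S1 / n%:R) ^+ 2) in
  (st <= t -> N <= (if 0 <= t then 1 + 9 * eta else 1 - 9 * eta) * t + eta) /\
  (N <= (if 0 <= t then 1 - 9 * eta else 1 + 9 * eta) * t - eta -> st <= t).
Proof.
move=> n0 sg0 /andP[e0 e18] ha2 ha hd2 hd r S1 S2 N st.
have n0' : 0 < n%:R :> R by rewrite ltr0n.
have q0 : 0 < Num.sqrt n%:R :> R by rewrite sqrtr_gt0.
have q2 : Num.sqrt n%:R ^+ 2 = n%:R :> R by rewrite sqr_sqrtr// ltW.
pose A2 := (\sum_(i < n) a i ^+ 2) / n%:R.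
pose D2 := (\sum_(i < n) dl i ^+ 2) / n%:R.
pose X := (\sum_(i < n) a i * dl i) / n%:R.
pose A1 := (\sum_(i < n) a i) / n%:R.
pose D1 := (\sum_(i < n) dl i) / n%:R.
pose V := A2 + 2 * X + D2 - (A1 + D1) ^+ 2.
pose dd := (\sum_(i < n) dl i) / Num.sqrt n%:R.
have S1E : S1 = sg * (\sum_(i < n) a i + \sum_(i < n) dl i).
  by rewrite /S1 /r -mulr_sumr big_split.
have S2E : S2 / n%:R - (S1 / n%:R) ^+ 2 = sg ^+ 2 * V.
  rewrite S1E (_ : S2 = sg ^+ 2 * (\sum_(i < n) a i ^+ 2 +
      2 * \sum_(i < n) a i * dl i + \sum_(i < n) dl i ^+ 2)).
    by rewrite /V /A2 /X /D2 /A1 /D1; field; rewrite gt_eqF.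
  rewrite mulr_sumr -!big_split/= mulr_sumr; apply: eq_bigr => i _.
  by rewrite /r; ring.
have stE : st = (N + dd) / Num.sqrt V.
  rewrite /st S2E sqrtrM ?sqr_ge0// sqrtr_sqr gtr0_norm// S1E /N /dd -mulrDl.
  set Y := _ + _; set iq := (Num.sqrt n%:R)^-1.
  rewrite invfM; set iv := (Num.sqrt V)^-1.
  rewrite (_ : sg * Y * iq * (sg^-1 * iv) = (sg * sg^-1) * (Y * iq * iv)); last by ring.
  by rewrite divff ?gt_eqF// mul1r.
have D2b : 0 <= D2 <= eta ^+ 2.
  rewrite divr_ge0 ?sumr_ge0//=; last by move=> i _; exact: sqr_ge0.
  by rewrite ler_pdivrMr// mulrC.
have A20 : 0 <= A2 by rewrite divr_ge0 ?sumr_ge0// => i _; exact: sqr_ge0.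
have A2b : `|A2 - 1| <= eta by [].
have A1b : A1 ^+ 2 <= eta.
  rewrite /A1 exprMn exprVn ler_pdivrMr ?exprn_gt0//.
  by rewrite mulrC.
have n1 : 1 <= n%:R :> R by rewrite ler1n.
have D1b : D1 ^+ 2 <= eta ^+ 2.
  rewrite /D1 exprMn exprVn ler_pdivrMr ?exprn_gt0//.
  apply: (le_trans hd); rewrite mulrC; apply: ler_wpM2l; first exact: sqr_ge0.
  by rewrite expr2 ler_peMr// ltW.
have ddb : `|dd| <= eta.
  rewrite -ler_sqr ?nnegrE ?(ltW e0)// real_normK ?num_real//.
  by rewrite /dd exprMn exprVn q2 ler_pdivrMr// mulrC.
(* Cauchy-Schwarz, then arithmetic and geometric means with weight [eta], since [D2] is of order
   [eta ^ 2] while [A2] is of order 1. *)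
have Xb : `|X| <= (eta * A2 + D2 / eta) / 2.
  have X2 : X ^+ 2 <= A2 * D2.
    rewrite /X /A2 /D2 exprMn exprVn mulf_div -expr2.
    apply: ler_wpM2r; first by rewrite invr_ge0 sqr_ge0.
    exact: cauchy_schwarz.
  have D20 : 0 <= D2 by case/andP: D2b.
  rewrite -ler_sqr ?nnegrE//; last first.
    apply: divr_ge0 => //; apply: addr_ge0.
      by apply: mulr_ge0 => //; exact: ltW.
    by apply: divr_ge0 => //; exact: ltW.
  rewrite real_normK ?num_real//; apply: (le_trans X2).
  have -> : A2 * D2 = (eta * A2) * (D2 / eta) by field; rewrite gt_eqF.
  set u := eta * A2; set v := D2 / eta.
  by have := sqr_ge0 (u - v); nra.
have D2e : D2 / eta <= eta by rewrite ler_pdivrMr// -expr2; case/andP: D2b.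
(* The contributions of [A2], [2 X], [D2] and the squared mean are at most [eta], [2 eta + eta ^ 2],
   [eta ^ 2] and [2 eta + 2 eta ^ 2], in total [5 eta + 4 eta ^ 2]. *)
have Vb : `|V - 1| <= 9 * eta.
  have := sqr_ge0 (A1 + D1); have := sqr_ge0 (A1 - D1).
  move: A2b Xb D2b; rewrite !ler_norml => /andP[? ?] /andP[? ?] /andP[? ?].
  by rewrite /V => ? ?; apply/andP; split; nra.
have Vhalf : 2^-1 <= V.
  by move: Vb; rewrite ler_norml => /andP[]; lra.
have V0 : 0 < V by lra.
pose v := Num.sqrt V.
have v0 : 0 < v by rewrite sqrtr_gt0.
have v2 : v ^+ 2 = V by rewrite sqr_sqrtr// ltW.
have vb : `|v - 1| <= 9 * eta.
  apply: le_trans Vb; rewrite -v2.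
  have -> : v ^+ 2 - 1 = (v - 1) * (v + 1) by ring.
  rewrite normrM ler_peMr// ger0_norm; lra.
move: vb ddb; rewrite !ler_norml => /andP[v1 v1'] /andP[d1 d1'].
rewrite stE -/v; split.
  rewrite ler_pdivrMr// => h; case: ifPn => t0; first nra.
  by rewrite -ltNge in t0; nra.
move=> h; rewrite ler_pdivrMr//; move: h; case: ifPn => t0 h.
  have : (1 - 9 * eta) * t <= v * t by apply: ler_wpM2r => //; lra.
  lra.
rewrite -ltNge in t0.
have : (1 + 9 * eta) * t <= v * t by apply: ler_wnM2r; [exact: ltW|lra].
lra.
Qed.

(** Splitting a square of three terms costs a factor 3. The sum of squares then needs [9 C ^ 2 h];
    the square of the sum needs [3 C ^ 2 h] for the product term and [6 h ^ 2 <= 6 h] for the two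
    cross terms. The constant [9 C ^ 2 + 6] covers both, and [c <= sg ^ 2] pays for the division. *)
Lemma remainder_bounds n (df dg eps xi w : 'I_n -> R) (C c h eta sg : R) :
  0 < c -> 0 < C -> 0 < h <= 1 -> h * (9 * C ^+ 2 + 6) <= eta ^+ 2 * c ->
  0 < sg -> c <= sg ^+ 2 ->
  (forall i, `|w i| <= C) ->
  (\sum_(i < n) df i ^+ 2) * (\sum_(i < n) dg i ^+ 2) <= n%:R * h ->
  \sum_(i < n) (df i * xi i) ^+ 2 <= n%:R * h ->
  \sum_(i < n) (dg i * eps i) ^+ 2 <= n%:R * h ->
  (\sum_(i < n) df i * w i * xi i) ^+ 2 <= n%:R * h ^+ 2 ->
  (\sum_(i < n) dg i * w i * eps i) ^+ 2 <= n%:R * h ^+ 2 ->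
  let dl i := (df i * xi i + dg i * eps i + df i * dg i) * w i / sg in
  \sum_(i < n) dl i ^+ 2 <= n%:R * eta ^+ 2 /\
  (\sum_(i < n) dl i) ^+ 2 <= n%:R * eta ^+ 2.
Proof.
move=> c0 C0 /andP[h0 h1] hh sg0 csg wC hA hf hg hfw hgw dl.
have sg20 : 0 < sg ^+ 2 by rewrite exprn_gt0.
have wC2 i : w i ^+ 2 <= C ^+ 2.
  rewrite -(real_normK (num_real (w i))) lerXn2r ?nnegrE//; exact: ltW.
have C20 : 0 < C ^+ 2 by rewrite exprn_gt0.
have nn : 0 <= n%:R :> R by [].
have fin (x K : R) : x <= n%:R * (h * K) / sg ^+ 2 -> 0 <= K -> K <= 9 * C ^+ 2 + 6 ->
    x <= n%:R * eta ^+ 2.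
  move=> hx K0 hK; apply: (le_trans hx); rewrite -mulrA; apply: ler_wpM2l => //.
  rewrite ler_pdivrMr//.
  apply: (@le_trans _ _ (eta ^+ 2 * c)); last by apply: ler_wpM2l; [exact: sqr_ge0|].
  by apply: le_trans hh; apply: ler_wpM2l => //; exact: ltW.
have hfg : \sum_(i < n) (df i * dg i) ^+ 2 <= n%:R * h.
  by apply: le_trans hA; exact: sum_sqM_le.
have hfgw : (\sum_(i < n) df i * (dg i * w i)) ^+ 2 <= C ^+ 2 * (n%:R * h).
  apply: (le_trans (cauchy_schwarz _ _)).
  apply: (@le_trans _ _ (C ^+ 2 * ((\sum_(i < n) df i ^+ 2) * \sum_(i < n) dg i ^+ 2))).
    rewrite mulrCA; apply: ler_wpM2l; first by apply: sumr_ge0 => i _; exact: sqr_ge0.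
    rewrite mulr_sumr; apply: ler_sum => i _; rewrite exprMn mulrC.
    by apply: ler_wpM2r => //; exact: sqr_ge0.
  by apply: ler_wpM2l => //; exact: ltW.
split.
  apply: (fin _ (9 * C ^+ 2)); [|by rewrite mulr_ge0// ltW|by rewrite lerDl].
  apply: (@le_trans _ _ (\sum_(i < n) (3 * C ^+ 2 / sg ^+ 2) *
     ((df i * xi i) ^+ 2 + (dg i * eps i) ^+ 2 + (df i * dg i) ^+ 2))).
    apply: ler_sum => i _; rewrite /dl.
    set p := df i * xi i; set q := dg i * eps i; set s := df i * dg i.
    rewrite (_ : ((p + q + s) * w i / sg) ^+ 2 =
      (p + q + s) ^+ 2 * w i ^+ 2 * (sg ^+ 2)^-1); last by rewrite !exprMn exprVn.
    rewrite (_ : 3 * C ^+ 2 / sg ^+ 2 * (p ^+ 2 + q ^+ 2 + s ^+ 2) =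
      3 * (p ^+ 2 + q ^+ 2 + s ^+ 2) * C ^+ 2 * (sg ^+ 2)^-1); last by ring.
    apply: ler_wpM2r; first by rewrite invr_ge0 ltW.
    apply: (@le_trans _ _ ((p + q + s) ^+ 2 * C ^+ 2)).
      by apply: ler_wpM2l; [exact: sqr_ge0|exact: wC2].
    apply: ler_wpM2r; first exact: ltW.
    have := sqr_ge0 (p - q); have := sqr_ge0 (p - s); have := sqr_ge0 (q - s).
    nra.
  rewrite -mulr_sumr !big_split/=; set k := (sg ^+ 2)^-1.
  have k0 : 0 <= k by rewrite invr_ge0 ltW.
  have hF := lerD (lerD hf hg) hfg.
  rewrite (_ : n%:R * (h * (9 * C ^+ 2)) * k =
    3 * C ^+ 2 * k * (n%:R * h + n%:R * h + n%:R * h)); last by ring.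
  apply: ler_wpM2l => //; apply: mulr_ge0 => //; apply: mulr_ge0 => //.
  exact: ltW.
apply: (fin _ (3 * C ^+ 2 + 6)).
- rewrite /dl -mulr_suml exprMn exprVn; apply: ler_wpM2r; first by rewrite invr_ge0 ltW.
  rewrite (_ : \sum_(i < n) _ = \sum_(i < n) df i * w i * xi i +
     \sum_(i < n) dg i * w i * eps i + \sum_(i < n) df i * (dg i * w i)); last first.
    by rewrite -!big_split/=; apply: eq_bigr => i _; ring.
  move: hfw hgw hfgw; set p := \sum_(i < n) _; set q := \sum_(i < n) _.
  set s := \sum_(i < n) _ => hp hq hs.
  have h2 : n%:R * h ^+ 2 <= n%:R * h.
    by apply: ler_wpM2l => //; rewrite expr2 ger_pMr.
  have := sqr_ge0 (p - q); have := sqr_ge0 (p - s); have := sqr_ge0 (q - s).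
  rewrite (_ : n%:R * (h * (3 * C ^+ 2 + 6)) = 3 * (C ^+ 2 * (n%:R * h)) + 6 * (n%:R * h)); last by ring.
  nra.
- by rewrite addr_ge0// mulr_ge0// ltW.
- by rewrite lerD2r; apply: ler_wpM2r; [exact: ltW|lra].
Qed.

End studentization.

(** * Uniform limit theorems *)

(** [iid] over an arbitrary observation space; for [Obs] the two are convertible. *)
Definition iid_sample d dO (T : measurableType d) (Omega : measurableType dO)
    (R : realType) (Pr : probability Omega R) (D : nat -> Omega -> T)
    (P : probability T R) : Prop :=
  (forall i, measurable_fun setT (D i)) /\
  (forall i (A : set T), measurable A -> Pr (D i @^-1` A) = P A) /\
  (forall (I : seq nat) (A : nat -> set T), uniq I ->
     (forall i, measurable (A i)) ->
     Pr (\big[setI/setT]_(i <- I) (D i @^-1` A i)) =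
     (\prod_(i <- I) Pr (D i @^-1` A i))%E).

(* [Lf] is a modulus of uniform integrability for the square of [a]. *)
Definition standardized d (T : measurableType d) (R : realType)
    (P : probability T R) (Lf : R -> R) (a : T -> R) : Prop :=
  [/\ measurable_fun setT a, P.-integrable setT (EFin \o a),
    \int[P]_t a t = 0, (\int[P]_t (a t ^+ 2)%:E = 1)%E &
    forall del, 0 < del ->
      (\int[P]_t (a t ^+ 2 * (Lf del < `|a t|)%R%:R)%:E <= del%:E)%E].

Lemma large_nat (R : realType) (K : R) :
  exists N : nat, forall n, (N <= n)%N -> (0 < n)%N /\ K <= n%:R.
Proof.
exists (Num.truncn K).+1 => n Nn; split; first exact: leq_ltn_trans Nn.
by apply: (le_trans (ltW (truncnS_gt K))); rewrite ler_nat.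
Qed.

(** The parameters are fixed in the order [s], [tau], [n]: [s] makes unsmoothing cheap, [tau] serves
    both as the bound on small increments and as the tail mass, and [n] comes last. None depends on
    the law, only on [Lf] and [e]. *)
Lemma clt_uniform d dO (T : measurableType d) (Omega : measurableType dO)
    (R : realType) (Lf : R -> R) (e : R) :
  (forall del, 0 <= Lf del) -> 0 < e ->
  exists N : nat, forall n, (N <= n)%N ->
  forall (Pr : probability Omega R) (P : probability T R) D a,
  iid_sample Pr D P -> standardized P Lf a -> forall t,
  (`| Pr [set om | ((\sum_(i < n) a (D i om)) / Num.sqrt n%:R <= t)%R]
     - (gcdf t)%:E | <= e%:E)%E.
Proof.
move=> Lf0 e0; pose e' := e / 4.
have e'0 : 0 < e' by rewrite divr_gt0.
have gK0 := @gK_ge0 R.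
have [M [M0 [M1 M2]]] := gcdf_tail e'0.
pose s := Num.min 1 (e' / (gK * M + 2 * gK + 1)).
have den0 : 0 < gK * M + 2 * gK + 1.
  by apply: ltr_wpDl => //; apply: addr_ge0; apply: mulr_ge0 => //; exact: ltW.
have s0 : 0 < s by rewrite lt_min ltr01 divr_gt0.
have s1 : s <= 1 by rewrite ge_min lexx.
have se : s * (gK * M + 2 * gK + 1) <= e'.
  by rewrite -ler_pdivlMr// ge_min lexx orbT.
have s20 : 0 < s ^+ 2 by rewrite exprn_gt0.
pose tau := e' * s ^+ 2 / (4 * gK + 1).
have g40 : 0 < 4 * gK + 1 :> R by apply: ltr_wpDl => //; exact: mulr_ge0.
have tau0 : 0 < tau by rewrite divr_gt0// mulr_gt0.
have taue : tau * (4 * gK + 1) = e' * s ^+ 2 by rewrite divfK// gt_eqF.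
pose x := Num.min 3 (e' * s ^+ 2 / (2 * gK + 1)).
have g20 : 0 < 2 * gK + 1 :> R by apply: ltr_wpDl => //; exact: mulr_ge0.
have x0 : 0 < x.
  by rewrite lt_min; apply/andP; split => //; rewrite divr_gt0// mulr_gt0.
(* The first threshold gives [1 / (n s ^ 2) <= x], the second makes the truncation level [Lf tau] at
   most [tau] times the square root of [n s ^ 2]. *)
have [N HN] := large_nat (Num.max (s ^+ 2 * x)^-1 (Lf tau ^+ 2 / (tau ^+ 2 * s ^+ 2))).
exists N => n /HN [n0]; rewrite ge_max => /andP[n1 n2] Pr P D a [mD [PD indD]].
move=> [ma ai a0 a2 tl] t.
have n0' : 0 < n%:R :> R by rewrite ltr0n.
have ns0 : 0 < n%:R * s ^+ 2 by rewrite mulr_gt0.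
have kx : (n%:R * s ^+ 2)^-1 <= x.
  move: n1; rewrite -[leRHS]invrK lef_pV2 ?posrE ?mulr_gt0 ?invr_gt0//.
  move=> n1; rewrite invfM mulrC -ler_pdivlMl ?invr_gt0//.
  by rewrite invrK.
have k3 : (n%:R * s ^+ 2)^-1 <= 3 by apply: (le_trans kx); rewrite ge_min lexx.
have ke : (n%:R * s ^+ 2)^-1 * (2 * gK + 1) <= e' * s ^+ 2.
  by rewrite -ler_pdivlMr//; apply: (le_trans kx); rewrite ge_min lexx orbT.
have Lt : Lf tau <= tau * Num.sqrt (n%:R * s ^+ 2).
  have ts0 : 0 < tau ^+ 2 * s ^+ 2 by apply: mulr_gt0; exact: exprn_gt0.
  rewrite -ler_sqr; last 2 first.
  - by rewrite nnegrE.
  - by rewrite nnegrE; apply: mulr_ge0 => //; exact: ltW.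
  rewrite exprMn sqr_sqrtr ?(ltW ns0)//.
  by move: n2; rewrite ler_pdivrMr// mulrCA.
have := @clt_bound _ _ T Omega R Pr P D mD PD indD a ma ai a0 a2 (Lf tau) tau tau
  (tl _ tau0) n s e' M t n0 s0 s1 k3 Lt (ltW tau0) (ltW M0) M1 M2.
move=> /le_trans; apply; rewrite lee_fin.
set k := (n%:R * s ^+ 2)^-1 in ke *.
have h1 : (2 * gK * (tau + tau) + 2 * gK * k) / s ^+ 2 <= 2 * e'.
  rewrite ler_pdivrMr//.
  have : 0 < k by rewrite invr_gt0.
  nra.
have h2 : gK * (M * s) + 2 * gK * s ^+ 2 <= e'.
  have : s ^+ 2 <= s by rewrite expr2 ger_pMr.
  have : 0 <= gK * M by apply: mulr_ge0 => //; exact: ltW.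
  nra.
rewrite /e' in h1 h2 *; lra.
Qed.

Lemma wlln_uniform d dO (T : measurableType d) (Omega : measurableType dO)
    (R : realType) (Lf : R -> R) (r e : R) :
  (forall del, 0 <= Lf del) -> 0 < r -> 0 < e ->
  exists N : nat, forall n, (N <= n)%N ->
  forall (Pr : probability Omega R) (P : probability T R) D a,
  iid_sample Pr D P -> standardized P Lf a ->
  (Pr [set om | (r < `|(\sum_(i < n) a (D i om) ^+ 2) / n%:R - 1|)%R] <= e%:E)%E /\
  (Pr [set om | (n%:R ^+ 2 * r < (\sum_(i < n) a (D i om)) ^+ 2)%R] <= e%:E)%E.
Proof.
move=> Lf0 r0 e0; pose q := r / 3.
have q0 : 0 < q by rewrite divr_gt0.
(* The first bound keeps the truncation bias below [q], the second makes the Markov term [del / q]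
   at most [e / 2]. *)
pose del := Num.min q (q * (e / 2)).
have d0 : 0 < del by rewrite lt_min q0 mulr_gt0// divr_gt0.
have [N HN] := large_nat (Num.max (Lf del ^+ 4 / (q ^+ 2 * (e / 2))) (r * e)^-1).
exists N => n /HN [n0]; rewrite ge_max => /andP[n1 n2] Pr P D a [mD [PD indD]].
move=> [ma ai a0 a2 tl].
have n0' : 0 < n%:R :> R by rewrite ltr0n.
split.
  have := @wlln_bound _ _ T Omega R Pr P D mD PD indD a ma a2 (Lf del) del
    (tl _ d0) n q n0 q0 (Lf0 _).
  have dq : del <= q by rewrite ge_min lexx.
  have -> : 3 * q = r by rewrite /q mulrC divfK.
  move=> /(_ dq)/le_trans; apply; rewrite lee_fin.
  have h1 : Lf del ^+ 4 / (n%:R * q ^+ 2) <= e / 2.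
    rewrite ler_pdivrMr ?mulr_gt0 ?exprn_gt0//.
    move: n1; rewrite ler_pdivrMr ?mulr_gt0 ?exprn_gt0 ?divr_gt0//.
    by rewrite (_ : n%:R * (q ^+ 2 * (e / 2)) = e / 2 * (n%:R * q ^+ 2)); last by ring.
  have h2 : del / q <= e / 2.
    by rewrite ler_pdivrMr// mulrC ge_min lexx orbT.
  by rewrite (splitr e) lerD.
apply: (le_trans (@mean_sq_bound _ _ T Omega R Pr P D mD PD indD a ma ai a0 a2 n r n0 r0)).
rewrite lee_fin invfM mulrC -ler_pdivlMl ?invr_gt0// invrK.
move: n2; rewrite -[leRHS]invrK lef_pV2 ?posrE ?mulr_gt0 ?invr_gt0//.
Qed.

(** Where [|e| > L], one has [e ^ 2 <= |e| ^ (2 + eta) / L ^ eta], and the level solves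
    [L ^ eta = (|M| + 1) / del]. Using [|M| + 1] for [M] keeps it positive. *)
Lemma tail_of_moment d (T : measurableType d) (R : realType)
    (P : probability T R) (e : T -> R) (eta M del : R) :
  measurable_fun setT e -> 0 < eta -> 0 < del ->
  (\int[P]_t (`|e t| `^ (2 + eta))%:E <= M%:E)%E ->
  (\int[P]_t (e t ^+ 2 * ((((`|M| + 1) / del) `^ eta^-1) < `|e t|)%R%:R)%:E
     <= del%:E)%E.
Proof.
move=> me eta0 d0 hM.
set L := _ `^ _.
have M10 : 0 < `|M| + 1 by rewrite ltr_wpDl.
have L0 : 0 <= L by exact: powR_ge0.
have Le : L `^ eta = (`|M| + 1) / del.
  by rewrite -powRrM mulVf ?gt_eqF// powRr1// divr_ge0// ltW.
have mp : measurable_fun setT (fun t => `|e t| `^ (2 + eta)).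
  apply: (measurableT_comp (measurable_powR _)); exact: measurableT_comp.
have pt t : e t ^+ 2 * (L < `|e t|)%R%:R <= del / (`|M| + 1) * `|e t| `^ (2 + eta).
  have p0 : 0 <= del / (`|M| + 1) * `|e t| `^ (2 + eta).
    by apply: mulr_ge0; [rewrite divr_ge0// ltW|exact: powR_ge0].
  case: ltP => h; rewrite ?mulr1 ?mulr0//.
  have et0 : `|e t| != 0 by rewrite gt_eqF// (le_lt_trans L0).
  rewrite powRD; last by apply/implyP.
  rewrite (powR_mulrn 2)// real_normK ?num_real// mulrCA ler_peMr ?sqr_ge0//.
  rewrite -ler_pdivrMl ?divr_gt0// mulr1 invf_div -Le.
  by rewrite ge0_ler_powR ?nnegrE ?(ltW eta0)// ltW.
apply: (@le_trans _ _ (\int[P]_t ((del / (`|M| + 1))%:E * (`|e t| `^ (2 + eta))%:E))%E).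
  apply: ge0_le_integral => //.
  - by move=> t _; rewrite lee_fin mulr_ge0 ?sqr_ge0.
  - by apply/measurable_EFinP; exact: measurable_tail.
  - apply: emeasurable_funM => //; exact/measurable_EFinP.
  - by move=> t _; rewrite -EFinM lee_fin.
rewrite ge0_integralZl//; last 2 first.
- exact/measurable_EFinP.
- by rewrite lee_fin divr_ge0// ltW.
apply: (@le_trans _ _ ((del / (`|M| + 1))%:E * M%:E)%E).
  by apply: lee_wpmul2l => //; rewrite lee_fin divr_ge0// ltW.
rewrite -EFinM lee_fin mulrAC ler_pdivrMr//; apply: ler_wpM2l; first exact: ltW.
by have := ler_norm M; lra.
Qed.

(** * Standardizing the product of the two noises *)

Section model.
Context {R : realType} {dZ : nat}.
Notation Obs := (Obs R dZ).
Notation Z := (Zsp R dZ).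
Variable P : probability Obs R.

Lemma tail_scale (e a : Obs -> R) (q L del : R) : 0 < q -> 0 < del ->
  measurable_fun setT e -> measurable_fun setT a ->
  (forall t, `|a t| <= q * `|e t|) ->
  (\int[P]_t (e t ^+ 2 * (L < `|e t|)%R%:R)%:E <= (del / q ^+ 2)%:E)%E ->
  (\int[P]_t (a t ^+ 2 * ((q * L)%R < `|a t|)%R%:R)%:E <= del%:E)%E.
Proof.
move=> q0 d0 me ma ae te.
have q20 : 0 < q ^+ 2 by rewrite exprn_gt0.
apply: (@le_trans _ _ (\int[P]_t ((q ^+ 2)%:E * (e t ^+ 2 * (L < `|e t|)%R%:R)%:E))%E).
  apply: ge0_le_integral => //.
  - by move=> t _; rewrite lee_fin mulr_ge0 ?sqr_ge0.
  - by apply/measurable_EFinP; exact: measurable_tail.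
  - by apply: emeasurable_funM => //; apply/measurable_EFinP; exact: measurable_tail.
  move=> t _; rewrite -EFinM lee_fin.
  case: ltP => h1; last first.
    by rewrite mulr0 mulr_ge0 ?(ltW q20)// mulr_ge0 ?sqr_ge0.
  have h2 : L < `|e t|.
    by rewrite -(ltr_pM2l q0); exact: lt_le_trans (ae t).
  rewrite h2 !mulr1 -exprMn -(real_normK (num_real (a t))) -(real_normK (num_real (q * _))).
  by rewrite lerXn2r ?nnegrE// normrM (gtr0_norm q0).
rewrite ge0_integralZl//; last 3 first.
- by apply/measurable_EFinP; exact: measurable_tail.
- by move=> t _; rewrite lee_fin mulr_ge0 ?sqr_ge0.
- by rewrite lee_fin ltW.
apply: (@le_trans _ _ ((q ^+ 2)%:E * (del / q ^+ 2)%:E)%E).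
  by apply: lee_wpmul2l => //; rewrite lee_fin ltW.
by rewrite -EFinM lee_fin mulrC divfK// gt_eqF.
Qed.

Lemma tail_integrable (e : Obs -> R) (L K : R) : measurable_fun setT e ->
  (\int[P]_t (e t ^+ 2 * (L < `|e t|)%R%:R)%:E <= K%:E)%E ->
  P.-integrable setT (EFin \o (fun t => e t ^+ 2)).
Proof.
move=> me te.
have mt := measurable_tail me L.
have ti : P.-integrable setT (EFin \o (fun t => e t ^+ 2 * (L < `|e t|)%R%:R)).
  apply/integrableP; split; first exact/measurable_EFinP.
  rewrite (_ : (\int[P]_x _)%E = (\int[P]_t (e t ^+ 2 * (L < `|e t|)%R%:R)%:E)%E).
    by apply: (le_lt_trans te); rewrite ltry.
  by apply: eq_integral => t _; rewrite /= ger0_norm// mulr_ge0 ?sqr_ge0.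
have ci' : P.-integrable setT (EFin \o (fun=> L ^+ 2)).
  by apply: (@bounded_integrable _ _ _ _ _ `|L ^+ 2|).
apply: (le_integrable measurableT _ _ (integrableD measurableT ti ci')).
  by apply/measurable_EFinP; exact: measurable_funX.
move=> t _ /=; rewrite lee_fin [leLHS]ger0_norm ?sqr_ge0// [leRHS]ger0_norm; last first.
  by apply: addr_ge0; [apply: mulr_ge0 => //|]; exact: sqr_ge0.
case: ltP => h; first by rewrite mulr1 lerDl sqr_ge0.
rewrite mulr0 add0r -(real_normK (num_real (e t))).
by rewrite lerXn2r ?nnegrE//; exact: le_trans h.
Qed.

Variables (f g : Z -> R).
Hypotheses (mf : measurable_fun setT f) (mg : measurable_fun setT g).
Let eps (t : Obs) := t.1.1 - f t.2.
Let xi (t : Obs) := t.1.2 - g t.2.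

Lemma measurable_obsx : measurable_fun setT (fun t : Obs => t.1.1).
Proof. by apply: (measurableT_comp measurable_fst); exact: measurable_fst. Qed.

Lemma measurable_obsy : measurable_fun setT (fun t : Obs => t.1.2).
Proof. by apply: (measurableT_comp measurable_snd); exact: measurable_fst. Qed.

(** [sg ^ 2] is the second moment of [eps xi w], bounded below by [c] through [Wset]. Hence the
    standardized variable is at most [C / sqrt c] times [|eps xi|], and rescaling the modulus of
    [eps xi] by this factor gives one that is the same for all [w]. *)
Lemma standardize (w : Z -> R) (C c : R) (Lf : R -> R) : 0 < C -> 0 < c ->
  (forall k : R * Z -> R, measurable_fun setT k ->
    (\int[P]_t (Num.max 0 (xi t * k (t.1.1, t.2)))%:E =
     \int[P]_t (Num.max 0 (- (xi t * k (t.1.1, t.2))))%:E)%E) ->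
  (forall del, 0 < del ->
    (\int[P]_t ((eps t * xi t) ^+ 2 * (Lf del < `|eps t * xi t|)%R%:R)%:E <= del%:E)%E) ->
  Wset P f g C c w ->
  exists sg : R, [/\ 0 < sg, c <= sg ^+ 2 &
    standardized P (fun del => C / Num.sqrt c * Lf (del / (C / Num.sqrt c) ^+ 2))
      (fun t => eps t * xi t * w t.2 / sg)].
Proof.
move=> C0 c0 sgn tl [mw [wC cw]].
have meps : measurable_fun setT eps.
  by apply: measurable_funB; [exact: measurable_obsx|exact: measurable_compz].
have mxi : measurable_fun setT xi.
  by apply: measurable_funB; [exact: measurable_obsy|exact: measurable_compz].
pose e t := eps t * xi t.
have me : measurable_fun setT e by exact: measurable_funM.
pose a0 t := e t * w t.2.
have mwz := measurable_compz mw.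
have ma0 : measurable_fun setT a0 by exact: measurable_funM.
have e2i := tail_integrable me (tl 1 ltr01).
have a0e t : a0 t ^+ 2 <= C ^+ 2 * e t ^+ 2.
  rewrite /a0 exprMn mulrC; apply: ler_wpM2r; first exact: sqr_ge0.
  rewrite -(real_normK (num_real (w _))) lerXn2r ?nnegrE// ltW//.
have a02i : P.-integrable setT (EFin \o (fun t => a0 t ^+ 2)).
  have h : P.-integrable setT (fun t : Obs => (C ^+ 2)%:E * (e t ^+ 2)%:E)%E.
    exact: integrableZl.
  apply: (le_integrable measurableT _ _ h).
    by apply/measurable_EFinP; exact: measurable_funX.
  move=> t _ /=; rewrite lee_fin [leLHS]ger0_norm ?sqr_ge0// [leRHS]ger0_norm//.
  by apply: mulr_ge0; exact: sqr_ge0.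
have a0i : P.-integrable setT (EFin \o a0).
  have ci' : P.-integrable setT (EFin \o (fun=> 1 : R)).
    by apply: (@bounded_integrable _ _ _ _ _ `|1|).
  apply: (le_integrable measurableT _ _ (integrableD measurableT a02i ci')).
    exact/measurable_EFinP.
  move=> t _ /=; rewrite lee_fin [leRHS]ger0_norm ?addr_ge0 ?sqr_ge0//.
  have := mul_le_sqrD `|a0 t| 1; rewrite mulr1 expr1n.
  by rewrite real_normK ?num_real.
have a0I : \int[P]_t a0 t = 0.
  (* [eps w] is a function of X and Z, so the centring of [xi] against such functions makes the
     product centred. *)
  pose k (u : R * Z) := (u.1 - f u.2) * w u.2.
  have mk : measurable_fun setT k.
    apply: measurable_funM; last exact: (measurableT_comp mw measurable_snd).
    by apply: measurable_funB => //; exact: (measurableT_comp mf measurable_snd).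
  have := sgn k mk.
  have E t : xi t * k (t.1.1, t.2) = a0 t by rewrite /k /a0 /e /eps /=; ring.
  under eq_integral do rewrite E; under [in RHS]eq_integral do rewrite E.
  move=> h; rewrite /Rintegral integral_posneg h subee//.
  rewrite (_ : (\int[P]_x _)%E = (\int[P]_t ((EFin \o a0)^\- t))%E).
    exact: integrable_neg_fin_num.
  by apply: eq_integral => t _; rewrite funenegE EFin_max maxC.
pose s2 := \int[P]_t (a0 t ^+ 2).
have s2E : (s2%:E = \int[P]_t (a0 t ^+ 2)%:E)%E by exact: EFin_Rintegral.
have cs2 : c <= s2.
  rewrite -lee_fin s2E; apply: (le_trans cw); rewrite le_eqVlt; apply/orP; left.
  by apply/eqP; apply: eq_integral => t _; rewrite /a0 /e !exprMn.
have s20 : 0 < s2 by exact: lt_le_trans cs2.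
pose sg := Num.sqrt s2.
have sg0 : 0 < sg by rewrite sqrtr_gt0.
have sg2 : sg ^+ 2 = s2 by rewrite sqr_sqrtr// ltW.
pose q := C / Num.sqrt c.
have q0 : 0 < q by rewrite divr_gt0// sqrtr_gt0.
exists sg; split; rewrite ?sg2//.
have ma : measurable_fun setT (fun t => a0 t / sg) by exact: measurable_funM.
split => //.
- rewrite (_ : _ \o _ = (fun t => (EFin \o a0) t * (sg^-1)%:E)%E)//.
  exact: integrableZr.
- by rewrite RintegralZr// a0I mul0r.
- have -> : (\int[P]_t ((a0 t / sg) ^+ 2)%:E = \int[P]_t ((s2^-1)%:E * (a0 t ^+ 2)%:E))%E.
    by apply: eq_integral => t _; rewrite exprMn exprVn sg2 -EFinM mulrC.
  rewrite ge0_integralZl//.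
  + by rewrite -s2E -EFinM mulVf// gt_eqF.
  + by apply/measurable_EFinP; exact: measurable_funX.
  + by move=> t _; rewrite lee_fin sqr_ge0.
  + by rewrite lee_fin invr_ge0 ltW.
move=> del d0; apply: (@tail_scale e) => //.
  move=> t; rewrite /a0 !normrM normfV (gtr0_norm sg0) -mulrA mulrC.
  apply: ler_wpM2r; first by rewrite -normrM.
  apply: ler_pM => //; first by rewrite invr_ge0 ltW.
  rewrite lef_pV2 ?posrE ?sqrtr_gt0//; exact: ler_wsqrtr.
by apply: tl; rewrite divr_gt0// exprn_gt0.
Qed.

End model.

Section noise_events.
Context {R : realType} {dZ : nat} dO {Omega : measurableType dO}.
Notation Obs := (Obs R dZ).
Notation Z := (Zsp R dZ).
Variables (P : probability Obs R) (Pr : probability Omega R) (D : nat -> Omega -> Obs).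
Hypothesis hD : iid_sample Pr D P.
Variables x y : Obs -> R.
Hypotheses (mx : measurable_fun setT x) (my : measurable_fun setT y).
Hypothesis cixy : ci P x y.
Hypothesis inty : P.-integrable setT (EFin \o y).
Variables (f g v : Z -> R).
Hypothesis mf : measurable_fun setT f.
Hypothesis cg : cond_exp P y g.
Hypothesis cv : cond_exp P (fun t => (y t - g t.2) ^+ 2) v.
Variable est : regression R dZ.
Hypothesis mest : measurable_regression est.
Variables (n : nat) (n0 : (0 < n)%N).

Let dif (i : 'I_n) om := f (D i om).2 -
  est [tuple x (D j om) | j < n] [tuple (D j om).2 | j < n] (D i om).2.

(** The regression error [dif] as a function of the blinded sample: the fit of [x] on Z never looks
    at [y]. *)
Let del (i : 'I_n) (u : n.-tuple (R * Z)) := f (tnth u i).2 -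
  est [tuple (tnth u j).1 | j < n] [tuple (tnth u j).2 | j < n] (tnth u i).2.

Let pi (t : Obs) := (x t, t.2).

Let mz2 i : measurable_fun setT (fun u : n.-tuple (R * Z) => (tnth u i).2).
Proof. by apply: (measurableT_comp measurable_snd); exact: measurable_tnth. Qed.

Let mdel i : measurable_fun setT (del i).
Proof.
apply: measurable_funB; first exact: (measurableT_comp mf (mz2 i)).
have m1 : measurable_fun setT (fun u : n.-tuple (R * Z) =>
   (([tuple (tnth u j).1 | j < n], [tuple (tnth u j).2 | j < n]), (tnth u i).2)).
  apply/measurable_fun_pairP; split; last exact: mz2.
  apply/measurable_fun_pairP; split.
    apply: (@measurable_tuple_of _ _ _ _ _ (fun j (u : n.-tuple (R * Z)) => (tnth u j).1)).
    by move=> j; apply: (measurableT_comp measurable_fst); exact: measurable_tnth.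
  by apply: (@measurable_tuple_of _ _ _ _ _ (fun j (u : n.-tuple (R * Z)) => (tnth u j).2)).
exact: (measurableT_comp (@mest n) m1).
Qed.

Let delE i om : del i (blind pi (sample D n om)) = dif i om.
Proof.
have e : forall j, tnth (blind pi (sample D n om)) j = pi (D j om).
  by move=> j; rewrite !tnth_mktuple.
rewrite /del /dif e /=; congr (_ - est _ _ _).
- by apply: eq_from_tnth => j; rewrite !tnth_mktuple.
- by apply: eq_from_tnth => j; rewrite !tnth_mktuple.
Qed.

Lemma measurable_dif i : measurable_fun setT (dif i).
Proof.
have [mD _] := hD.
have mpi : measurable_fun setT pi.
  by apply/measurable_fun_pairP; split => //; exact: measurable_obsz.
rewrite (_ : dif i = (fun om => del i (blind pi (sample D n om)))).
  apply: (measurableT_comp (mdel i)).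
  exact: (measurableT_comp (measurable_blind mpi (n:=n)) (measurable_sample mD (n:=n))).
by apply/funext => om; rewrite delE.
Qed.

Let B om := n%:R^-1 * \sum_(i < n) dif i om ^+ 2 * v (D i om).2.

Let mv : measurable_fun setT v. Proof. by case: cv => _ []. Qed.
Let mg : measurable_fun setT g. Proof. by case: cg => _ []. Qed.

Let mB : measurable_fun setT B.
Proof.
have [mD _] := hD.
apply: measurable_funM => //; apply: measurable_sum => i; apply: measurable_funM.
  by apply: measurable_funX; exact: measurable_dif.
exact: (measurableT_comp (measurable_compz mv)).
Qed.

(* [v] is nonnegative only almost surely, whence the truncation by [0]. *)
Let bad_le b : 0 <= b ->
  (Pr [set om | (n%:R * b < \sum_(i < n) del i (blind pi (sample D n om)) ^+ 2 *
     Num.max 0 (v (pi (D i om)).2))%R] <= Pr [set om | (b < `|B om / 1|)%R])%E.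
Proof.
move=> b0; have [mD [PD indD]] := hD.
have n0' : 0 < n%:R :> R by rewrite ltr0n.
have [N [mN N0 sub]] := cond_exp_ge0_ae cv (fun t => sqr_ge0 (y t - g t.2)).
pose NN := \bigcup_(i in [set: nat]) (D i @^-1` N).
have mDN i : measurable (D i @^-1` N).
  by rewrite -[X in measurable X]setTI; exact: mD.
have NN0 : Pr NN = 0%E.
  apply/eqP; rewrite eq_le measure_ge0 andbT.
  suff /negligibleP : Pr.-negligible NN by move=> ->//; exact: bigcup_measurable.
  apply: negligible_bigcup => i.
  by exists (D i @^-1` N); split => //; exact: etrans (PD i _ mN) N0.
rewrite -[leRHS]adde0 -NN0; apply: measure_cover2.
- apply: (@bad_measurable _ _ _ Obs (R * Z)%type Omega R D mD pi
    (fun u => Num.max 0 (v u.2)) _ _ n del mdel b).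
    by apply/measurable_fun_pairP; split => //; exact: measurable_obsz.
  by apply: measurable_maxr => //; exact: (measurableT_comp mv measurable_snd).
- apply: measurable_gt_set; apply: measurableT_comp => //.
  by apply: measurable_funM.
- exact: bigcup_measurable.
move=> om /= hb; have [NNo|nN] := pselect (NN om); [by right|left].
have e : \sum_(i < n) del i (blind pi (sample D n om)) ^+ 2 *
     Num.max 0 (v (pi (D i om)).2) = \sum_(i < n) dif i om ^+ 2 * v (D i om).2.
  apply: eq_bigr => i _; rewrite delE; congr (_ * _); apply/max_idPr.
  by apply: contrapT => h; apply: nN; exists i => //; exact: sub.
rewrite e in hb; rewrite /= divr1 /B.
apply: (lt_le_trans _ (ler_norm _)).
by rewrite mulrC ltr_pdivlMr// mulrC.
Qed.

Let xi (t : Obs) := y t - g t.2.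

(** [x] and [y] are parameters so that the second cross term follows by exchanging them. The event
    for [B] is written with [/ 1] as in [littleo_unif]. *)
Lemma noise_events (w : Z -> R) (C b h : R) : measurable_fun setT w ->
  (forall z, `|w z| <= C) -> 0 <= b -> 0 < h ->
  (Pr [set om | (n%:R * h < \sum_(i < n) (dif i om * xi (D i om)) ^+ 2)%R]
     <= (b / h)%:E + Pr [set om | (b < `|B om / 1|)%R])%E /\
  (Pr [set om | (n%:R * h ^+ 2 <
     (\sum_(i < n) dif i om * w (D i om).2 * xi (D i om)) ^+ 2)%R]
     <= (C ^+ 2 * b / h ^+ 2)%:E + Pr [set om | (b < `|B om / 1|)%R])%E.
Proof.
move=> mw wC b0 h0; have [mD [PD indD]] := hD.
have mpi : measurable_fun setT pi.
  by apply/measurable_fun_pairP; split => //; exact: measurable_obsz.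
have mxi : measurable_fun setT xi by apply: measurable_funB => //; exact: measurable_compz.
have mV : measurable_fun setT (fun u : R * Z => Num.max 0 (v u.2)).
  by apply: measurable_maxr => //; exact: (measurableT_comp mv measurable_snd).
have V0 (u : R * Z) : 0 <= Num.max 0 (v u.2) by rewrite le_max lexx.
have hs := noise_sign mx my cixy inty cg.
have hq := noise_square mx my cixy cg cv.
split.
- apply: le_trans (leeD2l _ (bad_le b0)).
  under [X in Pr X]eq_set do under eq_bigr do rewrite -delE.
  exact: (@noise_sum_sq _ _ _ Obs (R * Z)%type Omega R Pr P D mD PD indD pi xi
    (fun u => Num.max 0 (v u.2)) mpi mxi mV V0 hq n del n0 mdel b h b0 h0).
- apply: le_trans (leeD2l _ (bad_le b0)).
  under [X in Pr X]eq_set do under eq_bigr do rewrite -delE.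
  apply: (@noise_sq_sum _ _ _ Obs (R * Z)%type Omega R Pr P D mD PD indD pi xi
    (fun u => Num.max 0 (v u.2)) mpi mxi mV V0 hs hq n del n0 mdel (fun u => w u.2) C b h) => //.
  exact: (measurableT_comp mw measurable_snd).
Qed.

End noise_events.

Lemma measure_union_le d (T : measurableType d) (R : realType)
    (m : {measure set T -> \bar R}) (A B : set T) (a b : R) :
  measurable A -> measurable B -> (m A <= a%:E)%E -> (m B <= b%:E)%E ->
  measurable (A `|` B) /\ (m (A `|` B) <= (a + b)%:E)%E.
Proof.
move=> mA mB ha hb; split; first exact: measurableU.
by rewrite EFinD; apply: le_trans (measureU2 _ mA mB) _; exact: leeD.
Qed.

(* A statistic [st] that is squeezed between affine distortions of [N] outside
   the exceptional event [B] inherits the normal approximation of [N]. *)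
Lemma studentized_cdf_close d (T : measurableType d) (R : realType)
    (Pr : probability T R) (N st : T -> R) (B : set T) (eta e1 e2 t : R) :
  measurable_fun setT N -> measurable_fun setT st -> measurable B ->
  0 < eta <= 18^-1 -> (Pr B <= e2%:E)%E ->
  (forall s, (`|Pr [set om | (N om <= s)%R] - (gcdf s)%:E| <= e1%:E)%E) ->
  (forall om, ~ B om ->
    (st om <= t -> N om <= (if 0 <= t then 1 + 9 * eta else 1 - 9 * eta) * t + eta) /\
    (N om <= (if 0 <= t then 1 - 9 * eta else 1 + 9 * eta) * t - eta -> st om <= t)) ->
  (`|Pr [set om | (st om <= t)%R] - Phi t| <= (e1 + e2 + 19 * gK * eta)%:E)%E.
Proof.
move=> mN mst mB /andP[eta0 eta18] PB clt sq.
pose p (A : set T) : R := fine (Pr A).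
have pE A : measurable A -> Pr A = (p A)%:E.
  by move=> mA; rewrite /p fineK// fin_num_measure.
(* The 19 is 18 + 1: rescaling by [l] costs [2 gK] times [9 eta], the shift [gK eta]. *)
have near l x : 2^-1 <= l -> `|l - 1| <= 9 * eta -> `|x| <= eta ->
    `|gcdf (l * t + x) - gcdf t| <= 19 * gK * eta.
  move=> l2 l1 x1; have := gcdf_lip (l * t) (l * t + x).
  have -> : l * t + x - l * t = x by ring.
  move=> h1; have h2 := gcdf_scale t l2.
  have gK0 := @gK_ge0 R.
  have -> : gcdf (l * t + x) - gcdf t =
     (gcdf (l * t + x) - gcdf (l * t)) + (gcdf (l * t) - gcdf t) by ring.
  apply: (le_trans (ler_normD _ _)); apply: (le_trans (lerD h1 h2)).
  have h3 : gK * `|x| <= gK * eta by apply: ler_wpM2l.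
  have h4 : 2 * gK * `|l - 1| <= 2 * gK * (9 * eta).
    by apply: ler_wpM2l => //; exact: mulr_ge0.
  lra.
have mA := measurable_le_set t mst.
rewrite gcdf_fin (pE _ mA) -EFinB abse_EFin lee_fin.
have cover A1 A2 : measurable A1 -> measurable A2 -> A1 `<=` A2 `|` B ->
    p A1 <= p A2 + e2.
  move=> m1 m2 sub; rewrite -lee_fin EFinD -(pE _ m1) -(pE _ m2).
  by apply: le_trans (measure_cover2 Pr m1 m2 mB sub) _; exact: leeD.
pose l1 := if 0 <= t then 1 + 9 * eta else 1 - 9 * eta.
pose l2 := if 0 <= t then 1 - 9 * eta else 1 + 9 * eta.
have l1b : 2^-1 <= l1 /\ `|l1 - 1| <= 9 * eta.
  by rewrite /l1; case: ifP => _; rewrite ler_norml; split;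
    try (apply/andP; split); lra.
have l2b : 2^-1 <= l2 /\ `|l2 - 1| <= 9 * eta.
  by rewrite /l2; case: ifP => _; rewrite ler_norml; split;
    try (apply/andP; split); lra.
have cdf s : `|p [set om | N om <= s] - gcdf s| <= e1.
  by have := clt s; rewrite (pE _ (measurable_le_set s mN)) -EFinB abse_EFin lee_fin.
have up : p [set om | st om <= t] <= p [set om | N om <= l1 * t + eta] + e2.
  apply: cover => //; first exact: measurable_le_set.
  move=> om /= h; have [Bo|nB] := pselect (B om); [by right|left].
  by have [+ _] := sq om nB; apply.
have lo : p [set om | N om <= l2 * t - eta] <= p [set om | st om <= t] + e2.
  apply: cover => //; first exact: measurable_le_set.
  move=> om /= h; have [Bo|nB] := pselect (B om); [by right|left].
  by have [_] := sq om nB; apply.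
have [b1 b2] := l1b; have [b3 b4] := l2b.
have := near _ _ b1 b2 (_ : `|eta| <= eta).
have := near _ _ b3 b4 (_ : `|- eta| <= eta).
rewrite normrN (gtr0_norm eta0) => /(_ (lexx _)) n1 /(_ (lexx _)) n2.
have := cdf (l1 * t + eta); have := cdf (l2 * t - eta).
move: n1 n2; rewrite !ler_norml => /andP[? ?] /andP[? ?] /andP[? ?] /andP[? ?].
by apply/andP; split; lra.
Qed.

Lemma measurable_inv_sqrt (R : realType) :
  measurable_fun setT (fun x : R => (Num.sqrt x)^-1).
Proof.
rewrite (_ : (fun x => _) = (fun x : R => Num.sqrt x `^ (-1))); last first.
  by apply/funext => x; rewrite powR_inv1.
apply: (measurableT_comp (measurable_powR _)).
apply: nondecreasing_measurable => // x y; exact: ler_wsqrtr.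
Qed.

Theorem theorem8 (R : realType) (dZ : nat)
  (dO : measure_display) (Omega : measurableType dO)
  (* the sample space carrying, for each P, an i.i.d. sample with law P *)
  (Pr : probability (Obs R dZ) R -> probability Omega R)
  (D : probability (Obs R dZ) R -> nat -> Omega -> Obs R dZ)
  (* the two regression methods *)
  (estf estg : regression R dZ)
  (* versions of f_P, g_P, u_P, v_P *)
  (fP gP uP vP : probability (Obs R dZ) R -> Zsp R dZ -> R)
  (Pset : set (probability (Obs R dZ) R)) (C c : R) :
  measurable_regression estf -> measurable_regression estg ->
  (forall P, Pset P -> P0 P) ->
  (forall P, Pset P -> iid (Pr P) (D P) P) ->
  (forall P, Pset P ->
     cond_exp P (fun t => t.1.1) (fP P) /\
     cond_exp P (fun t => t.1.2) (gP P) /\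
     cond_exp P (fun t => (t.1.1 - fP P t.2) ^+ 2) (uP P) /\
     cond_exp P (fun t => (t.1.2 - gP P t.2) ^+ 2) (vP P)) ->
  0 < C -> 0 < c ->
  littleo_unif Pset Pr
    (fun P n om => A_f (D P) estf (fP P) n om * A_g (D P) estg (gP P) n om)
    (fun n => n%:R^-1) ->
  littleo_unif Pset Pr (fun P n om => B_f (D P) estf (fP P) (vP P) n om)
    (fun n => 1) ->
  littleo_unif Pset Pr (fun P n om => B_g (D P) estg (gP P) (uP P) n om)
    (fun n => 1) ->
  (exists eta : R, 0 < eta /\ exists M : R, forall P, Pset P ->
     (\int[P]_t (`|(t.1.1 - fP P t.2) * (t.1.2 - gP P t.2)| `^ (2 + eta))%:E
        <= M%:E)%E) ->
  (forall P, Pset P -> exists w, Wset P (fP P) (gP P) C c w) ->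
  forall e : R, 0 < e -> exists N : nat, forall n : nat, (N <= n)%N ->
  forall P, Pset P -> forall w, Wset P (fP P) (gP P) C c w -> forall t : R,
    (`| Pr P [set om | (Tstat (D P) estf estg w n om <= t)%R] - Phi t | <= e%:E)%E.
Proof.
move=> mestf mestg hP0 hiid hce C0 c0 hA hBf hBg [eta0 [eta00 [M hM]]] _ e e0.
have gK0 := @gK_ge0 R.
(* The budget: [e / 4] for the limit theorem, [e / 4] for the distortion of [t], and [11 e2] for the
   exceptional events, three of which cost [e2] and four [2 e2]. *)
pose e1 := e / 4; pose e2 := e / 32.
have e10 : 0 < e1 by rewrite divr_gt0.
have e20 : 0 < e2 by rewrite divr_gt0.
pose eta := Num.min 18^-1 (e / (4 * (19 * gK + 1))).
have g190 : 0 < 4 * (19 * gK + 1) :> R by lra.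
have etap : 0 < eta by rewrite lt_min; apply/andP; split => //; exact: divr_gt0.
have eta18 : eta <= 18^-1 by rewrite ge_min lexx.
have etae : eta * (4 * (19 * gK + 1)) <= e.
  by rewrite -ler_pdivlMr// ge_min lexx orbT.
have C20 : 0 < C ^+ 2 by rewrite exprn_gt0.
have ec0 : 0 < eta ^+ 2 * c by rewrite mulr_gt0// exprn_gt0.
(* The term [eta ^ 2 * c] in the denominator forces [h <= 1] as well as the inequality of
   [remainder_bounds]. *)
pose h := eta ^+ 2 * c / (9 * C ^+ 2 + 6 + eta ^+ 2 * c).
have hd0 : 0 < 9 * C ^+ 2 + 6 + eta ^+ 2 * c by lra.
have h0 : 0 < h by rewrite divr_gt0.
have hE : h * (9 * C ^+ 2 + 6 + eta ^+ 2 * c) = eta ^+ 2 * c by rewrite divfK// gt_eqF.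
have h1 : h <= 1 by rewrite ler_pdivrMr// mul1r; lra.
have hh : h * (9 * C ^+ 2 + 6) <= eta ^+ 2 * c.
  by rewrite -hE; apply: ler_wpM2l; [exact: ltW|lra].
(* Small enough for both Markov terms, [b / h] and [C ^ 2 * b / h ^ 2]. *)
pose b := e2 * h ^+ 2 / (C ^+ 2 + 1).
have C210 : 0 < C ^+ 2 + 1 by lra.
have h20 : 0 < h ^+ 2 by rewrite exprn_gt0.
have b0 : 0 < b by rewrite divr_gt0// mulr_gt0.
have bE : b * (C ^+ 2 + 1) = e2 * h ^+ 2 by rewrite divfK// gt_eqF.
have bh : b / h <= e2.
  rewrite ler_pdivrMr//.
  have : h ^+ 2 <= h by rewrite expr2 ger_pMr.
  nra.
have bh2 : C ^+ 2 * b / h ^+ 2 <= e2.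
  by rewrite ler_pdivrMr//; lra.
pose Le del := ((`|M| + 1) / del) `^ eta0^-1.
pose q := C / Num.sqrt c.
have q0 : 0 < q by rewrite divr_gt0// sqrtr_gt0.
pose Lf del := q * Le (del / q ^+ 2).
have Lf0 del : 0 <= Lf del.
  by apply: mulr_ge0; [exact: ltW|exact: powR_ge0].
have [N1 H1] := @clt_uniform _ _ (Obs R dZ) Omega R Lf e1 Lf0 e10.
have [N2 H2] := @wlln_uniform _ _ (Obs R dZ) Omega R Lf eta e2 Lf0 etap e20.
have [N3 H3] := hA h h0 e2 e20.
have [N4 H4] := hBf b b0 e2 e20.
have [N5 H5] := hBg b b0 e2 e20.
exists (maxn 1 (maxn N1 (maxn N2 (maxn N3 (maxn N4 N5))))) => n.
rewrite !geq_max => /and5P[n0 n1 n2 n3 /andP[n4 n5]] P PP w Ww t.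
have [mw [wC _]] := Ww.
have [_ cix] : abs_cont P /\ ci P (fun t => t.1.1) (fun t => t.1.2) := hP0 P PP.
have hD : iid_sample (Pr P) (D P) P := hiid P PP.
have [cf [cg [cu cv]]] := hce P PP.
have [mD _] := hD.
have [mf mg] : measurable_fun setT (fP P) /\ measurable_fun setT (gP P).
  by case: cf => _ [? _]; case: cg => _ [? _].
have mx := @measurable_obsx R dZ; have my := @measurable_obsy R dZ.
(* [cond_exp] asks for an integrable or a nonnegative function. The coordinates X and Y take the
   value -1 at a point above [z0], so they must be integrable. *)
pose z0 : Zsp R dZ := [tuple 0 | i < dZ].
have intx : P.-integrable setT (EFin \o (fun t : Obs R dZ => t.1.1)).
  have [_ [_ [[//|h'] _]]] := cf.
  by have := h' ((-1, 0), z0); rewrite /= leNgt ltrN10.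
have inty : P.-integrable setT (EFin \o (fun t : Obs R dZ => t.1.2)).
  have [_ [_ [[//|h'] _]]] := cg.
  by have := h' ((0, -1), z0); rewrite /= leNgt ltrN10.
have n0' : 0 < n%:R :> R by rewrite ltr0n.
have nn0 : n%:R != 0 :> R by rewrite gt_eqF.
pose ep (t : Obs R dZ) := t.1.1 - fP P t.2.
pose xi (t : Obs R dZ) := t.1.2 - gP P t.2.
have mep : measurable_fun setT ep by apply: measurable_funB => //; exact: measurable_compz.
have mxi : measurable_fun setT xi by apply: measurable_funB => //; exact: measurable_compz.
(* [sg] varies with [P] and [w], but the modulus [Lf] does not, so the thresholds fixed above
   apply. *)
have [sg [sg0 csg std]] : exists sg : R, [/\ 0 < sg, c <= sg ^+ 2 &
    standardized P Lf (fun t => ep t * xi t * w t.2 / sg)].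
  apply: (@standardize R dZ P (fP P) (gP P) mf mg w C c Le C0 c0) => //.
    exact: (noise_sign mx my cix inty cg).
  move=> del d0; apply: (@tail_of_moment _ _ R P (fun t => ep t * xi t) eta0 M del) => //.
    exact: measurable_funM.
  exact: hM.
pose a (t : Obs R dZ) := ep t * xi t * w t.2 / sg.
have ma : measurable_fun setT a by case: std.
pose df (i : 'I_n) om := fP P (D P i om).2 - fhat (D P) estf n om (D P i om).2.
pose dg (i : 'I_n) om := gP P (D P i om).2 - ghat (D P) estg n om (D P i om).2.
have mdf i : measurable_fun setT (df i).
  exact: (@measurable_dif R dZ dO Omega P (Pr P) (D P) hD (fun t => t.1.1) mx (fP P) mf estf mestf n i).
have mdg i : measurable_fun setT (dg i).
  exact: (@measurable_dif R dZ dO Omega P (Pr P) (D P) hD (fun t => t.1.2) my (gP P) mg estg mestg n i).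
have [F1 F2] := @noise_events R dZ dO Omega P (Pr P) (D P) hD (fun t => t.1.1)
  (fun t => t.1.2) mx my cix inty (fP P) (gP P) (vP P) mf cg cv estf mestf n n0 w C b h
  mw wC (ltW b0) h0.
have [G1 G2] := @noise_events R dZ dO Omega P (Pr P) (D P) hD (fun t => t.1.2)
  (fun t => t.1.1) my mx (ciC cix) intx (gP P) (fP P) (uP P) mg cf cu estg mestg n n0 w C b h
  mw wC (ltW b0) h0.
have [W1 W2] := H2 n n2 (Pr P) P (D P) a hD std.
pose E1 := [set om | h < `|A_f (D P) estf (fP P) n om * A_g (D P) estg (gP P) n om / n%:R^-1|].
pose E2 := [set om | n%:R * h < \sum_(i < n) (df i om * xi (D P i om)) ^+ 2].
pose E3 := [set om | n%:R * h ^+ 2 < (\sum_(i < n) df i om * w (D P i om).2 * xi (D P i om)) ^+ 2].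
pose E4 := [set om | n%:R * h < \sum_(i < n) (dg i om * ep (D P i om)) ^+ 2].
pose E5 := [set om | n%:R * h ^+ 2 < (\sum_(i < n) dg i om * w (D P i om).2 * ep (D P i om)) ^+ 2].
pose E6 := [set om | eta < `|(\sum_(i < n) a (D P i om) ^+ 2) / n%:R - 1|].
pose E7 := [set om | n%:R ^+ 2 * eta < (\sum_(i < n) a (D P i om)) ^+ 2].
have mDf (f : Obs R dZ -> R) i : measurable_fun setT f -> measurable_fun setT (fun om => f (D P i om)).
  by move=> mf'; exact: (measurableT_comp mf').
have mwz := measurable_compz mw.
have mE1 : measurable E1.
  apply: measurable_gt_set; apply: measurableT_comp => //; apply: measurable_funM => //.
  apply: measurable_funM; apply: measurable_funM => //; apply: measurable_sum => i.
    by apply: measurable_funX; exact: mdf.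
  by apply: measurable_funX; exact: mdg.
have mE2 : measurable E2.
  apply: measurable_gt_set; apply: measurable_sum => i; apply: measurable_funX.
  by apply: measurable_funM; [exact: mdf|exact: mDf].
have mE3 : measurable E3.
  apply: measurable_gt_set; apply: measurable_funX; apply: measurable_sum => i.
  apply: measurable_funM; last exact: mDf.
  by apply: measurable_funM; [exact: mdf|exact: (mDf (fun t => w t.2))].
have mE4 : measurable E4.
  apply: measurable_gt_set; apply: measurable_sum => i; apply: measurable_funX.
  by apply: measurable_funM; [exact: mdg|exact: mDf].
have mE5 : measurable E5.
  apply: measurable_gt_set; apply: measurable_funX; apply: measurable_sum => i.
  apply: measurable_funM; last exact: mDf.
  by apply: measurable_funM; [exact: mdg|exact: (mDf (fun t => w t.2))].
have mE6 : measurable E6.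
  apply: measurable_gt_set; apply: measurableT_comp => //; apply: measurable_funB => //.
  apply: measurable_funM => //; apply: measurable_sum => i; apply: measurable_funX.
  exact: mDf.
have mE7 : measurable E7.
  apply: measurable_gt_set; apply: measurable_funX; apply: measurable_sum => i.
  exact: mDf.
have PE1 : (Pr P E1 <= e2%:E)%E := H3 n n3 P PP.
have add2 (x : R) (X Y : \bar R) : x <= e2 -> (X <= x%:E + Y)%E -> (Y <= e2%:E)%E ->
    (X <= (e2 + e2)%:E)%E.
  move=> xe Xx Ye; apply: (le_trans Xx); rewrite EFinD; exact: leeD.
have Bf : (Pr P [set om | (b < `|B_f (D P) estf (fP P) (vP P) n om / 1|)%R] <= e2%:E)%E
  := H4 n n4 P PP.
have Bg : (Pr P [set om | (b < `|B_g (D P) estg (gP P) (uP P) n om / 1|)%R] <= e2%:E)%E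
  := H5 n n5 P PP.
have PE2 : (Pr P E2 <= (e2 + e2)%:E)%E := add2 _ _ _ bh F1 Bf.
have PE3 : (Pr P E3 <= (e2 + e2)%:E)%E := add2 _ _ _ bh2 F2 Bf.
have PE4 : (Pr P E4 <= (e2 + e2)%:E)%E := add2 _ _ _ bh G1 Bg.
have PE5 : (Pr P E5 <= (e2 + e2)%:E)%E := add2 _ _ _ bh2 G2 Bg.
have [m12 P12] := measure_union_le mE1 mE2 PE1 PE2.
have [m13 P13] := measure_union_le m12 mE3 P12 PE3.
have [m14 P14] := measure_union_le m13 mE4 P13 PE4.
have [m15 P15] := measure_union_le m14 mE5 P14 PE5.
have [m16 P16] := measure_union_le m15 mE6 P15 W1.
have [m17 P17] := measure_union_le m16 mE7 P16 W2.
set B := E1 `|` _ `|` _ `|` _ `|` _ `|` _ `|` _ in m17 P17.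
pose dl (i : 'I_n) om := (df i om * xi (D P i om) + dg i om * ep (D P i om)
  + df i om * dg i om) * w (D P i om).2 / sg.
(* Expanding [(ep + df) (xi + dg) w]: the leading product is [sg * a], the other three terms form
   [sg * dl]. *)
have RwE (i : 'I_n) om : Rw (D P) estf estg w n om i = sg * (a (D P i om) + dl i om).
  rewrite /Rw /a /dl.
  rewrite (_ : (D P i om).1.1 - fhat (D P) estf n om (D P i om).2 = ep (D P i om) + df i om);
    last by rewrite /ep /df; ring.
  rewrite (_ : (D P i om).1.2 - ghat (D P) estg n om (D P i om).2 = xi (D P i om) + dg i om);
    last by rewrite /xi /dg; ring.
  by field; rewrite gt_eqF.
have mdl i : measurable_fun setT (dl i).
  apply: measurable_funM => //; apply: measurable_funM; last exact: (mDf (fun t => w t.2)).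
  apply: measurable_funD; last by apply: measurable_funM; [exact: mdf|exact: mdg].
  by apply: measurable_funD; apply: measurable_funM;
    [exact: mdf|exact: mDf|exact: mdg|exact: mDf].
pose r om (i : 'I_n) := sg * (a (D P i om) + dl i om).
have mr i : measurable_fun setT (fun om => r om i).
  by apply: measurable_funM => //; apply: measurable_funD; [exact: mDf|exact: mdl].
pose st om := ((\sum_(i < n) r om i) / Num.sqrt n%:R) /
  Num.sqrt ((\sum_(i < n) r om i ^+ 2) / n%:R - ((\sum_(i < n) r om i) / n%:R) ^+ 2).
have TE om : Tstat (D P) estf estg w n om = st om.
  rewrite /Tstat /st; congr (_ / _ / Num.sqrt (_ / _ - (_ / _) ^+ 2)).
  - by apply: eq_bigr => i _; exact: RwE.
  - by apply: eq_bigr => i _; rewrite RwE.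
  - by apply: eq_bigr => i _; exact: RwE.
have mst : measurable_fun setT st.
  have mS : measurable_fun setT (fun om => \sum_(i < n) r om i).
    by apply: measurable_sum => i; exact: mr.
  have mV : measurable_fun setT (fun om => (\sum_(i < n) r om i ^+ 2) / n%:R -
      ((\sum_(i < n) r om i) / n%:R) ^+ 2).
    apply: measurable_funB; last first.
      by apply: measurable_funX; exact: (measurable_funM mS (measurable_cst _)).
    apply: measurable_funM; last exact: measurable_cst.
    by apply: measurable_sum => i; apply: measurable_funX; exact: mr.
  apply: measurable_funM; last exact: (measurableT_comp (@measurable_inv_sqrt R) mV).
  exact: (measurable_funM mS (measurable_cst _)).
under [X in Pr P X]eq_set do rewrite TE.
apply: le_trans (@studentized_cdf_close _ Omega R (Pr P)
  (fun om => (\sum_(i < n) a (D P i om)) / Num.sqrt n%:R) st B eta e1 _ t _ mst m17 _ P17 _ _) _.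
- by apply: measurable_funM => //; apply: measurable_sum => i; exact: mDf.
- by rewrite etap.
- by move=> s; exact: (H1 n n1 (Pr P) P (D P) a hD std s).
- move=> om nB.
  have [[e_1 e_2 e_3] [e_4 e_5] [e_6 e_7]] : [/\ [/\ ~ E1 om, ~ E2 om & ~ E3 om],
      ~ E4 om /\ ~ E5 om & ~ E6 om /\ ~ E7 om].
    by split; split => Eom; apply: nB; rewrite /B /=; tauto.
  move: e_1 e_2 e_3 e_4 e_5 e_6 e_7; rewrite /E1 /E2 /E3 /E4 /E5 /E6 /E7 /=.
  have NL (x y : R) : ~ (x < y) -> y <= x by rewrite leNgt => /negP.
  move=> /NL e_1 /NL e_2 /NL e_3 /NL e_4 /NL e_5 /NL e_6 /NL e_7.
  (* Dividing [A_f A_g] by [1 / n] leaves the product of the two sums over [n], so the little-o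
     event bounds it by [h]. *)
  have fg : (\sum_(i < n) df i om ^+ 2) * (\sum_(i < n) dg i om ^+ 2) <= n%:R * h.
    move: e_1 => /(le_trans (ler_norm _)).
    rewrite invrK /A_f /A_g -/(df _ om).
    rewrite (_ : _ * n%:R = (\sum_(i < n) df i om ^+ 2) * (\sum_(i < n) dg i om ^+ 2) / n%:R).
      by rewrite ler_pdivrMr// [h * _]mulrC.
    by rewrite /df /dg; field.
  have etah : 0 < h <= 1 by rewrite h0.
  have [d1 d2] := @remainder_bounds R n (df ^~ om) (dg ^~ om) (fun i => ep (D P i om))
    (fun i => xi (D P i om)) (fun i => w (D P i om).2) C c h eta sg c0 C0 etah hh sg0 csg
    (fun i => wC _) fg e_2 e_4 e_3 e_5.
  have eta01 : 0 < eta <= 18^-1 by rewrite etap.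
  exact: (@studentize R n (fun i => a (D P i om)) (dl ^~ om) sg eta t n0 sg0 eta01
    e_6 e_7 d1 d2).
rewrite lee_fin /e1 /e2.
have : 19 * gK * eta <= e / 4 by lra.
lra.
Qed.
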